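(* Let $\mathbb K$ be a field and let $F\in R=\mathbb K[x,y,z]$ be the product of two distinct non-degenerate quadrics, such that the partial derivatives of $F$ are algebraically independent over $\mathbb K$. The following conditions are equivalent (where condition (iv) is included under the assumption $\mathrm{char}(\mathbb K)=0$): (i) $J_F$ is a codimension two perfect ideal with minimal graded free resolution $$0\to R(-4)\oplus R(-5)\to R(-3)^3\to R\to R/J_F\to 0.$$ (ii) $\mathrm{indeg}\,\mathrm{Syz}(J_F)=1$ and $\deg R/J_F=7$. (iii) $F$ is a free divisor. (iv) ($\mathrm{char}(\mathbb K)=0$) Up to a linear change of variables (and a nonzero scalar factor), $F=(x^2+yz)(x^2+vy^2+yz)$ for a certain nonzero $v\in\mathbb K$.
   Context: $R$ is standard graded. Quadrics here are homogeneous polynomials of degree $2$, considered up to nonzero scalars; non-degenerate means that they define smooth conics. $J_F$ is the ideal generated by the three partial derivatives of $F$; $\mathrm{Syz}(J_F)\subset R^3$ is the syzygy module of these partial derivatives and $\mathrm{indeg}\,\mathrm{Syz}(J_F)$ is the least (standard) degree of a nonzero element of it; $\deg R/J_F$ is the multiplicity (degree) of $R/J_F$. $F$ is a free divisor if $J_F$ is a codimension two perfect ideal (equivalently $J_F$ has codimension two and $\mathrm{Syz}(J_F)$ is a free $R$-module). *)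

(* Defs.v *)
From HB Require Import structures.
From mathcomp Require Import all_boot all_order all_algebra.
From mathcomp.multinomials Require Import mpoly.

Set Implicit Arguments.
Unset Strict Implicit.
Unset Printing Implicit Defensive.

Import GRing.Theory.
Local Open Scope ring_scope.

(* Ideals of R = K[x_1, .., x_n] are Prop-valued predicates on {mpoly K[n]}, as
   membership is not decidable a priori; prime ideals, which are only ever
   quantified over, use the boolean predicates of ring_quotient. *)

Section CommutativeAlgebra.
Variables (K : fieldType) (n : nat).
Local Notation R := {mpoly K[n]}.

Definition gen_ideal (m : nat) (f : 'I_m -> R) (p : R) : Prop :=
  exists c : 'I_m -> R, p = \sum_(i < m) c i * f i.

Definition jacobian_ideal (F : R) : R -> Prop :=
  gen_ideal (fun i : 'I_n => F^`M(i)).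

Definition is_syzygy (F : R) (s : 'rV[R]_n) : Prop :=
  \sum_(i < n) s 0 i * F^`M(i) = 0.

Definition indeg_syz (F : R) (d : nat) : Prop :=
  let nz_homog_syz (e : nat) (s : 'rV[R]_n) :=
    [/\ s != 0, is_syzygy F s & forall i, s 0 i \is e.-homog] in
  (exists s, nz_homog_syz d s) /\
  (forall e s, nz_homog_syz e s -> (d <= e)%N).

Definition alg_independent (m : nat) (t : m.-tuple R) : Prop :=
  forall P : {mpoly K[m]}, P \mPo t = 0 -> P = 0.

(* idealr_closed includes 1 \notin P *)
Definition prime_ideal (P : {pred R}) : Prop :=
  idealr_closed P /\ prime_idealr_closed P.

Definition height_ge (P : {pred R}) (m : nat) : Prop :=
  exists Q : nat -> {pred R},
    [/\ forall i, (i <= m)%N -> prime_ideal (Q i),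
        forall i, (i < m)%N ->
          {subset Q i <= Q i.+1} /\ ~ {subset Q i.+1 <= Q i}
      & Q m =i P].

(* The minimum of the heights of the primes containing I. *)
Definition codim (I : R -> Prop) (c : nat) : Prop :=
  let prime_over (P : {pred R}) :=
    prime_ideal P /\ forall f, I f -> f \in P in
  (forall P, prime_over P -> height_ge P c) /\
  (exists2 P, prime_over P & ~ height_ge P c.+1).

(* The requirement that f_0, .., f_(m-1) generate a proper ideal is omitted: it
   is automatic for sequences in a proper ideal, and without it the unit ideal
   has no finite grade, in accordance with the convention that it is oo. *)
Definition regular_seq (m : nat) (f : nat -> R) : Prop :=
  forall k u, (k < m)%N ->
    gen_ideal (fun i : 'I_k => f i) (u * f k) ->
    gen_ideal (fun i : 'I_k => f i) u.

Definition grade (I : R -> Prop) (g : nat) : Prop :=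
  let regular_in m f := regular_seq m f /\ forall i, (i < m)%N -> I (f i) in
  (exists f, regular_in g f) /\ (forall m f, regular_in m f -> (m <= g)%N).

(* The list of lists b = [:: b_1; ..; b_l] encodes the graded free modules
   F_k = \bigoplus_(a <- b_k) R(-a) for k > 0, with F_k = 0 for k > l, and
   F_0 = R. Since lists are indexed from 0, F_(k+1) has rank [rk b k].
   Elements are row vectors, and maps act by multiplication on the right. *)

Definition rk (b : seq (seq nat)) (k : nat) : nat := size (nth [::] b k).

(* M is homogeneous of degree 0 as a map
   \bigoplus_(a <- s) R(-a) -> \bigoplus_(c <- t) R(-c). *)
Definition graded_mx (s t : seq nat) (M : 'M[R]_(size s, size t)) : Prop :=
  forall (i : 'I_(size s)) (j : 'I_(size t)),
    let a := nth 0%N s i in let c := nth 0%N t j in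
    if (c <= a)%N then M i j \is (a - c)%N.-homog else M i j == 0.

(* g : F_1 -> F_0 = R and d k : F_(k+2) -> F_(k+1) *)
Definition graded_free_resolution (I : R -> Prop) (b : seq (seq nat))
    (g : 'cV[R]_(rk b 0)) (d : forall k, 'M[R]_(rk b k.+1, rk b k)) : Prop :=
  [/\ @graded_mx (nth [::] b 0) [:: 0%N] g,
      forall k, @graded_mx (nth [::] b k.+1) (nth [::] b k) (d k),
      forall f, I f <-> exists u : 'rV[R]_(rk b 0), f = (u *m g) 0 0,
      forall u : 'rV[R]_(rk b 0),
        u *m g = 0 <-> exists w : 'rV[R]_(rk b 1), u = w *m d 0%N
    & forall k (u : 'rV[R]_(rk b k.+1)),
        u *m d k = 0 <-> exists w : 'rV[R]_(rk b k.+2), u = w *m d k.+1].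

(* All entries lie in the ideal (x_1, .., x_n). *)
Definition minimal_maps (b : seq (seq nat))
    (g : 'cV[R]_(rk b 0)) (d : forall k, 'M[R]_(rk b k.+1, rk b k)) : Prop :=
  (forall i, (g i 0)@_0%MM = 0) /\ (forall k i j, (d k i j)@_0%MM = 0).

Definition has_minimal_resolution (I : R -> Prop) (b : seq (seq nat)) : Prop :=
  exists g d, @graded_free_resolution I b g d /\ @minimal_maps b g d.

(* Projective dimension of R/I for a homogeneous ideal I: in the category of
   finitely generated graded R-modules projective modules are free. *)
Definition proj_dim_le (I : R -> Prop) (l : nat) : Prop :=
  exists b g d, (size b <= l)%N /\ @graded_free_resolution I b g d.

Definition proj_dim (I : R -> Prop) (l : nat) : Prop :=
  proj_dim_le I l /\ forall m, proj_dim_le I m -> (l <= m)%N.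

Definition perfect (I : R -> Prop) : Prop :=
  exists2 g, grade I g & proj_dim I g.

Definition free_divisor (F : R) : Prop :=
  codim (jacobian_ideal F) 2 /\ perfect (jacobian_ideal F).

(* dim_K (R/I)_d = h, for a homogeneous ideal I: the classes of the h forms in
   e are a basis of (R/I)_d. *)
Definition hilbert_fun (I : R -> Prop) (d h : nat) : Prop :=
  exists e : 'I_h -> R,
    [/\ forall i, e i \is d.-homog,
        forall c : 'I_h -> K, I (\sum_i c i *: e i) -> forall i, c i = 0
      & forall f, f \is d.-homog ->
          exists c : 'I_h -> K, I (f - \sum_i c i *: e i)].

(* With p the Hilbert polynomial, the multiplicity is (deg p)! times the leading
   coefficient of p, and the length of R/I when p = 0. *)
Definition degree (I : R -> Prop) (e : nat) : Prop :=
  exists (h : nat -> nat) (p : {poly rat}) (N : nat),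
    [/\ forall d, hilbert_fun I d (h d),
        forall d, (N <= d)%N -> (h d)%:R = p.[d%:R]
      & e%:R = if p == 0 then (\sum_(d < N) h d)%:R
               else lead_coef p * ((size p).-1)`!%:R].

End CommutativeAlgebra.

Section Conics.
Variable K : fieldType.
Local Notation R := {mpoly K[3]}.

(* Smoothness of the conic q = 0 is geometric: the Jacobian criterion holds at
   all points with coordinates in extension fields of K. *)
Definition nondegenerate_quadric (q : R) : Prop :=
  q \is 2.-homog /\
  forall (L : fieldType) (iota : {rmorphism K -> L}) (a : 'I_3 -> L),
    (exists i, a i != 0) -> (map_mpoly iota q).@[a] = 0 ->
    exists i : 'I_3, ((map_mpoly iota q)^`M(i)).@[a] != 0.

Definition distinct_quadrics (q1 q2 : R) : Prop :=
  forall c : K, c != 0 -> q2 <> c *: q1.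

Definition lin_subst (M : 'M[K]_3) (p : R) : R :=
  p \mPo [tuple \sum_(j < 3) M i j *: 'X_j | i < 3].

Definition normal_form (v : K) : R :=
  let x : R := 'X_(0 : 'I_3) in
  let y : R := 'X_(1 : 'I_3) in
  let z : R := 'X_(2%:R : 'I_3) in
  (x ^+ 2 + y * z) * (x ^+ 2 + v *: y ^+ 2 + y * z).

End Conics.

(* Main.v *)
(* Conditions (i)-(iii) are each equivalent to the existence of syzygies s, t of
   the gradient G of F, of degrees 1 and 2, with G = s x t and Syz(G) = R s + R t
   ([hilbert_burch]).

   Given such s and t, counting dimensions shows that the Hilbert function of
   R/J is eventually 7, which also excludes codimension 3. If J is perfect of
   codimension 2, then J is saturated; exactness of the Koszul complex on the
   variables makes Syz(G) free of rank 2, and two minimal generators have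
   degrees 1 and 2 because the partial derivatives are linearly independent.
   If there is a linear syzygy s and the degree is 7, then G = s x C for some C:
   by exactness of the Koszul complex when the coefficients of s span all linear
   forms, and otherwise because failure would make J agree in large degrees with
   an ideal generated by a quadric and a cubic. The Hilbert function then forces s and C
   to generate Syz(G).

   For (iv), s is a linear vector field annihilating q1 q2, hence tangent to both
   conics. In characteristic 0 a trace argument shows that it annihilates q1 and
   q2; it is then skew with respect to both forms, so it vanishes at a point p,
   which lies on the conics. A basis in which q1 is x^2 + yz and p is the point
   (0 : 0 : 1) brings q2 to the form required. *)

Require Import Defs.
From HB Require Import structures.
From mathcomp Require Import all_boot all_order all_algebra.
From mathcomp.multinomials Require Import mpoly.
From mathcomp Require Import ring lra zify.
From mathcomp Require boolp classical_sets.

Set Implicit Arguments.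
Unset Strict Implicit.
Unset Printing Implicit Defensive.

Import GRing.Theory.
Local Open Scope ring_scope.

(** * Factorial rings *)

(** The condition behind most steps is that the entries of a vector have no common factor, in the
    form [par_prop]: whatever is parallel to the vector is a multiple of it. It comes from a regular
    sequence of length 2 or from prime entries, which is one reason why unique factorization comes
    first. Factoriality also makes smooth conics prime, and produces a regular sequence in J by
    prime avoidance over the factors of one partial derivative. Heights are bounded below by regular
    sequences, through Krull's separation lemma, and above by transcendence degree. Algebraic
    independence of the partials enters as their K-linear independence.

    The number 7 is half the second derivative at t = 1 of 1 - 3t^3 + t^4 + t^5, the numerator of
    the Hilbert series read off from the resolution. If G = s x t, then s and t span a free
    submodule of Syz(G), and 7 is the value of the Hilbert function at which it fills Syz(G) in
    large degrees; so the real task in (ii) is to find t from s. There the competing ideal,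
    generated by a quadric and a cubic, would have multiplicity 6 if it were a complete
    intersection; common factors must be excluded as well, whence the argument on the colon
    ideal. *)

Definition dvdr (A : comNzRingType) (a b : A) : Prop := exists c, b = c * a.

Definition prime_elt (A : idomainType) (p : A) : Prop :=
  [/\ p != 0, p \isn't a GRing.unit
    & forall a b, dvdr p (a * b) -> dvdr p a \/ dvdr p b].

(** Uniqueness of the factorization is automatic, because the factors are prime and not merely
    irreducible. *)
Definition factorial_domain (A : idomainType) : Prop :=
  forall a : A, a != 0 -> exists u (s : seq A),
    [/\ u \is a GRing.unit, forall p, p \in s -> prime_elt p
      & a = u * \prod_(p <- s) p].

Section Divisibility.
Variable A : comNzRingType.
Implicit Types a b c d : A.

Lemma dvdr_refl a : dvdr a a.
Proof. by exists 1; rewrite mul1r. Qed.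

Lemma dvdr0 a : dvdr a 0.
Proof. by exists 0; rewrite mul0r. Qed.

Lemma dvdr_trans b a c : dvdr a b -> dvdr b c -> dvdr a c.
Proof. by case=> x -> [y ->]; exists (y * x); rewrite mulrA. Qed.

Lemma dvdr_mull a b c : dvdr a b -> dvdr a (c * b).
Proof. by case=> x ->; exists (c * x); rewrite mulrA. Qed.

Lemma dvdr_mulr a b c : dvdr a b -> dvdr a (b * c).
Proof. by rewrite mulrC; apply: dvdr_mull. Qed.

Lemma dvdrD a b c : dvdr a b -> dvdr a c -> dvdr a (b + c).
Proof. by case=> x -> [y ->]; exists (x + y); rewrite mulrDl. Qed.

Lemma dvdrN a b : dvdr a b -> dvdr a (- b).
Proof. by case=> x ->; exists (- x); rewrite mulNr. Qed.

Lemma dvdrB a b c : dvdr a b -> dvdr a c -> dvdr a (b - c).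
Proof. by move=> ab /dvdrN; apply: dvdrD. Qed.

Lemma dvdrDr a b c : dvdr a (b + c) -> dvdr a b -> dvdr a c.
Proof. by move=> /dvdrB h /h; rewrite addrC addKr. Qed.

End Divisibility.

Section Primes.
Variable A : idomainType.
Implicit Types (p : A) (s : seq A).

Lemma dvdr_mul2l (a b c : A) : a != 0 -> dvdr (a * b) (a * c) -> dvdr b c.
Proof.
by move=> a0 [x xE]; exists x; apply: (mulfI a0); rewrite xE; ring.
Qed.

Lemma prime_not_dvd_unit p u : prime_elt p -> u \is a GRing.unit -> ~ dvdr p u.
Proof.
case=> _ np _ uu [c uE]; move: uu; rewrite uE unitrM => /andP[_].
by rewrite (negbTE np).
Qed.

Lemma prime_dvd_prod p s :
  prime_elt p -> dvdr p (\prod_(q <- s) q) -> exists2 q, q \in s & dvdr p q.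
Proof.
move=> pp; elim: s => [|q s IH].
  by rewrite big_nil => /(prime_not_dvd_unit pp (unitr1 _)).
rewrite big_cons; have [_ _ hp] := pp; case/hp=> [pq|/IH[r rs pr]].
  by exists q; rewrite ?mem_head.
by exists r; rewrite // inE rs orbT.
Qed.

Lemma dvdr_primes p q : prime_elt p -> prime_elt q -> dvdr p q ->
  exists2 u, u \is a GRing.unit & q = u * p.
Proof.
move=> [p0 np _] [q0 nq hq] [u qE]; exists u => //.
have := dvdr_refl q; rewrite {2}qE => /hq[] [v vE].
  case/negP: np; have := q0; rewrite qE mulf_eq0 negb_or => /andP[u0 _].
  apply/unitrPr; exists v; apply: (mulfI u0).
  by rewrite mulr1 {2}vE {1}qE; ring.
apply/unitrPr; exists v; apply: (mulfI p0).
by rewrite mulr1 {2}vE {1}qE; ring.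
Qed.

End Primes.

(** * Gauss's lemma and factoriality of polynomial rings in one variable *)

Section Gauss.
Variable A : idomainType.
Implicit Types (f g q : {poly A}) (p : A).

Lemma dvdr_polyC p f : dvdr p%:P f <-> forall i, dvdr p f`_i.
Proof.
split=> [[c ->] i|h]; first by exists c`_i; rewrite coefMC.
have [g gP] := boolp.choice h.
exists (\poly_(i < size f) g i); apply/polyP=> i; rewrite coefMC coef_poly.
by case: ltnP => fi; rewrite -?gP // nth_default // mul0r.
Qed.

(** Induction on the total size of the two factors: [p] divides the product of their constant
    coefficients, hence one of these; removing that coefficient and cancelling ['X] leaves a smaller
    product. *)
Lemma prime_polyC p : prime_elt p -> prime_elt p%:P.
Proof.
case=> p0 np hp; split; rewrite ?polyC_eq0 //.
  apply/negP; rewrite poly_unitE => /andP[_].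
  by rewrite coefC eqxx (negbTE np).
move=> f g; have [n] := ubnP (size f + size g).
elim: n f g => // n IH f g fg_n fg.
have step (h k : {poly A}) : (size h + size k < n.+1)%N -> dvdr p%:P (h * k) ->
    dvdr p h`_0 -> dvdr p%:P h \/ dvdr p%:P k.
  elim/poly_ind: h => [|h c _] lt hk; first by move=> _; left; apply: dvdr0.
  rewrite coefD coefMX coefC /= add0r => pc.
  have [->|h0] := eqVneq h 0.
    left; rewrite mul0r add0r; apply/dvdr_polyC=> i; rewrite coefC.
    by case: eqP => // _; apply: dvdr0.
  have pC : dvdr p%:P c%:P.
    apply/dvdr_polyC=> i; rewrite coefC.
    by case: eqP => // _; apply: dvdr0.
  have ph : dvdr p%:P (h * k).
    apply/dvdr_polyC=> i.
    have /dvdr_polyC/(_ i.+1) : dvdr p%:P (h * k * 'X).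
      have -> : h * k * 'X = (h * 'X + c%:P) * k - c%:P * k by ring.
      by apply: dvdrB => //; apply: dvdr_mulr.
    by rewrite coefMX.
  have lt' : (size h + size k < n)%N.
    by move: lt; rewrite size_MXaddC (negbTE h0) /= addSn ltnS.
  case: (IH _ _ lt' ph) => [ph'|]; last by right.
  by left; apply: dvdrD => //; apply: dvdr_mulr.
have /dvdr_polyC/(_ 0%N) := fg; rewrite coef0M => /hp[pf|pg].
  exact: step.
case: (step g f _ _ pg); rewrite 1?addnC 1?mulrC //; by [left|right].
Qed.

(** Phrased with primes so that no content has to be chosen. Over a field there are no primes and
    even 0 is primitive, whence the separate hypotheses [f != 0] below. *)
Definition primitive f : Prop := forall p, prime_elt p -> ~ dvdr p%:P f.

Lemma primitive_dvd f g : primitive f -> dvdr g f -> primitive g.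
Proof. by move=> pf gf p pp pg; apply: (pf p pp); apply: dvdr_trans gf. Qed.

Hypothesis factA : factorial_domain A.

(** A prime constant dividing [f] divides its leading coefficient, so the number of prime factors of
    the latter decreases each time one is split off. *)
Lemma primitive_part f : f != 0 -> exists s h,
  [/\ forall p, p \in s -> prime_elt p, primitive h
    & f = (\prod_(p <- s) p)%:P * h].
Proof.
move=> f0; have l0 : lead_coef f != 0 by rewrite lead_coef_eq0.
have [u [s [uu ps lE]]] := factA l0.
have [n] := ubnP (size s).
elim: n f u s uu ps lE {f0 l0} => // n IH f u s uu ps lE sn.
have [[p [pp [g fE]]]|np] := boolp.EM (exists p, prime_elt p /\ dvdr p%:P f);
  last first.
  exists [::], f; split=> //; last by rewrite big_nil mul1r.
  by move=> p pp pf; apply: np; exists p.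
have [p0 _ hp] := pp.
have lE' : lead_coef g * p = u * \prod_(q <- s) q.
  by rewrite -lE fE lead_coefM lead_coefC.
have [q qs pq] : exists2 q, q \in s & dvdr p q.
  apply: (prime_dvd_prod pp).
  have : dvdr p (u * \prod_(q <- s) q) by exists (lead_coef g).
  by case/hp => // /(prime_not_dvd_unit pp uu).
have [v vu qE] := dvdr_primes pp (ps _ qs) pq.
have [||||t [h [pt ph gE]]] := IH g (u * v) (rem q s).
- by rewrite unitrM uu.
- by move=> r /mem_rem; apply: ps.
- apply: (mulIf p0); rewrite lE' (perm_big _ (perm_to_rem qs)) /= big_cons.
  by rewrite {1}qE; ring.
- by rewrite size_rem //; move: sn; case: (s) qs.
exists (p :: t), h; split=> // [r|].
  by rewrite inE => /orP[/eqP->|/pt].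
by rewrite fE gE big_cons polyCM; ring.
Qed.

(** Over a domain [%|] is divisibility up to a nonzero constant [c]. The prime factors of [c] do not
    divide the primitive [q], so they divide the cofactor and cancel one by one. *)
Lemma gauss_dvd q f : primitive q -> (q %| f)%R -> dvdr q f.
Proof.
move=> pq /Pdiv.Idomain.dvdpP[[c h] /= c0 cE].
have [u [s [uu ps cE']]] := factA c0.
elim: s u c h uu ps cE' cE {c0} => [|p s IH] u c h uu ps cE' cE.
  exists (u^-1 *: h); move: cE; rewrite cE' big_nil mulr1 => cE.
  by rewrite -scalerAl -cE scalerA mulVr ?scale1r.
have pp : prime_elt p by apply: ps; rewrite mem_head.
have [p0 _ _] := pp.
have [_ _ hp] := prime_polyC pp.
have [h' hE] : dvdr p%:P h.
  have : dvdr p%:P (h * q).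
    exists ((u * \prod_(r <- s) r) *: f).
    by rewrite -cE cE' big_cons -!mul_polyC !polyCM; ring.
  by case/hp => // /(pq _ pp).
apply: (IH u (u * \prod_(r <- s) r) h') => //.
  by move=> r rs; apply: ps; rewrite inE rs orbT.
have p0' : p%:P != 0 by rewrite polyC_eq0.
apply: (mulfI p0'); transitivity (c *: f).
  by rewrite cE' big_cons -!mul_polyC !polyCM; ring.
by rewrite cE hE; ring.
Qed.

Lemma primitive_size1 f : primitive f -> size f = 1%N -> f \is a GRing.unit.
Proof.
move=> pf /eqP /size_poly1P[c c0 fE].
have [u [s [uu ps cE]]] := factA c0.
case: s ps cE => [|p s] ps cE.
  by rewrite fE poly_unitE size_polyC c0 coefC eqxx cE big_nil mulr1 uu.
case: (pf p); first by apply: ps; rewrite mem_head.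
by exists (u * \prod_(q <- s) q)%:P; rewrite fE cE big_cons -polyCM; congr _%:P; ring.
Qed.

(** If [q] divides [a * b], then either [q] is coprime to [a] and Gauss applies, or the primitive
    part of [gcdp q a] is a nonconstant divisor of [q], by minimality of the same size; then [q]
    divides [a]. *)
Lemma prime_min_size q : primitive q -> (1 < size q)%N ->
  (forall g, dvdr g q -> (1 < size g)%N -> (size q <= size g)%N) ->
  prime_elt q.
Proof.
move=> pq sq qmin.
have q0 : q != 0 by rewrite -size_poly_gt0 ltnW.
split=> // [|a b qab]; first by rewrite poly_unitE; case: eqP sq => // ->.
have [g_small|g_big] := leqP (size (gcdp q a)) 1.
  right; apply: gauss_dvd => //.
  have cop : coprimep q a.
    by rewrite /coprimep eqn_leq g_small size_poly_gt0 gcdp_eq0 (negbTE q0).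
  rewrite -(Pdiv.Idomain.Gauss_dvdpr _ cop).
  by case: qab => c ->; apply: dvdp_mull.
left; apply: gauss_dvd => //.
have g0 : gcdp q a != 0 by rewrite gcdp_eq0 (negbTE q0).
have [s [h [ps ph gE]]] := primitive_part g0.
have s0 : \prod_(p <- s) p != 0.
  by apply: contraNneq g0 => s0; rewrite gE s0 mul0r.
have sh : size h = size (gcdp q a) by rewrite gE size_Cmul.
have hg : (h %| gcdp q a)%R by rewrite gE; apply: dvdp_mull.
have hq : dvdr h q.
  by apply: gauss_dvd => //; apply: dvdp_trans hg (Pdiv.Idomain.dvdp_gcdl _ _).
have := qmin _ hq; rewrite sh => /(_ g_big) le_qg.
have := Pdiv.Idomain.dvdp_gcdl q a => gq.
have eqqg : gcdp q a %= q.
  by rewrite -(dvdp_size_eqp gq) eqn_leq le_qg dvdp_leq.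
by rewrite -(eqp_dvdl _ eqqg) Pdiv.Idomain.dvdp_gcdr.
Qed.

(** A nonconstant divisor of least size is prime by [prime_min_size], and dividing it out lowers the
    size. *)
Lemma primitive_factor f : primitive f -> f != 0 -> exists u (s : seq {poly A}),
  [/\ u \is a GRing.unit, forall g, g \in s -> prime_elt g
    & f = u * \prod_(p <- s) p].
Proof.
have [n] := ubnP (size f).
elim: n f => // n IH f fn pf f0.
have [s1|s1] := leqP (size f) 1.
  exists f, [::]; split=> //; last by rewrite big_nil mulr1.
  by apply: primitive_size1 => //; apply/eqP; rewrite eqn_leq s1 size_poly_gt0.
pose P k := boolp.asbool (exists q, [/\ dvdr q f, (1 < size q)%N & size q = k]).
have exP : exists k, P k.
  by exists (size f); apply/boolp.asboolP; exists f; split=> //; apply: dvdr_refl.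
case: (ex_minnP exP) => k /boolp.asboolP[q [qf q1 <-]] qmin.
have pq := primitive_dvd pf qf.
have qprime : prime_elt q.
  apply: prime_min_size => // g gq g1; apply: qmin; apply/boolp.asboolP.
  by exists g; split=> //; apply: dvdr_trans qf.
case: qf => h fE.
have h0 : h != 0 by apply: contraNneq f0 => h0; rewrite fE h0 mul0r.
have ph : primitive h by apply: (primitive_dvd pf); exists q; rewrite mulrC.
have sh : (size h < n)%N.
  have [q0 _ _] := qprime.
  rewrite -ltnS; apply: leq_trans fn; rewrite fE size_mul // ltnS.
  by case: (size q) q1 => [|[|m]] // _; rewrite !addnS /= ltnS leq_addr.
have [u [s [uu ps hE]]] := IH h sh ph h0.
exists u, (q :: s); split=> // [r|]; first by rewrite inE => /orP[/eqP->|/ps].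
by rewrite fE hE big_cons; ring.
Qed.

Lemma factorial_poly : factorial_domain {poly A}.
Proof.
move=> f f0; have [s [h [ps ph fE]]] := primitive_part f0.
have h0 : h != 0 by apply: contraNneq f0 => h0; rewrite fE h0 mulr0.
have [u [t [uu pt hE]]] := primitive_factor ph h0.
exists u, (map polyC s ++ t); split=> // [p|].
  by rewrite mem_cat => /orP[/mapP[r rs ->]|/pt] //; apply/prime_polyC/ps.
by rewrite fE hE big_cat big_map rmorph_prod /=; ring.
Qed.

End Gauss.

Lemma factorial_transfer (A B : idomainType) (f : {rmorphism A -> B})
    (g : {rmorphism B -> A}) :
  cancel f g -> cancel g f -> factorial_domain A -> factorial_domain B.
Proof.
move=> fK gK factA b b0.
have gb0 : g b != 0 by apply: contraNneq b0 => e; rewrite -(gK b) e rmorph0.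
have [u [s [uu ps gbE]]] := factA _ gb0.
exists (f u), (map f s); split=> [|p /mapP[q qs ->]|]; first exact: rmorph_unit.
  have [q0 nq hq] := ps _ qs; split.
  - by apply: contraNneq q0 => e; rewrite -(fK q) e rmorph0.
  - by apply: contra nq => e; rewrite -(fK q) rmorph_unit.
  - move=> x y [c cE].
    have : dvdr q (g x * g y) by exists (g c); rewrite -rmorphM cE rmorphM fK.
    by case/hq=> -[d dE]; [left|right]; exists (f d); rewrite -rmorphM -dE gK.
by rewrite -(gK b) gbE rmorphM rmorph_prod big_map.
Qed.

Section RMorphExt.

Lemma mpoly_rmorph_ext (n : nat) (K : nzRingType) (S : nzRingType)
    (f g : {rmorphism {mpoly K[n]} -> S}) :
  (forall c, f c%:MP = g c%:MP) -> (forall i, f 'X_i = g 'X_i) -> f =1 g.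
Proof.
move=> fgC fgX p; rewrite [p]mpolyE !rmorph_sum; apply: eq_bigr => m _.
rewrite -mul_mpolyC !rmorphM fgC mpolyXE_id !rmorph_prod; congr (_ * _).
by apply: eq_bigr => i _; rewrite !rmorphXn /= fgX.
Qed.

Lemma mpoly_rmorph_ext_comp (n : nat) (K : nzRingType) (A S : nzRingType)
    (f : {rmorphism {mpoly K[n]} -> A}) (g : {rmorphism A -> S})
    (h : {rmorphism {mpoly K[n]} -> S}) :
  (forall c, g (f c%:MP) = h c%:MP) -> (forall i, g (f 'X_i) = h 'X_i) ->
  forall p, g (f p) = h p.
Proof.
exact: (@mpoly_rmorph_ext n K S (g \o f : {rmorphism _ -> _}) h).
Qed.

End RMorphExt.

(** * Polynomial rings over a field are factorial *)

Section FactorialMpoly.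
Variable K : fieldType.

Section Step.
Variable n : nat.
(** The inverse of [muni]: the coefficients are widened and the last variable is substituted for the
    indeterminate. *)
Let inv : {poly {mpoly K[n]}} -> {mpoly K[n.+1]} :=
  horner_eval 'X_ord_max \o map_poly (@mwiden n K).
HB.instance Definition _ := GRing.RMorphism.on inv.

Lemma muniX_max : muni ('X_ord_max : {mpoly K[n.+1]}) = 'X.
Proof.
rewrite muniE msuppX big_seq1 mcoeffX eqxx scale1r mnm1E eqxx expr1.
rewrite (_ : [multinom _ | _ < _] = 0%MM) ?mpolyX0 ?scale1r //.
by apply/mnmP=> i; rewrite mnmE mnm1E mnm0E -val_eqE /= gtn_eqF.
Qed.

Lemma muniX_widen (i : 'I_n) :
  muni ('X_(widen_ord (leqnSn n) i) : {mpoly K[n.+1]}) = ('X_i)%:P.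
Proof.
rewrite muniE msuppX big_seq1 mcoeffX eqxx scale1r mnm1E.
rewrite -val_eqE /= ltn_eqF // expr0 alg_polyC; congr (_)%:P.
by congr 'X_[_]; apply/mnmP=> j; rewrite mnmE !mnm1E -!val_eqE.
Qed.

Let inv_muni : cancel (@muni n K) inv.
Proof.
move=> p; have := @mpoly_rmorph_ext n.+1 K _
  (inv \o @muni n K : {rmorphism _ -> _}) (idfun : {rmorphism _ -> _}).
apply=> [c|i] /=.
  by rewrite muniC /inv /= map_polyC /= /horner_eval hornerC mwidenC.
case: (unliftP ord_max i) => [j ->|->].
  have -> : lift ord_max j = widen_ord (leqnSn n) j.
    by apply/val_inj; rewrite /= /bump leqNgt ltn_ord add0n.
  rewrite muniX_widen /inv /= map_polyC /= /horner_eval hornerC.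
  by rewrite mwidenX mnmwiden1.
by rewrite muniX_max /inv /= map_polyX /horner_eval hornerX.
Qed.

Let muni_inv : cancel inv (@muni n K).
Proof.
move=> p; elim/poly_ind: p => [|p c IH]; first by rewrite !rmorph0.
rewrite !rmorphD !rmorphM /= IH; congr (_ * _ + _).
  by rewrite /inv /= map_polyX /horner_eval hornerX muniX_max.
rewrite /inv /= map_polyC /= /horner_eval hornerC.
have := @mpoly_rmorph_ext n K _
  (@muni n K \o @mwiden n K : {rmorphism _ -> _})
  (polyC : {rmorphism _ -> _}).
apply=> [a|i] /=; first by rewrite mwidenC muniC.
by rewrite mwidenX mnmwiden1 muniX_widen.
Qed.

Lemma muni_inj : injective (@muni n K).
Proof. exact: can_inj inv_muni. Qed.

Lemma factorial_mpolyS :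
  factorial_domain {mpoly K[n]} -> factorial_domain {mpoly K[n.+1]}.
Proof.
move=> /factorial_poly.
exact: (@factorial_transfer _ _ (inv : {rmorphism _ -> _})
  (@muni n K : {rmorphism _ -> _}) muni_inv inv_muni).
Qed.

End Step.

Theorem factorial_mpoly n : factorial_domain {mpoly K[n]}.
Proof.
elim: n => [|n IH]; last exact: factorial_mpolyS.
move=> p p0; exists p, [::]; split=> //; last by rewrite big_nil mulr1.
rewrite [p]nvar0_mpolyC; apply: rmorph_unit; rewrite unitfE.
by apply: contraNneq p0 => e; rewrite [p]nvar0_mpolyC e.
Qed.

End FactorialMpoly.

(** * Prime ideals and height *)

Section Ideals.
Variable A : comNzRingType.

Definition is_ideal (I : A -> Prop) : Prop :=
  I 0 /\ forall a u v, I u -> I v -> I (a * u + v).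

Definition mult_closed (S : A -> Prop) : Prop :=
  S 1 /\ forall u v, S u -> S v -> S (u * v).

Variables (I : A -> Prop).
Hypothesis idI : is_ideal I.

Lemma idealMl a u : I u -> I (a * u).
Proof. by case: idI => I0 h Iu; rewrite -[a * u]addr0; apply: h. Qed.

Lemma idealD u v : I u -> I v -> I (u + v).
Proof. by case: idI => _ h Iu Iv; rewrite -[u]mul1r; apply: h. Qed.

Lemma ideal_sum (J : Type) (r : seq J) (P : pred J) (F : J -> A) :
  (forall j, P j -> I (F j)) -> I (\sum_(j <- r | P j) F j).
Proof.
by move=> h; elim/big_rec: _ => [|j x Pj Ix];
  [case: idI | apply: idealD => //; apply: h].
Qed.

End Ideals.

Section Krull.
Variables (A : comNzRingType) (I S : A -> Prop).
Hypotheses (idI : is_ideal I) (multS : mult_closed S).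
Hypothesis disj : forall x, I x -> ~ S x.

Import classical_sets.

Theorem krull_separation : exists P : {pred A},
  [/\ idealr_closed P, prime_idealr_closed P, forall x, I x -> x \in P
    & forall x, S x -> x \notin P].
Proof.
(* The empty set is admitted so that the empty chain has an upper bound. *)
pose good (X : A -> Prop) := [/\ (forall a u v, X u -> X v -> X (a * u + v)),
  (forall x, X x -> ~ S x) & (forall x, I x -> X x) \/ (forall x, ~ X x)].
have [|M [[Mlin Mdisj MI] Mmax]] := @Zorn_bigcup A good.
  move=> F Fgood Ftot; split.
  - move=> a u v [X FX Xu] [Y FY Yv].
    have [XY|YX] := Ftot X Y FX FY.
      by exists Y => //; have [+ _ _] := Fgood _ FY; apply=> //; apply: XY.
    by exists X => //; have [+ _ _] := Fgood _ FX; apply=> //; apply: YX.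
  - by move=> x [X FX Xx]; have [_ + _] := Fgood _ FX; apply.
  - have [[X [FX Xne]]|h] := boolp.EM (exists X, F X /\ exists x, X x).
      left=> x Ix; exists X => //; have [_ _ [|]] := Fgood _ FX; first by apply.
      by case: Xne => y Xy /(_ y).
    by right=> x [X FX Xx]; apply: h; exists X; split=> //; exists x.
have goodI : good I by split=> //; [case: idI | left].
have IM : forall x, I x -> M x.
  case: MI => // Me; exfalso; apply: (Mmax I) => //; split=> [x /Me//|MI].
  by apply: (Me 0); apply: MI; case: idI.
have M0 : M 0 by apply: IM; case: idI.
have idM : is_ideal M by split.
(* By maximality the ideal generated by [M] and [z] meets [S]. For u and v outside [M], the product
   of two such elements is in [S], and it would be in [M] if u v were. *)
have meetS z : ~ M z -> exists s x a, [/\ S s, M x & s = a * z + x].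
  move=> nMz; apply: boolp.contrapT => nS.
  pose X y := exists x a, M x /\ y = a * z + x.
  apply: (Mmax X).
    split=> [y My|XM]; first by exists y, 0; rewrite mul0r add0r.
    by apply: nMz; apply: XM; exists 0, 1; rewrite mul1r addr0.
  split.
  - move=> a u v [x [b [Mx ->]]] [y [c [My ->]]].
    by exists (a * x + y), (a * b + c); split; [exact: Mlin | ring].
  - by move=> y [x [a [Mx yE]]] Sy; apply: nS; exists y, x, a.
  - by left=> x Ix; exists x, 0; rewrite mul0r add0r; split=> //; apply: IM.
exists (fun x => boolp.asbool (M x)); split.
- split; first exact/boolp.asboolP.
    by apply/negP => /boolp.asboolP /Mdisj; apply; case: multS.
  move=> a u v; rewrite !unfold_in => /boolp.asboolP Mu /boolp.asboolP Mv.
  by apply/boolp.asboolP; apply: Mlin.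
- move=> u v; rewrite !unfold_in => /boolp.asboolP Muv.
  apply/orP; apply: boolp.contrapT => nuv.
  have [|s [x [a [Ss Mx sE]]]] := meetS u.
    by move=> Mu; apply: nuv; left; apply/boolp.asboolP.
  have [|t [y [b [St My tE]]]] := meetS v.
    by move=> Mv; apply: nuv; right; apply/boolp.asboolP.
  apply: (Mdisj (s * t)); last by case: multS => _; apply.
  have -> : s * t = (a * b) * (u * v) + (t * x + a * u * y).
    by rewrite sE tE; ring.
  exact: (Mlin _ _ _ Muv (Mlin _ _ _ Mx (idealMl idM (a * u) My))).
- by move=> x Ix; apply/boolp.asboolP; apply: IM.
- by move=> x Sx; apply/negP => /boolp.asboolP /Mdisj.
Qed.

End Krull.

Section Height.
Variables (K : fieldType) (n : nat).
Local Notation R := {mpoly K[n]}.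

Lemma gen_ideal_is_ideal m (f : 'I_m -> R) : is_ideal (gen_ideal f).
Proof.
split=> [|a u v [c ->] [d ->]].
  by exists (fun=> 0); rewrite big1 // => i _; rewrite mul0r.
exists (fun i => a * c i + d i); rewrite mulr_sumr -big_split /=.
by apply: eq_bigr => i _; rewrite mulrDl mulrA.
Qed.

Lemma gen_ideal_gen m (f : 'I_m -> R) i : gen_ideal f (f i).
Proof.
exists (fun j => (j == i)%:R); rewrite (bigD1 i) //= eqxx mul1r big1 ?addr0 //.
by move=> j /negbTE->; rewrite mul0r.
Qed.

Section Prime.
Variable P : {pred R}.
Hypothesis primeP : prime_ideal P.

Lemma prime0 : 0 \in P. Proof. by case: primeP => -[]. Qed.

Lemma prime1 : 1 \notin P. Proof. by case: primeP => -[]. Qed.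

Lemma primeM u v : u * v \in P -> (u \in P) || (v \in P).
Proof. by case: primeP => _; apply. Qed.

Lemma prime_is_ideal : is_ideal (fun x => x \in P).
Proof. by split=> [|a u v uP vP]; case: primeP => -[] // _ _ h _; apply: h. Qed.

Lemma gen_ideal_sub m (f : 'I_m -> R) x :
  (forall i, f i \in P) -> gen_ideal f x -> x \in P.
Proof.
move=> fP [c ->]; apply: (ideal_sum prime_is_ideal) => i _.
exact: (idealMl prime_is_ideal).
Qed.

End Prime.

(* If [s f_k^e] with [s] outside [P] were in [(f_0, .., f_(k-1))], then so would
   be [s]; hence some prime inside [P] contains these [f_i] but not [f_k]. *)
Lemma regular_seq_height (f : nat -> R) m (P : {pred R}) :
  prime_ideal P -> regular_seq m f -> (forall i, (i < m)%N -> f i \in P) ->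
  height_ge P m.
Proof.
elim: m P => [|m IH] P primeP reg fP.
  by exists (fun=> P); split=> // i; rewrite leqn0.
pose I := gen_ideal (fun i : 'I_m => f i).
pose S x := exists s e, [/\ s \notin P & x = s * f m ^+ e].
have multS : mult_closed S.
  split; first by exists 1, 0%N; rewrite expr0 mulr1 (prime1 primeP).
  move=> _ _ [s [e [sP ->]]] [t [d [tP ->]]].
  exists (s * t), (e + d)%N; split; last by rewrite exprD; ring.
  by apply/negP => /(primeM primeP); rewrite (negbTE sP) (negbTE tP).
have disj x : I x -> ~ S x.
  move=> Ix [s [e [sP xE]]]; move: Ix; rewrite xE {x xE}.
  elim: e => [|e IHe].
    rewrite expr0 mulr1 => Is; case/negP: sP.
    by apply: (gen_ideal_sub primeP) Is => i; apply: fP; apply: ltnW; rewrite ltnS.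
  by rewrite exprSr mulrA => /(reg _ _ (leqnn _)).
have [Q [idQ prQ IQ SQ]] :=
  krull_separation (gen_ideal_is_ideal _) multS disj.
have primeQ : prime_ideal Q by split.
have fmQ : f m \notin Q.
  by apply: SQ; exists 1, 1%N; rewrite expr1 mul1r (prime1 primeP).
have [||C [Cprime Cstrict CQ]] := IH Q primeQ.
- by move=> k u km; apply: reg; apply: ltnW; rewrite ltnS.
- by move=> i im; apply: IQ; apply: (gen_ideal_gen _ (Ordinal im)).
exists (fun i => if (i <= m)%N then C i else P); split.
- by move=> i _; case: ifP => // /Cprime.
- move=> i im'; have [im|mi] := ltnP i m; first by rewrite ltnW //; apply: Cstrict.
  have -> : i = m by apply/eqP; rewrite eqn_leq mi -ltnS im'.
  rewrite leqnn; split.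
    (* [Q] lies inside [P], because every element outside [P] belongs to [S] with exponent 0. *)
    move=> x; rewrite CQ; apply: contraLR => xP.
    by apply: SQ; exists x, 0%N; rewrite expr0 mulr1.
  by move=> /(_ (f m) (fP _ (leqnn _))); rewrite CQ (negbTE fmQ).
- by rewrite ltnn.
Qed.

(** Algebraic independence of the residue classes modulo [P], expressed without the quotient
    ring. *)
Definition indep_mod (P : {pred R}) m (t : m.-tuple R) : Prop :=
  forall p : {mpoly K[m]}, p \mPo t \in P -> p = 0.

Section CompMuni.
Variables (m : nat) (t : m.-tuple R) (f : R).
Let comm_f : commr_rmorph (comp_mpoly t) f :=
  fun x => mulrC f (comp_mpoly t x).

Lemma comp_mpoly_muni (p : {mpoly K[m.+1]}) :
  p \mPo [tuple of rcons t f] = (map_poly (comp_mpoly t) (muni p)).[f].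
Proof.
apply/esym/(@mpoly_rmorph_ext_comp m.+1 K _ _ (@muni m K)
  (horner_morph comm_f) (comp_mpoly [tuple of rcons t f])) => [c|i] /=.
  by rewrite muniC horner_morphC /= !comp_mpolyC.
rewrite comp_mpolyXU /=.
case: (unliftP ord_max i) => [j ->|->].
  have -> : lift ord_max j = widen_ord (leqnSn m) j.
    by apply/val_inj; rewrite /= /bump leqNgt ltn_ord add0n.
  rewrite muniX_widen horner_morphC /= comp_mpolyXU.
  by rewrite nth_rcons size_tuple ltn_ord.
rewrite muniX_max horner_morphX.
by rewrite nth_rcons size_tuple ltnn eqxx.
Qed.

End CompMuni.

(** An element [f] of [P] outside [Q] can be appended. In a relation modulo [Q], read as a
    polynomial in [f], the constant coefficient lies in [P] and so vanishes; then [f] factors out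
    and cancels modulo [Q]. *)
Lemma indep_mod_step (P Q : {pred R}) m (t : m.-tuple R) :
  prime_ideal Q -> prime_ideal P -> {subset Q <= P} -> ~ {subset P <= Q} ->
  indep_mod P t -> exists t' : m.+1.-tuple R, indep_mod Q t'.
Proof.
move=> prQ prP QP nPQ indt.
have [f fP fQ] : exists2 f, f \in P & f \notin Q.
  apply: boolp.contrapT => h; apply: nPQ => x xP; apply/negPn/negP => xQ.
  by apply: h; exists x.
exists [tuple of rcons t f] => p; rewrite comp_mpoly_muni => pQ.
apply: (@muni_inj K m); rewrite rmorph0; move: pQ.
elim/poly_ind: (muni p) => // q c IH.
rewrite rmorphD rmorphM /= map_polyX map_polyC /= hornerD hornerMX hornerC => h.
have c0 : c = 0.
  apply: indt; move: h; set b := _.[f]; set a := (c \mPo t) => h.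
  have -> : a = - b * f + (b * f + a) by ring.
  have [_] := prime_is_ideal prP; apply=> //; exact: QP.
move: h; rewrite c0 rmorph0 addr0 => /(primeM prQ).
by rewrite (negbTE fQ) orbF => /IH ->; rewrite mul0r addr0.
Qed.

(** Walking down the chain adds one element per step. With [alg_independent_leq] this is one half of
    the dimension formula: the height of P plus the transcendence degree of R/P is at most n. *)
Lemma indep_mod_height (P : {pred R}) h m (t : m.-tuple R) :
  height_ge P h -> indep_mod P t -> exists t' : (m + h).-tuple R, alg_independent t'.
Proof.
case=> Q [Qprime Qstrict QP] indt.
suff tower : forall k, (k <= h)%N ->
    exists t' : (m + k).-tuple R, indep_mod (Q (h - k)%N) t'.
  have [t' indt'] := tower h (leqnn h); exists t' => p pt'; apply: indt'.
  by rewrite pt' prime0 //; apply: Qprime; rewrite leq_subr.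
elim=> [|k IH] kh.
  rewrite subn0 addn0; exists t => p pP; apply: indt.
  by rewrite -QP.
have [t' indt'] := IH (ltnW kh).
rewrite addnS.
have [|QQ nQQ] := Qstrict (h - k.+1)%N; first by rewrite ltn_subrL; case: (h) kh.
rewrite -subSn // subSS in QQ nQQ.
apply: (indep_mod_step _ _ QQ nQQ indt'); apply: Qprime; exact: leq_subr.
Qed.

End Height.

(** * Transcendence degree of a polynomial ring *)

Section AlgIndependentBound.
Variables (K : fieldType) (n : nat).
Local Notation R := {mpoly K[n]}.

Lemma leq_exp2r_weak a b k : (a <= b -> a ^ k <= b ^ k)%N.
Proof. by case: k => // k ab; rewrite leq_exp2r. Qed.

Lemma msize_prod_exp_le m (t : 'I_m -> R) (e : 'I_m -> nat) D N :
  (forall i, (msize (t i) <= D.+1)%N) -> (forall i, (e i <= N)%N) ->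
  (msize (\prod_i t i ^+ e i) <= (m * (N * D)).+1)%N.
Proof.
move=> tD eN.
have mulD (p q : R) a b : (msize p <= a.+1)%N -> (msize q <= b.+1)%N ->
    (msize (p * q) <= (a + b).+1)%N.
  have [->|p0] := eqVneq p 0; first by rewrite mul0r msize0.
  have [->|q0] := eqVneq q 0; first by rewrite mulr0 msize0.
  move=> pa qb; rewrite msizeM //.
  by rewrite -subn1 leq_subLR add1n -addnS -addSn leq_add.
have expD (p : R) k : (msize p <= D.+1)%N -> (msize (p ^+ k) <= (k * D).+1)%N.
  move=> pD; elim: k => [|k IH]; first by rewrite expr0 msize1.
  by rewrite exprS mulSn mulD.
have -> : (m * (N * D) = \sum_(i < m) (N * D))%N by rewrite sum_nat_const card_ord.
elim/big_rec2: _ => [|i a p _ IH]; first by rewrite msize1.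
apply: mulD => //; apply: leq_trans (expD _ _ (tD i)) _.
by rewrite ltnS leq_mul2r eN orbT.
Qed.

(* There are N^m monomials of degree < N in each t_i, and their images have at
   most (mND + 1)^n distinct monomials, which is fewer once N is large. *)
Lemma alg_independent_leq m (t : m.-tuple R) : alg_independent t -> (m <= n)%N.
Proof.
move=> indt; rewrite leqNgt; apply/negP => nm.
pose D := (\max_(i < m) msize (tnth t i))%N.
have tD i : (msize (tnth t i) <= D.+1)%N by apply/leqW; apply: leq_bigmax.
(* Since B <= N (mD + 1), this choice gives B^n <= N^n (mD + 1)^n < N^(n + 1) <= N^m. *)
pose N := ((m * D).+1 ^ n).+1; pose B := (m * (N * D)).+1.
pose rows : finType := {ffun 'I_m -> 'I_N}; pose cols : finType := {ffun 'I_n -> 'I_B}.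
pose te (e : rows) : R := \prod_i tnth t i ^+ e i.
pose mon (c : cols) : 'X_{1..n} := [multinom (c i : nat) | i < n].
pose A : 'M[K]_(#|rows|, #|cols|) :=
  \matrix_(i, j) (te (enum_val i))@_(mon (enum_val j)).
have ltrc : (#|cols| < #|rows|)%N.
  rewrite !card_ffun !card_ord.
  have leB : (B <= N * (m * D).+1)%N by rewrite /B mulnCA mulnS /N addSn ltnS leq_addl.
  apply: (@leq_ltn_trans ((N * (m * D).+1) ^ n)); first by rewrite leq_exp2r_weak.
  apply: (@leq_trans (N ^ n.+1)); last by rewrite leq_exp2l // /N ltnS expn_gt0.
  by rewrite expnMn expnSr ltn_pmul2l ?expn_gt0.
have [v vA v0] : exists2 v : 'rV_#|rows|, v *m A = 0 & v != 0.
  have : kermx A != 0.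
    rewrite -mxrank_eq0 mxrank_ker -lt0n subn_gt0.
    exact: leq_ltn_trans (rank_leq_col A) ltrc.
  by case/rowV0Pn => v /sub_kermxP; exists v.
pose mon' (e : rows) : 'X_{1..m} := [multinom (e i : nat) | i < m].
pose p : {mpoly K[m]} := \sum_j v 0 j *: 'X_[mon' (enum_val j)].
have pt : p \mPo t = \sum_j v 0 j *: te (enum_val j).
  rewrite raddf_sum /=; apply: eq_bigr => j _.
  rewrite comp_mpolyZ comp_mpolyX; congr (_ *: _).
  by apply: eq_bigr => i _; rewrite mnmE.
have p0 : p = 0.
  apply: indt; rewrite pt; apply/mpolyP => mu; rewrite mcoeff0 raddf_sum /=.
  have [muB|] := boolp.EM (forall i, (mu i < B)%N).
    pose c : cols := [ffun i => Ordinal (muB i)].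
    have -> : mu = mon c by apply/mnmP => i; rewrite mnmE ffunE.
    transitivity ((v *m A) 0 (enum_rank c)); last by rewrite vA mxE.
    rewrite mxE; apply: eq_bigr => j _.
    by rewrite mcoeffZ mxE enum_rankK.
  move=> nB; apply: big1 => j _; rewrite mcoeffZ.
  suff -> : (te (enum_val j))@_mu = 0 by rewrite mulr0.
  apply: memN_msupp_eq0; apply: msize_mdeg_ge.
  apply: leq_trans (msize_prod_exp_le tD (fun i => ltnW (ltn_ord _))) _.
  rewrite ltnNge; apply/negP => muN; apply: nB => i; rewrite ltnS.
  by apply: leq_trans muN; rewrite mdegE (bigD1 i) //= leq_addr.
case/negP: v0; apply/eqP/rowP => j; rewrite mxE.
have : p@_(mon' (enum_val j)) = 0 by rewrite p0 mcoeff0.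
rewrite raddf_sum /= (bigD1 j) //= mcoeffZ mcoeffX eqxx mulr1 big1 ?addr0 //.
move=> k kj; rewrite mcoeffZ mcoeffX; case: eqP => [eqm|]; last by rewrite mulr0.
case/eqP: kj; apply: enum_val_inj; apply/ffunP => i; apply/val_inj.
by move/mnmP/(_ i): eqm; rewrite !mnmE.
Qed.

End AlgIndependentBound.

(** * Vectors over polynomial rings *)

Definition i0 : 'I_3 := @Ordinal 3 0 isT.
Definition i1 : 'I_3 := @Ordinal 3 1 isT.
Definition i2 : 'I_3 := @Ordinal 3 2 isT.

Lemma ord3P (P : 'I_3 -> Prop) : P i0 -> P i1 -> P i2 -> forall i, P i.
Proof.
by move=> P0 P1 P2 [[|[|[|//]]] lt];
  [rewrite (_ : Ordinal lt = i0)|rewrite (_ : Ordinal lt = i1)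
  |rewrite (_ : Ordinal lt = i2)] => //; apply/val_inj.
Qed.

Lemma sum3 (V : nmodType) (F : 'I_3 -> V) : \sum_i F i = F i0 + F i1 + F i2.
Proof.
rewrite !big_ord_recl big_ord0 addr0 addrA.
by congr (F _ + F _ + F _); apply/val_inj.
Qed.

Section Vec3.
Variable A : comNzRingType.
Implicit Types (u v w : 'rV[A]_3).

Definition vec3 (a b c : A) : 'rV[A]_3 := \row_i nth 0 [:: a; b; c] i.

Definition dot u v : A := \sum_i u 0 i * v 0 i.

Definition cross u v : 'rV[A]_3 :=
  vec3 (u 0 i1 * v 0 i2 - u 0 i2 * v 0 i1)
       (u 0 i2 * v 0 i0 - u 0 i0 * v 0 i2)
       (u 0 i0 * v 0 i1 - u 0 i1 * v 0 i0).

Lemma row3P u v :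
  u 0 i0 = v 0 i0 -> u 0 i1 = v 0 i1 -> u 0 i2 = v 0 i2 -> u = v.
Proof. by move=> *; apply/rowP; apply: ord3P. Qed.

Lemma dotE u v : dot u v = u 0 i0 * v 0 i0 + u 0 i1 * v 0 i1 + u 0 i2 * v 0 i2.
Proof. exact: sum3. Qed.

Lemma dotC u v : dot u v = dot v u.
Proof. by rewrite !dotE; ring. Qed.

Lemma dotDl u v w : dot (u + v) w = dot u w + dot v w.
Proof. by rewrite !dotE !mxE; ring. Qed.

Lemma dotNl u v : dot (- u) v = - dot u v.
Proof. by rewrite !dotE !mxE; ring. Qed.

Lemma dotZl a u v : dot (a *: u) v = a * dot u v.
Proof. by rewrite !dotE !mxE; ring. Qed.

Lemma dot0l v : dot 0 v = 0.
Proof. by rewrite dotE !mxE; ring. Qed.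

Lemma dot_mulmx u v (N : 'M[A]_3) : dot u (v *m N) = dot (u *m N^T) v.
Proof. by rewrite !dotE !mxE !sum3 !mxE; ring. Qed.

Lemma dot_crossl u v : dot u (cross u v) = 0.
Proof. by rewrite dotE !mxE /=; ring. Qed.

Lemma dot_crossr u v : dot v (cross u v) = 0.
Proof. by rewrite dotE !mxE /=; ring. Qed.

Lemma crossvv u : cross u u = 0.
Proof. by apply: row3P; rewrite !mxE /=; ring. Qed.

Lemma crossC u v : cross u v = - cross v u.
Proof. by apply: row3P; rewrite !mxE /=; ring. Qed.

Lemma crossZl a u v : cross (a *: u) v = a *: cross u v.
Proof. by apply: row3P; rewrite !mxE /=; ring. Qed.

Lemma crossZr a u v : cross u (a *: v) = a *: cross u v.
Proof. by apply: row3P; rewrite !mxE /=; ring. Qed.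

Lemma crossDl u v w : cross (u + v) w = cross u w + cross v w.
Proof. by apply: row3P; rewrite !mxE /=; ring. Qed.

Lemma crossDr u v w : cross u (v + w) = cross u v + cross u w.
Proof. by apply: row3P; rewrite !mxE /=; ring. Qed.

Lemma crossNr u v : cross u (- v) = - cross u v.
Proof. by apply: row3P; rewrite !mxE /=; ring. Qed.

Lemma cross_sumr u (I : Type) (r : seq I) (P : pred I) (a : I -> A) F :
  cross u (\sum_(i <- r | P i) a i *: F i) =
  \sum_(i <- r | P i) a i *: cross u (F i).
Proof.
rewrite (big_morph (cross u) (crossDr u) (id1 := 0)); last first.
  by apply: row3P; rewrite !mxE /=; ring.
by apply: eq_bigr => i _; rewrite crossZr.
Qed.

Lemma triple_cross u v w : cross (cross u v) w = dot u w *: v - dot v w *: u.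
Proof. by apply: row3P; rewrite !dotE !mxE /=; ring. Qed.

(** Cramer's rule for the matrix with rows [u], [v], [w], one coordinate at a time; it yields a
    relation among the rows when the determinant vanishes. *)
Lemma cramer3 u v w l : cross v w 0 l *: u + cross w u 0 l *: v + cross u v 0 l *: w
  = dot w (cross u v) *: delta_mx 0 l.
Proof.
by elim/ord3P: l; apply: row3P; rewrite !dotE !mxE /=; ring.
Qed.

Lemma det_mx33 (N : 'M[A]_3) : \det N =
  N i0 i0 * (N i1 i1 * N i2 i2 - N i1 i2 * N i2 i1)
  - N i0 i1 * (N i1 i0 * N i2 i2 - N i1 i2 * N i2 i0)
  + N i0 i2 * (N i1 i0 * N i2 i1 - N i1 i1 * N i2 i0).
Proof.
pose f (i j : nat) := N (inord i) (inord j).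
have Nf i j : N i j = f i j by rewrite /f !inord_val.
rewrite (expand_det_row _ ord0) !big_ord_recl big_ord0 /cofactor.
rewrite !(expand_det_row _ ord0) !big_ord_recl !big_ord0 /cofactor.
by rewrite !det_mx11 !mxE !Nf /= /bump /=; ring.
Qed.

(** Cross products transform by the cofactor matrix, and multiplying it by [N^T] leaves the
    determinant. *)
Lemma cross_mulmx u v (N : 'M[A]_3) :
  cross (u *m N) (v *m N) *m N^T = \det N *: cross u v.
Proof.
by rewrite det_mx33; apply: row3P; rewrite !mxE !sum3 !mxE /= !sum3; ring.
Qed.

End Vec3.

Section Parallel.
Variable A : idomainType.
Implicit Types (b c d l s u v w : 'rV[A]_3).

(** The form in which it is used that the ideal of the entries of [l] has grade at least 2. *)
Definition par_prop l : Prop :=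
  forall b, cross b l = 0 -> exists k, b = k *: l.

Lemma cross0_coord b l i j : cross b l = 0 -> b 0 i * l 0 j = b 0 j * l 0 i.
Proof.
move=> /rowP bl; have := bl i0; have := bl i1; have := bl i2.
rewrite !mxE /= => /subr0_eq e2 /subr0_eq e1 /subr0_eq e0.
by elim/ord3P: i; elim/ord3P: j; rewrite ?e0 ?e1 ?e2.
Qed.

Lemma cross0_dot b c l : cross b l = 0 -> dot c b *: l = dot c l *: b.
Proof.
move=> bl; apply/rowP => j; rewrite !mxE /dot !mulr_suml.
by apply: eq_bigr => i _; rewrite -!mulrA (cross0_coord i j bl) [l 0 i * _]mulrC.
Qed.

(** For [b] parallel to [l], (c.l) b = (c.b) l and (d.l)(c.b) = (c.l)(d.b); regularity makes c.l
    divide c.b, and the quotient is the multiplier. *)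
Lemma par_regular l c d : dot c l != 0 ->
  (forall a : A, dvdr (dot c l) (a * dot d l) -> dvdr (dot c l) a) -> par_prop l.
Proof.
move=> f0 reg b bl; have cE := cross0_dot c bl; have dE := cross0_dot d bl.
have [h hE] : dvdr (dot c l) (dot c b).
  apply: reg; exists (dot d b).
  have := congr1 (dot d) cE; rewrite ![dot d _]dotC !dotZl => e.
  by rewrite dotC in e *; rewrite e [dot b d]dotC mulrC.
exists h; apply/rowP => j; apply: (mulfI f0).
by move/rowP/(_ j): cE; rewrite hE !mxE => <-; ring.
Qed.

Lemma par_prime l i j : prime_elt (l 0 i) -> ~ dvdr (l 0 i) (l 0 j) -> par_prop l.
Proof.
move=> pl nl.
have dotd k : dot (delta_mx 0 k) l = l 0 k.
  rewrite /dot (bigD1 k) //= mxE !eqxx mul1r big1 ?addr0 // => m mk.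
  by rewrite mxE (negbTE mk) andbF mul0r.
apply: (@par_regular l (delta_mx 0 i) (delta_mx 0 j)); rewrite !dotd.
  by case: pl.
by move=> u; have [_ _ h] := pl; case/h.
Qed.

Lemma orth_cross0 u v w : dot u w = 0 -> dot v w = 0 -> cross w (cross u v) = 0.
Proof.
by move=> uw vw; rewrite crossC triple_cross uw vw !scale0r subr0 oppr0.
Qed.

End Parallel.

Section MpolyDomain.
Variables (K : fieldType) (n : nat).
Local Notation R := {mpoly K[n]}.
Implicit Types p q : R.

Lemma mpoly_unitP p : reflect (exists2 c, c != 0 & p = c%:MP) (p \is a GRing.unit).
Proof.
apply: (iffP idP) => [|[c c0 ->]]; last by apply: rmorph_unit; rewrite unitfE.
case/andP=> /eqP pE u; exists p@_0%MM => //; move: u; rewrite unitfE //.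
Qed.

Lemma mpoly_unit_msize p : (p \is a GRing.unit) = (msize p == 1%N).
Proof. by apply/mpoly_unitP/msize_poly1P. Qed.

(** A prime factor of an irreducible [p] is associate to [p]. *)
Lemma irreducible_prime p : p != 0 -> p \isn't a GRing.unit ->
  (forall a b, p = a * b -> a \is a GRing.unit \/ b \is a GRing.unit) ->
  prime_elt p.
Proof.
move=> p0 np irr; have [u [s [uu ps pE]]] := factorial_mpoly p0.
case: s ps pE => [|q s] ps pE; first by rewrite pE big_nil mulr1 uu in np.
have [q0 nq hq] : prime_elt q by apply: ps; rewrite mem_head.
have pE' : p = (u * \prod_(r <- s) r) * q by rewrite pE big_cons; ring.
case: (irr _ _ pE') => [vu|]; last by rewrite (negbTE nq).
split=> // a b [c cE].
have qp : dvdr q p by rewrite pE'; exists (u * \prod_(r <- s) r).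
have pq : dvdr p q.
  by exists (u * \prod_(r <- s) r)^-1; rewrite pE' mulrA mulVr ?mul1r.
have : dvdr q (a * b) by apply: dvdr_trans qp _; exists c.
by case/hq => h; [left|right]; apply: dvdr_trans h.
Qed.

Lemma msize_dhomog d p : p != 0 -> p \is d.-homog -> msize p = d.+1.
Proof.
move=> p0 pd; rewrite -(mlead_deg p0); congr _.+1.
exact: (dhomog_mf pd) (mlead_supp p0).
Qed.

Lemma homog0_const p : p \is 0.-homog -> p = (p@_0%MM)%:MP.
Proof.
move=> p0; apply: msize1_polyC; have [->|nz] := eqVneq p 0; first by rewrite msize0.
by rewrite (msize_dhomog nz p0).
Qed.

Lemma homogX (i : 'I_n) : ('X_i : R) \is 1.-homog.
Proof. by rewrite dhomogX /= mdeg1. Qed.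

Lemma homog_coef0 d p : p \is d.+1.-homog -> p@_0%MM = 0.
Proof. by move=> hp; apply: (dhomog_nemf_coeff hp); rewrite /= mdeg0. Qed.

Lemma lin_formP p : p \is 1.-homog -> p = \sum_i p@_(U_(i))%MM *: 'X_i.
Proof.
move=> hp; apply/mpolyP => m; rewrite raddf_sum /=.
have [/mdeg1P[i /eqP ->]|m1] := boolP (mdeg m == 1%N).
  rewrite (bigD1 i) //= mcoeffZ mcoeffX eqxx mulr1 big1 ?addr0 // => j ji.
  by rewrite mcoeffZ mcoeffX eq_mnm1 (negbTE ji) mulr0.
rewrite (dhomog_nemf_coeff hp) // big1 // => i _; rewrite mcoeffZ mcoeffX.
by case: eqP => [e|]; [move: m1; rewrite -e mdeg1|rewrite mulr0].
Qed.

Lemma prime_lin_form p : p != 0 -> p \is 1.-homog -> prime_elt p.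
Proof.
move=> p0 hp; have sp := msize_dhomog p0 hp.
apply: irreducible_prime; rewrite ?mpoly_unit_msize ?sp // => a b pE.
have a0 : a != 0 by apply: contraNneq p0 => e; rewrite pE e mul0r.
have b0 : b != 0 by apply: contraNneq p0 => e; rewrite pE e mulr0.
move: sp; rewrite pE msizeM // !mpoly_unit_msize.
rewrite -(msize_poly_eq0 a) in a0; rewrite -(msize_poly_eq0 b) in b0.
case: (msize a) a0 => [|[|x]] // _; case: (msize b) b0 => [|[|y]] // _; try by auto.
by rewrite !addnS.
Qed.

(** Extracts homogeneous components of relations with homogeneous coefficients; the test guards the
    truncated subtraction [d - e]. *)
Lemma pihomog_homogM d e p q : q \is e.-homog ->
  pihomog mdeg d (p * q) = (if (e <= d)%N then pihomog mdeg (d - e) p else 0) * q.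
Proof.
move=> hq; rewrite {1}(pihomog_partitionE (leqnn (msize p))) mulr_suml raddf_sum /=.
have comp k : pihomog mdeg d (pihomog mdeg k p * q) =
    if (k + e == d)%N then pihomog mdeg k p * q else 0.
  have hk := dhomogM (pihomogP mdeg k p) hq.
  case: eqP => [<-|/eqP kd]; first by rewrite pihomog_dE.
  exact: pihomog_ne0 kd hk.
under eq_bigr => k _ do rewrite comp.
rewrite -big_mkcond /=.
have [ed|de] := leqP e d; last first.
  by rewrite mul0r big_pred0 // => k; apply/eqP => kd; move: de;
    rewrite -kd ltnNge leq_addl.
have [lt|ge] := ltnP (d - e) (msize p).
  rewrite (big_pred1 (Ordinal lt)) // => k /=.
  by rewrite -val_eqE /= -{1}(subnK ed) eqn_add2r.
rewrite big_pred0 => [|k]; last first.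
  apply/eqP => kd; have := ltn_ord k; move: ge.
  by rewrite -kd addnK leqNgt => /negP.
suff -> : pihomog mdeg (d - e) p = 0 by rewrite mul0r.
rewrite pihomogE big_seq_cond big_pred0 // => m; apply/andP => -[mp /eqP me].
by have := msize_mdeg_lt mp; rewrite me ltnNge ge.
Qed.

Lemma dhomogM_eq d e D p q :
  p \is d.-homog -> q \is e.-homog -> (d + e = D)%N -> p * q \is D.-homog.
Proof. by move=> hp hq <-; apply: dhomogM. Qed.

Lemma homog_dvd_quot d p q : q != 0 -> q \is d.-homog ->
  forall e, p * q \is (e + d).-homog -> p \is e.-homog.
Proof.
move=> q0 hq e hpq; rewrite homog_piE; apply/eqP/(mulIf q0).
have := pihomog_homogM (e + d) p hq; rewrite leq_addl addnK => <-.
by rewrite pihomog_dE.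
Qed.

(** Lets a substitution stand for reduction modulo an ideal: congruent substitutions give congruent
    results. *)
Lemma subst_congr k (I : {mpoly K[k]} -> Prop) (t t' : n.-tuple {mpoly K[k]}) :
  is_ideal I -> (forall i, I (tnth t i - tnth t' i)) ->
  forall p, I ((p \mPo t) - (p \mPo t')).
Proof.
move=> idI It; elim/mpolyind => [|c m p _ _ IH].
  by rewrite !comp_mpoly0 subr0; case: idI.
rewrite !comp_mpolyD opprD addrACA; apply: idealD => //.
rewrite !comp_mpolyZ -scalerBr -mul_mpolyC; apply: idealMl => //.
rewrite !comp_mpolyX; elim/big_rec2: _ => [|i a b _ Iab].
  by rewrite subrr; case: idI.
have -> : tnth t i ^+ m i * b - tnth t' i ^+ m i * a =
  (tnth t i ^+ m i) * (b - a) + (tnth t i ^+ m i - tnth t' i ^+ m i) * a by ring.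
apply: idealD => //; first exact: idealMl.
by rewrite mulrC; apply: idealMl => //; rewrite subrXX mulrC; apply: idealMl.
Qed.

End MpolyDomain.

(** * The Koszul complex of the variables *)

Section Koszul.
Variable K : fieldType.
Local Notation R := {mpoly K[3]}.
Local Notation x0 := ('X_i0 : R).
Local Notation x1 := ('X_i1 : R).
Local Notation x2 := ('X_i2 : R).

Definition Xv : 'rV[R]_3 := \row_i 'X_i.

Lemma mpolyX_neq0 (i : 'I_3) : ('X_i : R) != 0.
Proof. by rewrite -msize_poly_eq0 msizeX. Qed.

Lemma prime_mpolyX (i : 'I_3) : prime_elt ('X_i : R).
Proof. by apply: prime_lin_form; rewrite ?mpolyX_neq0 ?homogX. Qed.

Lemma lin_form_dvd (l m : R) : l != 0 -> l \is 1.-homog -> m \is 1.-homog ->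
  dvdr l m -> exists c : K, m = c *: l.
Proof.
move=> l0 hl hm [c mE]; exists c@_0%MM.
have hc : c \is 0.-homog by apply: (homog_dvd_quot l0 hl); rewrite add0n -mE.
by rewrite mE {1}(homog0_const hc) mul_mpolyC.
Qed.

Lemma mpolyX_not_dvd (i j : 'I_3) : i != j -> ~ dvdr ('X_i : R) 'X_j.
Proof.
move=> ij /(lin_form_dvd (mpolyX_neq0 i) (homogX _ i) (homogX _ j))[c].
move/(congr1 (mcoeff U_(j)%MM)); rewrite mcoeffZ !mcoeffX eqxx eq_mnm1 (negbTE ij).
by rewrite mulr0 => /eqP; rewrite oner_eq0.
Qed.

Lemma par_X : par_prop Xv.
Proof.
apply: (@par_prime _ _ i0 i1); rewrite !mxE; first exact: prime_mpolyX.
exact: mpolyX_not_dvd.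
Qed.

Lemma gen2_is_ideal (a b : R) : is_ideal (fun p => exists c d, p = c * a + d * b).
Proof.
split=> [|r _ _ [c [d ->]] [c' [d' ->]]].
  by exists 0, 0; ring.
by exists (r * c + c'), (r * d + d'); ring.
Qed.

Lemma koszul_X (a : 'rV[R]_3) : dot Xv a = 0 -> exists e, a = cross Xv e.
Proof.
rewrite dotE !mxE => ax.
pose I := fun p : R => exists c d, p = c * x0 + d * x1.
have idI : is_ideal I by apply: gen2_is_ideal.
(* Reduction modulo (x0, x1). Applied to the relation it leaves x2 times the reduction of [a 0 i2],
   which therefore vanishes. *)
pose t : 3.-tuple R := [tuple 0; 0; x2].
have It p : I (p - (p \mPo t)).
  rewrite -{1}(comp_mpoly_id p); apply: subst_congr => //.
  by apply: ord3P; rewrite tnth_mktuple !(tnth_nth 0) /= ?subr0;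
    [exists 1, 0|exists 0, 1|exists 0, 0]; ring.
have [c [d a2]] : I (a 0 i2).
  have := It (a 0 i2); suff -> : a 0 i2 \mPo t = 0 by rewrite subr0.
  have := congr1 (comp_mpoly t) ax.
  rewrite !rmorphD !rmorphM rmorph0 /= !comp_mpolyXU /= !mul0r !add0r.
  by move=> /eqP; rewrite mulf_eq0 (negbTE (mpolyX_neq0 _)) => /eqP.
(* a_2 = x0 e1 - x1 e0 with e1 = c, e0 = -d *)
have h : x0 * (a 0 i0 + x2 * c) = x1 * - (a 0 i1 + x2 * d).
  by apply/eqP; rewrite -subr_eq0 -ax a2; apply/eqP; ring.
have [e eE] : dvdr x1 (a 0 i0 + x2 * c).
  have [_ _ p1] := prime_mpolyX i1.
  have : dvdr x1 (x0 * (a 0 i0 + x2 * c)) by rewrite h; exists (- (a 0 i1 + x2 * d)); ring.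
  by case/p1 => // /mpolyX_not_dvd; case.
have eE' : a 0 i1 + x2 * d = - e * x0.
  apply: (mulfI (mpolyX_neq0 i1)); apply: oppr_inj; rewrite -mulrN -h eE; ring.
exists (vec3 (- d) c e); apply: row3P; rewrite !mxE /=.
- by apply: (addIr (x2 * c)); rewrite eE; ring.
- by apply: (addIr (x2 * d)); rewrite eE'; ring.
- by rewrite a2; ring.
Qed.

Lemma const0_dotX (p : R) : p@_0%MM = 0 -> exists a, p = dot Xv a.
Proof.
move=> p0; pose I := fun p : R => exists a, p = dot Xv a.
have idI : is_ideal I.
  split=> [|r _ _ [a ->] [b ->]]; first by exists 0; rewrite dotC dot0l.
  by exists (r *: a + b); rewrite !dotE !mxE; ring.
pose t : 3.-tuple R := [tuple 0; 0; 0].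
have : I (p - (p \mPo t)).
  rewrite -{1}(comp_mpoly_id p); apply: subst_congr => //.
  apply: ord3P; rewrite tnth_mktuple !(tnth_nth 0) /= subr0.
  - by exists (vec3 1 0 0); rewrite dotE !mxE /=; ring.
  - by exists (vec3 0 1 0); rewrite dotE !mxE /=; ring.
  - by exists (vec3 0 0 1); rewrite dotE !mxE /=; ring.
suff -> : p \mPo t = 0 by rewrite subr0.
have tE i : tnth t i = (0 : K)%:MP.
  by elim/ord3P: i; rewrite (tnth_nth 0) /= mpolyC0.
rewrite comp_mpolyEX big1_seq // => m /andP[_ mp].
rewrite comp_mpolyX.
have m0 : m != 0%MM by apply: contraTneq mp => ->; rewrite mcoeff_msupp p0 eqxx.
have [i mi] : exists i, m i != 0%N.
  apply: boolp.contrapT => h; case/eqP: m0; apply/mnmP => i; rewrite mnm0E.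
  by apply/eqP/negPn/negP => mi; apply: h; exists i.
rewrite (bigD1 i) //= tE mpolyC0; case: (m i) mi => // k _.
by rewrite expr0n /= mul0r scaler0.
Qed.

End Koszul.

(** * Minimal resolutions and saturation *)

Section Cubics.
Variable K : fieldType.
Local Notation R := {mpoly K[3]}.
Implicit Types (u v s t : 'rV[R]_3).

Definition row_ideal (G : 'rV[R]_3) (p : R) : Prop := exists c, p = dot c G.

Definition grad (F : R) : 'rV[R]_3 := \row_i F^`M(i).

Lemma jacobian_idealE F : jacobian_ideal F = row_ideal (grad F).
Proof.
apply: boolp.funext => p; apply: boolp.propext; split=> -[c ->].
  by exists (\row_i c i); apply: eq_bigr => i _; rewrite !mxE.
by exists (c 0); apply: eq_bigr => i _; rewrite !mxE.
Qed.

Lemma is_syzygyE F s : is_syzygy F s <-> dot s (grad F) = 0.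
Proof.
rewrite /is_syzygy (_ : dot _ _ = \sum_i s 0 i * F^`M(i)) //.
by apply: eq_bigr => i _; rewrite !mxE.
Qed.

Definition homog_row d s : Prop := forall i, s 0 i \is d.-homog.

Lemma homog_row_cross d e u v :
  homog_row d u -> homog_row e v -> homog_row (d + e) (cross u v).
Proof. by move=> hu hv; apply: ord3P; rewrite !mxE /=; apply: rpredB; apply: dhomogM. Qed.

Definition lin_indep (G : 'rV[R]_3) : Prop :=
  forall c : 'I_3 -> K, \sum_i c i *: G 0 i = 0 -> forall i, c i = 0.

Definition hilbert_burch (G : 'rV[R]_3) : Prop := exists s t,
  [/\ homog_row 1 s, homog_row 2 t, G = cross s t
    & forall u, dot u G = 0 -> exists a b, u = a *: s + b *: t].

Variable G : 'rV[R]_3.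
Hypotheses (G3 : homog_row 3 G) (indG : lin_indep G).
Local Notation J := (row_ideal G).

Lemma row_ideal_is_ideal : is_ideal J.
Proof.
split=> [|a _ _ [c ->] [d ->]]; first by exists 0; rewrite dot0l.
by exists (a *: c + d); rewrite dotDl dotZl.
Qed.

Lemma row_ideal_gen i : J (G 0 i).
Proof.
exists (delta_mx 0 i); rewrite /dot (bigD1 i) //= mxE !eqxx mul1r big1 ?addr0 //.
by move=> m mk; rewrite mxE (negbTE mk) andbF mul0r.
Qed.

Lemma indep_neq0 i : G 0 i != 0.
Proof.
apply/eqP => Gi; have := indG (c := fun j => (j == i)%:R).
rewrite (bigD1 i) //= eqxx Gi scaler0 big1 ?addr0.
  by move=> /(_ erefl i)/eqP; rewrite eqxx oner_eq0.
by move=> j /negbTE->; rewrite scale0r.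
Qed.

Lemma indep_row_neq0 : G != 0.
Proof. by apply/eqP => G0; have := indep_neq0 i0; rewrite G0 mxE eqxx. Qed.

Lemma scale_row_inj (a b : R) v : v != 0 -> a *: v = b *: v -> a = b.
Proof.
move=> v0 e; apply/eqP; rewrite -subr_eq0; apply/negPn/negP => ab; case/eqP: v0.
apply/rowP => j; rewrite mxE; apply: (mulfI ab).
by move/rowP/(_ j): e; rewrite !mxE mulrBl => ->; rewrite mulr0 subrr.
Qed.

Lemma const_syz s : dot s G = 0 -> homog_row 0 s -> s = 0.
Proof.
move=> sG s0; apply/rowP => i; rewrite mxE (homog0_const (s0 i)).
rewrite (@indG (fun j => (s 0 j)@_0%MM)) ?mpolyC0 //.
transitivity (dot s G) => //; apply: eq_bigr => j _.
by rewrite [in RHS](homog0_const (s0 j)) mul_mpolyC.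
Qed.

Lemma row_ideal_low p d : (d < 3)%N -> J p -> pihomog mdeg d p = 0.
Proof.
move=> d3 [c ->]; rewrite /dot raddf_sum big1 //= => i _.
by rewrite (pihomog_homogM _ _ (G3 i)) leqNgt d3 mul0r.
Qed.

Section Resolution.
Variables (b : seq (seq nat)) (g : 'cV[R]_(rk b 0))
  (d : forall k, 'M[R]_(rk b k.+1, rk b k)).
Hypothesis resJ : graded_free_resolution J g d.

Let genJ f : J f <-> exists u : 'rV[R]_(rk b 0), f = (u *m g) 0 0.
Proof. by case: resJ. Qed.

Let kerg (u : 'rV[R]_(rk b 0)) : u *m g = 0 <-> exists w, u = w *m d 0.
Proof. by case: resJ. Qed.

Let kerd k (u : 'rV[R]_(rk b k.+1)) : u *m d k = 0 <-> exists w, u = w *m d k.+1.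
Proof. by case: resJ. Qed.

Lemma mulmx_empty m n (w : 'rV[R]_m) (M : 'M_(m, n)) : m = 0%N -> w *m M = 0.
Proof. by move=> m0; subst m; rewrite [w]thinmx0 mul0mx. Qed.

Lemma mx11_eq0 (M : 'M[R]_1) : M 0 0 = 0 -> M = 0.
Proof. by move=> M0; apply/matrixP => i j; rewrite !ord1 M0 mxE. Qed.

(** Otherwise [g] is injective, so [J] is free, hence principal with a generator [ga]. The cofactors
    [c k] of the entries of [G] are forms of one degree that generate the unit ideal, so they are
    constants, against linear independence. *)
Lemma resolution_length_gt1 : (1 < size b)%N.
Proof.
rewrite ltnNge; apply/negP => b1.
have rk1 : rk b 1 = 0%N by rewrite /rk nth_default.
have injg (u : 'rV[R]_(rk b 0)) : u *m g = 0 -> u = 0.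
  by move/kerg => [w ->]; apply: mulmx_empty.
have eq_idx (i j : 'I_(rk b 0)) : i = j.
  apply/eqP/negPn/negP => ij.
  have gi0 (k l : 'I_(rk b 0)) : k != l -> g l 0 = 0.
    move=> kl; have := injg (g l 0 *: delta_mx 0 k - g k 0 *: delta_mx 0 l).
    rewrite mulmxBl -!scalemxAl -!rowE.
    have -> : g l 0 *: row k g - g k 0 *: row l g = 0.
      by apply: mx11_eq0; rewrite !mxE; ring.
    move=> /(_ erefl)/rowP/(_ k); rewrite !mxE !eqxx /= (negbTE kl).
    by rewrite mulr1 mulr0 subr0.
  have := injg (delta_mx 0 j); rewrite -rowE.
  have -> : row j g = 0 by apply: mx11_eq0; rewrite mxE; apply: gi0 ij.
  by move=> /(_ erefl)/rowP/(_ j)/eqP; rewrite !mxE !eqxx oner_eq0.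
have [u0 G0E] := (genJ (G 0 i0)).1 (row_ideal_gen i0).
have [i _] : exists i : 'I_(rk b 0), True.
  apply: boolp.contrapT => h; have := indep_neq0 i0.
  by rewrite G0E mxE big1 ?eqxx // => i; case: h; exists i.
have ugE (u : 'rV[R]_(rk b 0)) : (u *m g) 0 0 = u 0 i * g i 0.
  by rewrite mxE (big_pred1 i) // => j; rewrite (eq_idx j i) /= eqxx.
set ga := g i 0 in ugE.
have cP k : exists c, G 0 k = c * ga.
  by have [u ->] := (genJ _).1 (row_ideal_gen k); exists (u 0 i); rewrite ugE.
have [c cE] := boolp.choice cP.
have ga0 : ga != 0.
  by apply: contraNneq (indep_neq0 i0) => e; rewrite cE e mulr0.
have [a aE] : J ga by apply/genJ; exists (delta_mx 0 i); rewrite -rowE mxE.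
have ac1 : \sum_k a 0 k * c k = 1.
  apply: (mulIf ga0); rewrite mul1r [RHS]aE mulr_suml.
  by apply: eq_bigr => k _; rewrite cE mulrA.
pose da := nth 0%N (nth [::] b 0) i.
have hga : ga \is da.-homog.
  by case: resJ => /(_ i 0) /=; rewrite subn0.
have da3 : (da <= 3)%N.
  have := msize_dhomog (indep_neq0 i0) (G3 i0).
  have c0 : c i0 != 0 by apply: contraNneq (indep_neq0 i0) => e; rewrite cE e mul0r.
  rewrite cE msizeM // (msize_dhomog ga0 hga) addnS /= => e.
  by rewrite -ltnS -[X in (_ < X)%N]e -[X in (X < _)%N]add0n ltn_add2r lt0n msize_poly_eq0.
have hc k : c k \is (3 - da).-homog.
  by apply: (homog_dvd_quot ga0 hga); rewrite subnK // -cE.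
move: hc; case: (3 - da)%N => [|e] hc; last first.
  have := congr1 (mcoeff 0%MM) ac1.
  rewrite raddf_sum /= mcoeff1 eqxx big1 => [/esym/eqP|k _]; first by rewrite oner_eq0.
  by rewrite rmorphM /= (homog_coef0 (hc k)) mulr0.
have cC k : c k = ((c k)@_0%MM)%:MP by apply: homog0_const.
have := indG (c := fun k => if k == i0 then (c i1)@_0%MM
                            else if k == i1 then - (c i0)@_0%MM else 0).
rewrite sum3 /= scale0r addr0 scaleNr -!mul_mpolyC -!cC !cE.
have -> : c i1 * (c i0 * ga) - c i0 * (c i1 * ga) = 0 by ring.
move=> /(_ erefl i1) /= /eqP; rewrite oppr_eq0 => /eqP c0.
by have := indep_neq0 i0; rewrite cE cC c0 mpolyC0 mul0r eqxx.
Qed.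

Section LengthTwo.
Hypothesis b2 : (size b <= 2)%N.

Lemma injd (w : 'rV[R]_(rk b 1)) : w *m d 0 = 0 -> w = 0.
Proof.
by move/kerd => [v ->]; apply: mulmx_empty; rewrite /rk nth_default.
Qed.

Lemma exists3 (T : Type) (P : 'I_3 -> T -> Prop) :
  (forall i, exists x, P i x) -> exists f : 'I_3 -> T, forall i, P i (f i).
Proof. by move=> h; have [f fP] := boolp.choice h; exists f. Qed.

(* [Tor_3(R/J, K)], the socle of [R/J], vanishes. *)
Lemma saturated h : (forall i, J ('X_i * h)) -> J h.
Proof.
move=> Jh.
have /exists3[v vE] : forall i, exists v : 'rV[R]_(rk b 0), 'X_i * h = (v *m g) 0 0.
  by move=> i; apply/genJ/Jh.
pose V j : 'rV[R]_3 := \row_i v i 0 j.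
have vg i : v i *m g = ('X_i * h)%:M.
  by apply/matrixP => k l; rewrite !ord1 -vE mxE eqxx mulr1n.
(* A chase between the Koszul complex and the resolution. The [xv k] are killed by [g] and lift to
   [w k]; as [d 0] is injective, the lifts are Koszul cycles, hence of the form X x T. Correcting
   [v] by the image of T makes it a multiple of X, and the multiplier maps to [h]. *)
pose xv k : 'rV[R]_(rk b 0) := \row_j cross (Xv K) (V j) 0 k.
have /exists3[w wE] : forall k, exists w, xv k = w *m d 0.
  move=> k; apply/kerg; apply: mx11_eq0.
  have vgE i : \sum_j v i 0 j * g j 0 = 'X_i * h.
    by rewrite vE mxE.
  rewrite mxE.
  elim/ord3P: k; under eq_bigr do rewrite !mxE /= mulrBl -!mulrA;
    by rewrite sumrB -!mulr_sumr !vgE; ring.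
pose W j : 'rV[R]_3 := \row_i w i 0 j.
have W0 j : dot (Xv K) (W j) = 0.
  have : \sum_k ('X_k : R) *: w k = 0.
    apply: injd; rewrite sum3 !mulmxDl -!scalemxAl -!wE.
    by apply/rowP => l; rewrite !mxE /=; ring.
  move/rowP/(_ j); rewrite summxE mxE => <-; apply: eq_bigr => k _.
  by rewrite !mxE.
have [T TE] := boolp.choice (fun j => koszul_X (W0 j)).
pose t i : 'rV[R]_(rk b 1) := \row_j T j 0 i.
have tE j : exists e, \row_i ((v i - t i *m d 0) 0 j) = e *: Xv K.
  apply: par_X.
  have -> : \row_i (v i - t i *m d 0) 0 j = V j - \sum_l d 0 l j *: T l.
    apply/rowP => i; rewrite !mxE summxE; congr (_ - _).
    by apply: eq_bigr => l _; rewrite !mxE mulrC.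
  rewrite crossC crossDr crossNr cross_sumr.
  suff -> : cross (Xv K) (V j) = \sum_l d 0 l j *: cross (Xv K) (T l).
    by rewrite subrr oppr0.
  apply/rowP => k; have /rowP/(_ j) := wE k; rewrite mxE => ->.
  rewrite mxE summxE; apply: eq_bigr => l _.
  by rewrite -TE !mxE mulrC.
have [e eE] := boolp.choice tE.
apply/genJ; exists (\row_j e j).
apply: (mulfI (mpolyX_neq0 K i0)).
have dg0 : d 0 *m g = 0.
  apply/row_matrixP => l; rewrite row_mul row0; apply/kerg.
  by exists (delta_mx 0 l); rewrite rowE.
rewrite vE.
have -> : v i0 = t i0 *m d 0 + 'X_i0 *: \row_j e j.
  apply/rowP => j; move/rowP/(_ i0): (eE j).
  by rewrite !mxE => /eqP; rewrite subr_eq => /eqP ->; rewrite addrC mulrC.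
by rewrite mulmxDl -mulmxA dg0 mulmx0 add0r -scalemxAl mxE.
Qed.

Lemma syz_finitely_generated : exists N (T : 'I_N -> 'rV[R]_3),
  (forall k, dot (T k) G = 0) /\
  (forall u, dot u G = 0 -> exists c : 'I_N -> R, u = \sum_k c k *: T k).
Proof.
have /exists3[w wE] : forall i, exists v : 'rV[R]_(rk b 0), G 0 i = (v *m g) 0 0.
  by move=> i; apply/genJ/row_ideal_gen.
have gP a : exists c, g a 0 = dot c G.
  have [|c cE] := (genJ (g a 0)).2; last by exists c.
  by exists (delta_mx 0 a); rewrite -rowE mxE.
have [v vE] := boolp.choice gP.
pose W : 'M[R]_(3, rk b 0) := \matrix_(i, a) w i 0 a.
pose V : 'M[R]_(rk b 0, 3) := \matrix_(a, i) v a 0 i.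
have WG : W *m g = G^T.
  apply/matrixP => i j; rewrite ord1 !mxE wE mxE.
  by apply: eq_bigr => a _; rewrite mxE.
have VG : V *m G^T = g.
  apply/matrixP => i j; rewrite ord1 !mxE vE; apply: eq_bigr => a _.
  by rewrite !mxE.
have dotG s : dot s G = (s *m G^T) 0 0.
  by rewrite mxE; apply: eq_bigr => a _; rewrite mxE.
have dg0 : d 0 *m g = 0.
  apply/row_matrixP => l; rewrite row_mul row0; apply/kerg.
  by exists (delta_mx 0 l); rewrite rowE.
pose S := col_mx (1%:M - W *m V) (d 0 *m V).
have SG : S *m G^T = 0.
  rewrite mul_col_mx mulmxBl mul1mx -!mulmxA VG WG dg0 subrr.
  by rewrite col_mx0.
exists _, (fun k => row k S); split=> [k|u uG].
  by rewrite dotG -row_mul SG !mxE.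
have [y yE] : exists y, u *m W = y *m d 0.
  apply/kerg; rewrite -mulmxA WG; apply: mx11_eq0; by rewrite -dotG.
exists (row_mx u y 0); rewrite -mulmx_sum_row mul_row_col.
by rewrite mulmxBr mulmx1 !mulmxA -yE subrK.
Qed.

End LengthTwo.

End Resolution.
End Cubics.

(** * Freeness of the syzygies of a saturated ideal *)

Section Freeness.
Variable K : fieldType.
Local Notation R := {mpoly K[3]}.
Implicit Types (u v s t : 'rV[R]_3).
Variable G : 'rV[R]_3.
Hypotheses (G3 : homog_row 3 G) (indG : lin_indep G).
Local Notation J := (row_ideal G).
Hypothesis sat : forall h, (forall i, J ('X_i * h)) -> J h.
Hypothesis fg : exists N (T : 'I_N -> 'rV[R]_3),
  (forall k, dot (T k) G = 0) /\
  (forall u, dot u G = 0 -> exists c : 'I_N -> R, u = \sum_k c k *: T k).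
Hypothesis parG : par_prop G.

Lemma dot_suml (I : Type) (r : seq I) (P : pred I) (F : I -> 'rV[R]_3) :
  dot (\sum_(i <- r | P i) F i) G = \sum_(i <- r | P i) dot (F i) G.
Proof.
elim/big_rec2: _ => [|i x y _ <-]; [exact: dot0l | exact: dotDl].
Qed.

(* The Koszul complex of [x, y, z] with coefficients in [Syz G] is exact in
   degree 1. *)
Lemma koszul_syz (m : 'I_3 -> 'rV[R]_3) : (forall i, dot (m i) G = 0) ->
  \sum_i ('X_i : R) *: m i = 0 ->
  exists e : 'I_3 -> 'rV[R]_3, (forall i, dot (e i) G = 0) /\
    forall i j, m i 0 j = cross (Xv K) (\row_k e k 0 j) 0 i.
Proof.
move=> mG mX.
have koz j : exists e, \row_k m k 0 j = cross (Xv K) e.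
  apply: koszul_X; move/rowP/(_ j): mX; rewrite summxE mxE => <-.
  by apply: eq_bigr => i _; rewrite !mxE.
have [e eE] := boolp.choice koz.
pose e' i : 'rV[R]_3 := \row_j e j 0 i.
(* The coordinatewise lifts [e'] need not be syzygies. Their defect [phi] is parallel to X, so phi =
   h X; then every x_i h is in [J], hence so is [h] by saturation, and this provides the
   correction. *)
pose phi : 'rV[R]_3 := \row_i dot (e' i) G.
have mE i j : m i 0 j = cross (Xv K) (e j) 0 i by rewrite -eE mxE.
have phiX : cross phi (Xv K) = 0.
  have -> : phi = \sum_j G 0 j *: e j.
    apply/rowP => i; rewrite mxE summxE; apply: eq_bigr => j _.
    by rewrite !mxE mulrC.
  rewrite crossC cross_sumr; apply/eqP; rewrite oppr_eq0; apply/eqP/rowP => i.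
  rewrite summxE mxE -[RHS](mG i); apply: eq_bigr => j _.
  by rewrite mE mxE mulrC.
have [h hE] := par_X phiX.
have [k kE] : J h.
  apply: sat => i; exists (e' i).
  by move/rowP/(_ i): hE; rewrite !mxE => ->; rewrite mulrC.
exists (fun i => e' i - 'X_i *: k); split=> [i|i j].
  rewrite dotDl dotNl dotZl -kE; move/rowP/(_ i): hE; rewrite !mxE => ->.
  by ring.
have -> : \row_l (e' l - 'X_l *: k) 0 j = e j - k 0 j *: Xv K.
  by apply/rowP => l; rewrite !mxE mulrC.
by rewrite crossDr crossNr crossZr crossvv scaler0 subr0.
Qed.

Definition homog_gens N (T : 'I_N -> 'rV[R]_3) (e : 'I_N -> nat) : Prop :=
  [/\ forall k, homog_row (e k) (T k), forall k, dot (T k) G = 0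
    & forall u, dot u G = 0 -> exists c : 'I_N -> R, u = \sum_k c k *: T k].

Lemma exists_homog_gens : exists N (T : 'I_N -> 'rV[R]_3) e, homog_gens T e.
Proof.
have [N [T [TG Tgen]]] := fg.
pose B := (\max_k \max_i msize (T k 0%R i))%N.
pose I : finType := ('I_N * 'I_B)%type.
pose S (x : I) : 'rV[R]_3 := \row_i pihomog mdeg x.2 (T x.1 0 i).
pose deg (x : I) : nat := x.2.
exists #|I|, (fun k => S (enum_val k)), (fun k => deg (enum_val k)).
split=> [k i|k|u uG]; first by rewrite mxE; apply: pihomogP.
- case: (enum_val k) => a D /=; rewrite /dot /S.
  have E := congr1 (pihomog mdeg (D + 3)) (TG a).
  rewrite raddf0 raddf_sum /= in E; rewrite -[RHS]E.
  apply: eq_bigr => i _.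
  by rewrite (pihomog_homogM _ _ (G3 i)) leq_addl addnK mxE.
have [c ->] := Tgen u uG; exists (fun k => c (enum_val k).1).
transitivity (\sum_(x : I) c x.1 *: S x); last first.
  by rewrite (reindex (@enum_val I I)) //; apply/onW_bij/enum_val_bij.
rewrite -(pair_bigA _ (fun a D => c a *: S (a, D))) /=.
apply: eq_bigr => a _; rewrite -scaler_sumr; congr (_ *: _).
apply/rowP => i; rewrite summxE.
under eq_bigr do rewrite mxE /=.
apply: pihomog_partitionE.
by apply: leq_trans (leq_bigmax a); apply: (leq_bigmax i).
Qed.

Section Minimal.
Variables (N : nat) (T : 'I_N -> 'rV[R]_3) (e : 'I_N -> nat).
Hypothesis gensT : homog_gens T e.
Hypothesis minT : forall N' (T' : 'I_N' -> 'rV[R]_3) e',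
  homog_gens T' e' -> (N <= N')%N.

Let Thom k : homog_row (e k) (T k). Proof. by case: gensT. Qed.
Let TG k : dot (T k) G = 0. Proof. by case: gensT => _ h _; apply: h. Qed.
Let Tgen u : dot u G = 0 -> exists c : 'I_N -> R, u = \sum_k c k *: T k.
Proof. by case: gensT => _ _ h; apply: h. Qed.

(** In degree [e k] the relation has the constant term of [c k] as coefficient of [T k]; if it were
    nonzero, [T k] could be eliminated, against the minimality of [N]. *)
Lemma relation_const0 (c : 'I_N -> R) k :
  \sum_j c j *: T j = 0 -> (c k)@_0%MM = 0.
Proof.
move=> cT; apply/eqP/negPn/negP => ck.
pose p j := if (e j <= e k)%N then pihomog mdeg (e k - e j) (c j) else 0.
have pT : \sum_j p j *: T j = 0.
  apply/rowP => i; have /rowP/(_ i)/(congr1 (pihomog mdeg (e k))) E := cT.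
  rewrite summxE mxE raddf0 raddf_sum /= in E.
  rewrite summxE mxE -[RHS]E; apply: eq_bigr => j _.
  by rewrite !mxE (pihomog_homogM _ _ (Thom j i)).
have pk : p k = ((c k)@_0%MM)%:MP.
  rewrite /p leqnn subnn [LHS]homog0_const ?pihomogP //; congr (_)%:MP.
  transitivity ((\sum_(d < msize (c k)) pihomog mdeg d (c k))@_0%MM); last first.
    by rewrite -pihomog_partitionE.
  have sk : (0 < msize (c k))%N.
    by rewrite lt0n msize_poly_eq0; apply: contraNneq ck => ->; rewrite mcoeff0.
  rewrite (bigD1 (Ordinal sk)) //= mcoeffD [X in _ = _ + X](_ : _ = 0) ?addr0 //.
  rewrite raddf_sum /=; apply: big1 => -[[|j] jl] //= _.
  exact: homog_coef0 (pihomogP _ _ _).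
case: N T e gensT minT k c cT ck p pT pk => [_ _ _ _ []//|N'] T' e' [T'hom T'G T'gen] min'.
move=> k c _ ck p pT pk.
suff /min' : homog_gens (fun j => T' (lift k j)) (fun j => e' (lift k j)).
  by rewrite ltnn.
split=> [j|j|u /T'gen[a ->]] //.
pose q j := ((c k)@_0%MM)^-1 *: p (lift k j).
exists (fun j => a (lift k j) - a k * q j).
have Tk : T' k = - \sum_j q j *: T' (lift k j).
  move: pT; rewrite (bigD1_ord k) //= pk => /eqP; rewrite addr_eq0 => /eqP pT.
  apply/rowP => i; move/rowP/(_ i): pT; rewrite !mxE !summxE => pT.
  have -> : T' k 0 i = ((c k)@_0%MM)^-1 *: (((c k)@_0%MM)%:MP * T' k 0 i).
    by rewrite mul_mpolyC scalerA mulVf ?scale1r.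
  rewrite pT scalerN scaler_sumr; congr (- _); apply: eq_bigr => j _.
  by rewrite !mxE -scalerAl.
rewrite (bigD1_ord k) //= [in LHS]Tk scalerN scaler_sumr addrC -sumrB.
by apply: eq_bigr => j _; rewrite scalerBl scalerA.
Qed.

(* Nakayama: by exactness of the Koszul complex every relation lies in
   [(x, y, z)] times the module of relations. *)
Lemma relation_trivial (c : 'I_N -> R) : \sum_j c j *: T j = 0 -> forall k, c k = 0.
Proof.
move=> cT k.
suff vanish D : forall c : 'I_N -> R, \sum_j c j *: T j = 0 ->
    forall k d, (d < D)%N -> pihomog mdeg d (c k) = 0.
  rewrite (pihomog_partitionE (leqnn (msize (c k)))) big1 // => d _.
  exact: (vanish _ c cT k d (ltn_ord d)).
elim: D {c k cT} => // D IH c cT.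
have [a aE] := boolp.choice (fun k => const0_dotX (relation_const0 k cT)).
have [i||E [EG mE]] := @koszul_syz (fun i => \sum_k a k 0 i *: T k).
- by rewrite dot_suml big1 // => k _; rewrite dotZl TG mulr0.
- rewrite -[RHS]cT.
  transitivity (\sum_i \sum_k ('X_i : R) *: (a k 0 i *: T k)).
    by apply: eq_bigr => i _; rewrite scaler_sumr.
  rewrite exchange_big /=; apply: eq_bigr => k _.
  rewrite aE /dot scaler_suml; apply: eq_bigr => i _.
  by rewrite scalerA mxE.
have [f fE] := boolp.choice (fun j => Tgen (EG j)).
(* Subtracting a Koszul boundary does not change the sum of the x_i [rho i k], which is still [c k],
   but it makes each [rho i] a relation. *)
pose rho i k := a k 0 i - cross (Xv K) (\row_j f j k) 0 i.
have rhoT i : \sum_k rho i k *: T k = 0.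
  apply/rowP => j; have := mE i j.
  have -> : \row_l E l 0 j = \sum_k T k 0 j *: \row_l f l k.
    apply/rowP => l; rewrite mxE fE !summxE; apply: eq_bigr => k _.
    by rewrite !mxE mulrC.
  rewrite cross_sumr !summxE => /eqP; rewrite -subr_eq0 -sumrB [RHS]mxE => /eqP E0.
  rewrite -[RHS]E0; apply: eq_bigr => k _.
  by rewrite mxE [X in _ = X - _]mxE [X in _ = _ - X]mxE mulrBl [T k 0 j * _]mulrC.
have cE k : c k = \sum_i 'X_i * rho i k.
  rewrite aE dotE sum3 /rho !mxE /=; ring.
move=> k d dD; rewrite cE raddf_sum big1 //= => i _.
rewrite mulrC (pihomog_homogM _ _ (homogX _ i)).
case: d dD => [|d] dD; first by rewrite mul0r.
by rewrite subSS subn0 (IH _ (rhoT i)) // mul0r.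
Qed.

Lemma relation2 (i j : 'I_N) (a b : R) : i != j ->
  a *: T i + b *: T j = 0 -> a = 0 /\ b = 0.
Proof.
move=> ij h.
have ji : (j == i) = false by rewrite eq_sym (negbTE ij).
have cT : \sum_k (if k == i then a else if k == j then b else 0) *: T k = 0.
  rewrite (bigD1 i) //= eqxx (bigD1 j) /= ji // eqxx big1 ?addr0 //.
  by move=> k /andP[/negbTE-> /negbTE->]; rewrite scale0r.
have := relation_trivial cT; move=> rel; have := rel i; have := rel j.
by rewrite !eqxx ji.
Qed.

Lemma relation3 (i j k : 'I_N) (a b c : R) : i != j -> i != k -> j != k ->
  a *: T i + b *: T j + c *: T k = 0 -> c = 0.
Proof.
move=> ij ik jk h.
have ji : (j == i) = false by rewrite eq_sym (negbTE ij).
have ki : (k == i) = false by rewrite eq_sym (negbTE ik).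
have kj : (k == j) = false by rewrite eq_sym (negbTE jk).
pose F l := if l == i then a else if l == j then b else if l == k then c else 0.
suff /relation_trivial/(_ k) : \sum_l F l *: T l = 0 by rewrite /F ki kj eqxx.
rewrite -[RHS]h (bigD1 i) // (bigD1 j) /= ?ji // (bigD1 k) /= ?ki ?kj //.
rewrite /F !eqxx ji ki kj !addrA -[RHS]addr0; congr (_ + _).
by apply: big1 => l /andP[/andP[/negbTE-> /negbTE->] /negbTE->]; rewrite scale0r.
Qed.

Lemma gens_neq0 i : T i != 0.
Proof.
apply/eqP => Ti.
have := @relation_trivial (fun j => if j == i then 1 else 0).
rewrite (bigD1 i) //= Ti scaler0 big1 ?addr0 => [|j /negbTE->]; last by rewrite scale0r.
by move=> /(_ erefl i)/eqP; rewrite eqxx oner_eq0.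
Qed.

Lemma cross_gens_neq0 i j : i != j -> cross (T i) (T j) != 0.
Proof.
move=> ij; apply/eqP => cr; have /eqP[] := gens_neq0 i; apply/rowP => l.
have [] := @relation2 i j (- T j 0 l) (T i 0 l) ij; last by rewrite mxE.
apply/rowP => m; rewrite !mxE mulNr.
by rewrite -(cross0_coord m l cr) [T j 0 l * _]mulrC addNr.
Qed.

(** The cross product of two generators is a multiple of [G], hence orthogonal to a third one, and
    Cramer's rule would give a nontrivial relation among the three. A single generator cannot
    produce both [kap1] and [kap2], which are independent. *)
Lemma syz_rank : N = 2%N.
Proof.
have Gn0 := indep_neq0 indG.
pose kap1 := vec3 (G 0 i1) (- G 0 i0) 0; pose kap2 := vec3 (G 0 i2) 0 (- G 0 i0).
have k1G : dot kap1 G = 0 by rewrite dotE !mxE /=; ring.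
have k2G : dot kap2 G = 0 by rewrite dotE !mxE /=; ring.
have [c1 c1E] := Tgen k1G; have [c2 c2E] := Tgen k2G.
apply/eqP; rewrite eqn_leq; apply/andP; split.
  rewrite leqNgt; apply/negP => N3.
  pose a := Ordinal (ltnW (ltnW N3)); pose b := Ordinal (ltnW N3); pose c := Ordinal N3.
  have ab : a != b by []. have ac : a != c by []. have bc : b != c by [].
  move: a b c ab ac bc => a b c ab ac bc.
  have /eqP[] := cross_gens_neq0 ab; apply/rowP => l; rewrite [RHS]mxE.
  have det0 : dot (T c) (cross (T a) (T b)) = 0.
    have [|h hE] := parG (b := cross (T a) (T b)).
      by rewrite triple_cross !TG !scale0r subrr.
    by rewrite hE dotC dotZl dotC TG mulr0.
  apply: (@relation3 a b c (cross (T b) (T c) 0 l) (cross (T c) (T a) 0 l)) => //.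
  by rewrite cramer3 det0 scale0r.
rewrite ltnNge; apply/negP => N1.
have eqI (i j : 'I_N) : i = j.
  have z (k : 'I_N) : val k = 0%N.
    by apply/eqP; rewrite -leqn0 -ltnS; apply: leq_trans (ltn_ord k) N1.
  by apply/val_inj; rewrite !z.
have [i _] : exists i : 'I_N, True.
  apply: boolp.contrapT => h; have := congr1 (fun v => v 0 i1) c1E.
  rewrite big1 => [|k _]; last by case: h; exists k.
  by rewrite !mxE /= => /eqP; rewrite oppr_eq0 (negbTE (Gn0 _)).
have one (c : 'I_N -> R) : \sum_k c k *: T k = c i *: T i.
  by rewrite (big_pred1 i) // => k; rewrite (eqI k i) /= eqxx.
rewrite !one in c1E c2E.
have : c2 i *: kap1 = c1 i *: kap2 by rewrite c1E c2E !scalerA mulrC.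
move=> /rowP/(_ i1); rewrite !mxE /= mulr0 => /eqP.
rewrite mulf_eq0 oppr_eq0 (negbTE (Gn0 _)) orbF => /eqP c20.
move: c2E; rewrite c20 scale0r => /rowP/(_ i0); rewrite !mxE /= => /eqP.
by rewrite (negbTE (Gn0 _)).
Qed.

(** The cross product of the generators is h G, and [h] must be a unit. Expanding G x w in the
    generators shows that [h] divides each coordinate of [T a]; the quotient is again a syzygy, so
    freeness makes [h] invertible. The degrees add up to 3, and neither is 0 because constant
    syzygies vanish. *)
Lemma minimal_hilbert_burch : hilbert_burch G.
Proof.
have N2 := syz_rank.
pose a : 'I_N := cast_ord (esym N2) ord0; pose b : 'I_N := cast_ord (esym N2) ord_max.
have ab : a != b by [].
have gen u : dot u G = 0 -> exists x y, u = x *: T a + y *: T b.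
  move=> /Tgen[c ->]; exists (c a), (c b).
  rewrite (bigD1 a) //= (big_pred1 b) // => k.
  have k2 : (k < 2)%N by rewrite -[X in (_ < X)%N]N2.
  by rewrite /= -!val_eqE /=; case: (nat_of_ord k) k2 => [|[|]].
have [|h hE] := parG (b := cross (T a) (T b)).
  by rewrite triple_cross !TG !scale0r subrr.
have h0 : h != 0.
  by apply: contraNneq (cross_gens_neq0 ab) => h0; rewrite hE h0 scale0r.
have hdiv j : dvdr h (T a 0 j).
  pose w : 'rV[R]_3 := delta_mx 0 j.
  have wTa : dot w (T a) = T a 0 j.
    rewrite /dot (bigD1 j) //= mxE !eqxx mul1r big1 ?addr0 // => m mk.
    by rewrite mxE (negbTE mk) andbF mul0r.
  have [|x [y xyE]] := gen (cross G w); first by rewrite dotC dot_crossl.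
  exists y; rewrite -wTa; apply: (scale_row_inj (indep_row_neq0 indG)).
  have := congr1 (fun v => cross v (T a)) xyE.
  rewrite /= triple_cross crossDl !crossZl crossvv (crossC (T b)) hE.
  rewrite dotC TG scale0r scaler0 sub0r add0r scalerN => /oppr_inj ->.
  by rewrite scalerA.
have [s sE] := boolp.choice hdiv.
have Ta : T a = h *: \row_j s j by apply/rowP => j; rewrite !mxE sE mulrC.
have sG : dot (\row_j s j) G = 0.
  by apply: (mulfI h0); rewrite -dotZl -Ta TG mulr0.
have hu : h \is a GRing.unit.
  have [x [y xyE]] := gen _ sG; apply/unitrPr; exists x.
  have [|/eqP + _] := @relation2 a b (h * x - 1) (h * y) ab.
    have E : T a = (h * x) *: T a + (h * y) *: T b.
      by rewrite {1}Ta xyE scalerDr !scalerA.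
    by rewrite scalerBl scale1r addrAC -E subrr.
  by rewrite subr_eq0 => /eqP.
have [k k0 kE] := mpoly_unitP _ hu.
have he : (e a + e b = 3)%N.
  have G0 := indep_neq0 indG i0.
  apply: (@dhomog_uniq 3 K mdeg (h * G 0 i0)); first by rewrite mulf_neq0.
    have -> : h * G 0 i0 = cross (T a) (T b) 0 i0 by rewrite hE mxE.
    exact: homog_row_cross.
  by rewrite kE mul_mpolyC rpredZ.
have e0 j : (0 < e j)%N.
  rewrite lt0n; apply/eqP => ej; have /eqP[] := gens_neq0 j.
  by apply: (const_syz indG) => // i; have := Thom j i; rewrite ej.
have GE : G = k^-1%:MP *: cross (T a) (T b).
  by rewrite hE scalerA kE -mpolyCM mulVf // mpolyC1 scale1r.
have homZ d c (v : 'rV[R]_3) : homog_row d v -> homog_row d (c%:MP *: v).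
  by move=> hv i; rewrite mxE mul_mpolyC rpredZ.
have kk : k%:MP * k^-1%:MP = 1 :> R by rewrite -mpolyCM mulfV // mpolyC1.
have := e0 a; have := e0 b; have := Thom a; have := Thom b.
case ea : (e a) he => [|[|[|n]]] //=; rewrite ?addSn ?add0n.
- move=> [->] hb ha _ _; exists (T a), (k^-1%:MP *: T b); split=> //.
  + exact: homZ.
  + by rewrite crossZr.
  + move=> u /gen[x [y ->]]; exists x, (y * k%:MP).
    by rewrite scalerA -mulrA kk mulr1.
- move=> [->] hb ha _ _; exists (T b), (- k^-1%:MP *: T a); split=> //.
  + by rewrite -mpolyCN; apply: homZ.
  + by rewrite crossZr scaleNr -scalerN -crossC.
  + move=> u /gen[x [y ->]]; exists y, (- x * k%:MP).
    by rewrite scalerA mulNr mulrN mulNr opprK -mulrA kk mulr1 addrC.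
- by case=> /eqP; rewrite addn_eq0 => /andP[_ /eqP->] _ _.
Qed.

End Minimal.

Lemma saturated_hilbert_burch : hilbert_burch G.
Proof.
pose P N := boolp.asbool (exists (T : 'I_N -> 'rV[R]_3) e, homog_gens T e).
have exP : exists N, P N.
  by have [N h] := exists_homog_gens; exists N; apply/boolp.asboolP.
case: (ex_minnP exP) => N /boolp.asboolP[T [e gT]] minN.
apply: (minimal_hilbert_burch gT) => N' T' e' gT'; apply: minN.
by apply/boolp.asboolP; exists T', e'.
Qed.

End Freeness.

(** * Codimension and grade *)

Section RegularSequences.
Variables (K : fieldType) (n : nat).
Local Notation R := {mpoly K[n]}.

Lemma regular_seq_leq (f : nat -> R) m m' :
  (m <= m')%N -> regular_seq m' f -> regular_seq m f.
Proof. by move=> mm' reg k u km; apply: reg; apply: leq_trans mm'. Qed.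

Lemma gen_ideal0 (f : nat -> R) p : gen_ideal (fun i : 'I_0 => f i) p <-> p = 0.
Proof.
split=> [[c ->]|->]; first by rewrite big_ord0.
by exists (fun=> 0); rewrite big_ord0.
Qed.

Lemma gen_ideal1 (f : nat -> R) p :
  gen_ideal (fun i : 'I_1 => f i) p <-> dvdr (f 0%N) p.
Proof.
split=> [[c ->]|[c ->]]; first by exists (c ord0); rewrite big_ord1.
by exists (fun=> c); rewrite big_ord1.
Qed.

Lemma regular_seq2P (f : nat -> R) : regular_seq 2 f <->
  f 0%N != 0 /\ forall u, dvdr (f 0%N) (u * f 1%N) -> dvdr (f 0%N) u.
Proof.
split=> [reg|[f0 reg] [|[|//]] u _].
- split=> [|u h].
    apply/eqP => f0; have := reg 0%N 1 isT.
    by rewrite !gen_ideal0 mul1r => /(_ f0)/eqP; rewrite oner_eq0.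
  by apply/gen_ideal1/(reg 1%N) => //; apply/gen_ideal1.
- rewrite !gen_ideal0 => /eqP.
  by rewrite mulf_eq0 (negbTE f0) orbF => /eqP.
- by rewrite !gen_ideal1; apply: reg.
Qed.

End RegularSequences.

Lemma dvd_prime_prod (A : idomainType) (u b x : A) s :
  u \is a GRing.unit -> (forall p, p \in s -> prime_elt p /\ ~ dvdr p b) ->
  dvdr (u * \prod_(p <- s) p) (x * b) -> dvdr (u * \prod_(p <- s) p) x.
Proof.
move=> uu; elim: s x => [|p s IH] x ps h.
  by rewrite big_nil mulr1; exists (x / u); rewrite divrK.
have [[p0 np hp] pb] := ps p (mem_head _ _).
have [y xE] : dvdr p x.
  have : dvdr p (x * b).
    by apply: dvdr_trans h; exists (u * \prod_(q <- s) q); rewrite big_cons; ring.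
  by case/hp.
have [z zE] : dvdr (u * \prod_(q <- s) q) y.
  apply: IH => [q qs|]; first by apply: ps; rewrite inE qs orbT.
  apply: (dvdr_mul2l p0); apply: dvdr_trans (_ : dvdr _ (x * b)) _.
    by apply: dvdr_trans h; exists 1; rewrite big_cons; ring.
  by exists 1; rewrite xE; ring.
by exists z; rewrite big_cons xE zE; ring.
Qed.

Section LemmaA.
Variable K : fieldType.
Local Notation R := {mpoly K[3]}.
Variable G : 'rV[R]_3.
Hypotheses (G3 : homog_row 3 G) (indG : lin_indep G).
Local Notation J := (row_ideal G).

(** The upper half of codimension 2. The lower half comes from a regular sequence in [J], by
    [regular_seq_height]. *)
Definition codim_le2 : Prop := exists2 P : {pred R},
  prime_ideal P /\ (forall f, J f -> f \in P) & ~ height_ge P 3.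

Lemma regular_seq_length : codim_le2 ->
  forall m f, regular_seq m f /\ (forall i, (i < m)%N -> J (f i)) -> (m <= 2)%N.
Proof.
move=> [P [primeP JP] nP] m f [reg Jf]; rewrite leqNgt; apply/negP => m3.
apply: nP; apply: (regular_seq_height primeP (regular_seq_leq m3 reg)).
by move=> i i3; apply/JP/Jf; apply: leq_trans m3.
Qed.

Lemma par_of_regular (f : nat -> R) :
  regular_seq 2 f -> J (f 0%N) -> J (f 1%N) -> par_prop G.
Proof.
move=> /regular_seq2P[f0 reg] [c cE] [d dE].
by apply: (@par_regular _ G c d); rewrite -cE -?dE.
Qed.

(** The codimension bounds the grade by 2 from above, and the projective dimension is at least 2.
    Perfection makes both equal to 2, which gives a resolution of length 2 and a regular sequence
    for [par_prop]. *)
Theorem free_hilbert_burch : codim J 2 -> perfect J -> hilbert_burch G.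
Proof.
move=> [_ cod] [g [[f [reg Jf]] gmax] [[b [gm [d [bg res]]]] pmin]].
have g2 : (g <= 2)%N by apply: (regular_seq_length cod (conj reg Jf)).
have b1 := resolution_length_gt1 G3 indG res.
have gE : g = 2%N by apply/eqP; rewrite eqn_leq g2 (leq_trans b1 bg).
subst g; apply: saturated_hilbert_burch => //.
- exact: (saturated res bg).
- exact: (syz_finitely_generated res).
- by apply: par_of_regular reg _ _; apply: Jf.
Qed.

Lemma row_ideal_pihomog d p : J p -> J (pihomog mdeg d p).
Proof.
case=> c ->; pose q i := if (3 <= d)%N then pihomog mdeg (d - 3) (c 0 i) else 0.
exists (\row_i q i); rewrite /dot raddf_sum; apply: eq_bigr => i _.
by rewrite /= (pihomog_homogM _ _ (G3 i)) mxE.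
Qed.

(* If every power of [x_i] stays out of [J], some prime over [J] avoids
   [K[x_i] \ 0]; modulo it [x_i] is transcendental, which bounds the height. *)
Lemma codim_le2_power i : (forall k, ~ J ('X_i ^+ k)) -> codim_le2.
Proof.
move=> nJ; pose t : 1.-tuple R := [tuple 'X_i].
pose S x := exists2 g : {mpoly K[1]}, g != 0 & x = g \mPo t.
have multS : mult_closed S.
  split; first by exists 1; rewrite ?oner_eq0 // rmorph1.
  by move=> _ _ [g g0 ->] [h h0 ->]; exists (g * h); rewrite ?mulf_neq0 // rmorphM.
have disj x : J x -> ~ S x.
  move=> Jx [g g0 xE]; have mg := mlead_supp g0; set m := mlead g in mg.
  pose k := mdeg m; apply: (nJ k).
  have pE : pihomog mdeg k x = g@_m *: 'X_i ^+ k.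
    rewrite xE comp_mpolyEX raddf_sum /= (bigD1_seq m) //= linearZ /=.
    have XE m' : ('X_[m'] : {mpoly K[1]}) \mPo t = 'X_i ^+ mdeg m'.
      by rewrite comp_mpolyX mdegE !big_ord1 (tnth_nth 0).
    rewrite XE pihomog_dE; last by rewrite -[X in X.-homog]mul1n; apply/dhomogMn/homogX.
    rewrite big1_seq ?addr0 // => m' /andP[mm' _]; rewrite linearZ /= XE.
    rewrite (@pihomog_ne0 _ _ _ (mdeg m')) ?scaler0 //; last first.
      by rewrite -[X in X.-homog]mul1n; apply/dhomogMn/homogX.
    apply: contra mm'; rewrite /k !mdegE !big_ord1 => /eqP e.
    by apply/eqP/mnmP => j; rewrite ord1.
  have := row_ideal_pihomog k Jx; rewrite pE => Jk.
  have -> : 'X_i ^+ k = (g@_m)^-1%:MP * (g@_m *: 'X_i ^+ k).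
    by rewrite mul_mpolyC scalerA mulVf ?scale1r // -mcoeff_msupp.
  by apply: idealMl Jk; apply: row_ideal_is_ideal.
have [P [idP prP JP SP]] := krull_separation (row_ideal_is_ideal G) multS disj.
have primeP : prime_ideal P by split.
exists P; first by split.
(* Height 3 and one transcendental element modulo [P] would give 4 algebraically independent
   elements in 3 variables. *)
move=> hP; have [|t' /alg_independent_leq] := indep_mod_height (t := t) hP; last by [].
move=> p pP; apply/eqP/negPn/negP => p0.
by have /negP := SP (p \mPo t) (ex_intro2 _ _ p p0 erefl).
Qed.

(** If a power k_i of each variable were in [J], every monomial of degree k_0 + k_1 + k_2 would be
    in [J], since one of its exponents reaches k_i. *)
Lemma codim_le2_degree : (forall d, exists2 f, f \is d.-homog & ~ J f) -> codim_le2.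
Proof.
move=> nJ; apply: boolp.contrapT => h.
have pw i : exists k, J ('X_i ^+ k).
  apply: boolp.contrapT => hi; apply: h; apply: (codim_le2_power (i := i)).
  by move=> k Jk; apply: hi; exists k.
have [k kP] := boolp.choice pw.
have idJ := row_ideal_is_ideal G.
have [f fd nf] := nJ (k i0 + k i1 + k i2)%N; apply: nf.
rewrite [f]mpolyE big_seq; apply: (ideal_sum idJ) => m mf.
rewrite -mul_mpolyC; apply: idealMl => //.
have [i ki] : exists i, (k i <= m i)%N.
  apply: boolp.contrapT => hk.
  have lt i : (m i < k i)%N by rewrite ltnNge; apply/negP => ki; apply: hk; exists i.
  have e : (m i0 + m i1 + m i2 = k i0 + k i1 + k i2)%N.
    by have := dhomog_mf fd mf; rewrite /= mdegE sum3.
  have : (m i0 + m i1 + m i2 < k i0 + k i1 + k i2)%N.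
    by rewrite -addSn leq_add ?(ltnW (lt _)) // -addSn leq_add ?(ltnW (lt _)).
  by rewrite e ltnn.
rewrite mpolyXE_id (bigD1 i) //= -(subnK ki) exprD mulrAC.
exact: idealMl.
Qed.

End LemmaA.

Section HilbertBurch.
Variable K : fieldType.
Local Notation R := {mpoly K[3]}.
Variable G : 'rV[R]_3.
Hypotheses (G3 : homog_row 3 G) (indG : lin_indep G).
Local Notation J := (row_ideal G).

(** A nonzero entry is a linear form, hence prime. If it divided all entries, [s] would be a
    constant vector times that form, and the constants would be a linear relation on [G]. *)
Lemma lin_syz_par s : homog_row 1 s -> s != 0 -> dot s G = 0 -> par_prop s.
Proof.
move=> hs s0 sG.
have [i si] : exists i, s 0 i != 0.
  apply: boolp.contrapT => h; case/eqP: s0; apply/rowP => i; rewrite mxE.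
  by apply/eqP/negPn/negP => si; apply: h; exists i.
have pi := prime_lin_form si (hs i).
apply: boolp.contrapT => npar.
have dvd j : dvdr (s 0 i) (s 0 j).
  by apply: boolp.contrapT => nd; apply: npar; apply: par_prime nd.
have [c cE] := boolp.choice (fun j => lin_form_dvd si (hs i) (hs j) (dvd j)).
have cG : \sum_j c j *: G 0 j = 0.
  apply: (mulfI si); rewrite mulr0 -[RHS]sG /dot mulr_sumr.
  by apply: eq_bigr => j _; rewrite (cE j) -scalerAr scalerAl.
by move: si; rewrite cE (indG cG) scale0r eqxx.
Qed.

Variables s t : 'rV[R]_3.
Hypotheses (hs : homog_row 1 s) (ht : homog_row 2 t) (GE : G = cross s t).
Hypothesis gen : forall u : 'rV[R]_3, dot u G = 0 -> exists a b, u = a *: s + b *: t.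

Lemma hb_syz1 : dot s G = 0. Proof. by rewrite GE dot_crossl. Qed.
Lemma hb_syz2 : dot t G = 0. Proof. by rewrite GE dot_crossr. Qed.

Lemma hb_neq0 : s != 0.
Proof.
apply: contraNneq (indep_row_neq0 indG) => s0; rewrite GE s0.
by apply/eqP; apply: row3P; rewrite !mxE /=; ring.
Qed.

Lemma hb_indep a b : a *: s + b *: t = 0 -> a = 0 /\ b = 0.
Proof.
move=> h; have G0 := indep_row_neq0 indG.
split; apply: (scale_row_inj G0); rewrite scale0r.
  have := congr1 (fun v => cross v t) h.
  rewrite crossDl !crossZl crossvv scaler0 addr0 -GE => ->.
  by apply: row3P; rewrite !mxE /=; ring.
have := congr1 (cross s) h.
rewrite crossDr !crossZr crossvv scaler0 add0r -GE => ->.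
by apply: row3P; rewrite !mxE /=; ring.
Qed.

(* [G i] is a nonzerodivisor modulo which [J] has no annihilator:
   [(G i) : J = (G i)]. *)
Lemma hb_colon i (u : R) : (forall j, dvdr (G 0 i) (u * G 0 j)) -> dvdr (G 0 i) u.
Proof.
move=> h; have [v vE] := boolp.choice h.
have Gi := indep_neq0 indG i.
have vG : G 0 i *: \row_j v j = u *: G.
  by apply/rowP => j; rewrite !mxE vE mulrC.
(* With w a unit vector, v x w is a syzygy because G_i (v x w) = u (G x w). Written as a s + b t and
   crossed with [s], it yields G_i b = u s_k. *)
have bP k : exists b, G 0 i * b = u * s 0 k.
  pose w : 'rV[R]_3 := delta_mx 0 k.
  have sw : dot s w = s 0 k.
    rewrite /dot (bigD1 k) //= mxE !eqxx mulr1 big1 ?addr0 // => m mk.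
    by rewrite mxE (negbTE mk) andbF mulr0.
  have vwG : G 0 i *: cross (\row_j v j) w = u *: cross G w.
    by rewrite -!crossZl vG.
  have [|a [b abE]] := gen (u := cross (\row_j v j) w).
    by apply: (mulfI Gi); rewrite -dotZl vwG dotZl [dot _ G]dotC dot_crossl !mulr0.
  exists b; apply: (scale_row_inj (indep_row_neq0 indG)).
  have := congr1 (cross s) vwG.
  rewrite abE GE triple_cross !crossZr !crossDr crossNr !crossZr crossvv -GE sw.
  by rewrite !scaler0 oppr0 add0r addr0 !scalerA.
have [b bE] := boolp.choice bP.
have bs : G 0 i *: \row_k b k = u *: s by apply/rowP => k; rewrite !mxE bE.
have [|k kE] := lin_syz_par hs hb_neq0 hb_syz1 (b := \row_k b k).
  have : G 0 i *: cross (\row_k b k) s = 0.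
    by rewrite -crossZl bs crossZl crossvv scaler0.
  move=> e; apply/rowP => j; rewrite [RHS]mxE; apply: (mulfI Gi).
  by move/rowP/(_ j): e; rewrite mxE [RHS]mxE mulr0.
exists k; rewrite mulrC; apply: (scale_row_inj hb_neq0).
by rewrite -bs kE scalerA.
Qed.

(** Prime avoidance: [tt] collects the prime factors of [G 0 i0] that do not divide [G 0 i1], so a
    common prime of [G 0 i0] and [b] divides all three entries. Its cofactor in [G 0 i0] would then
    multiply [J] into the ideal of [G 0 i0], against [hb_colon]. *)
Lemma hb_regular : exists f : nat -> R,
  [/\ regular_seq 2 f, J (f 0%N) & J (f 1%N)].
Proof.
have G0 := indep_neq0 indG i0.
have [u [ps [uu prim aE]]] := factorial_mpoly G0.
pose tt := \prod_(p <- [seq p <- ps | ~~ boolp.asbool (dvdr p (G 0 i1))]) p.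
pose b := G 0 i1 + tt * G 0 i2.
have nb p : p \in ps -> prime_elt p /\ ~ dvdr p b.
  move=> pin; have pp := prim p pin; split=> // pb; have [p0 np hp] := pp.
  have [c cE] : dvdr p (G 0 i0).
    rewrite aE (perm_big _ (perm_to_rem pin)) big_cons /=.
    by exists (u * \prod_(q <- rem p ps) q); ring.
  have c0 : c != 0 by apply: contraNneq G0 => e; rewrite cE e mul0r.
  have [pG1|pG1] := boolp.EM (dvdr p (G 0 i1)); last first.
    apply: (pG1); have : dvdr p (tt * G 0 i2).
      have pin' : p \in [seq p <- ps | ~~ boolp.asbool (dvdr p (G 0 i1))].
        by rewrite mem_filter pin andbT; apply/negP => /boolp.asboolP /pG1.
      apply: dvdr_mulr; rewrite /tt (perm_big _ (perm_to_rem pin')) /=.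
      by rewrite big_cons; apply: dvdr_mulr; apply: dvdr_refl.
    by rewrite /b addrC in pb; move=> h; apply: dvdrDr pb h.
  have pG2 : dvdr p (G 0 i2).
    have : dvdr p (tt * G 0 i2) by apply: dvdrDr pb pG1.
    case/hp => // /(prime_dvd_prod pp)[q]; rewrite mem_filter => /andP[nq qs] pq.
    have [v vu qE] := dvdr_primes pp (prim q qs) pq.
    case/negP: nq; apply/boolp.asboolP; case: pG1 => z ->.
    by exists (z * v^-1); rewrite qE; rewrite mulrA divrK.
  have : dvdr (G 0 i0) c.
    apply: hb_colon; apply: ord3P.
    - by apply: dvdr_mull; apply: dvdr_refl.
    - by case: pG1 => z ->; exists z; rewrite cE; ring.
    - by case: pG2 => z ->; exists z; rewrite cE; ring.
  case=> z zE; case/negP: np; apply/unitrPr; exists z.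
  by apply: (mulfI c0); rewrite mulr1 {2}zE cE; ring.
exists (fun i => if i == 0%N then G 0 i0 else b); split => /=.
- apply/regular_seq2P; split=> //= x.
  by rewrite aE; apply: dvd_prime_prod.
- exact: row_ideal_gen.
- apply: idealD (row_ideal_is_ideal G) _ _ _ _; first exact: row_ideal_gen.
  by apply: idealMl (row_ideal_is_ideal G) _ _ _; apply: row_ideal_gen.
Qed.

Let b34 : seq (seq nat) := [:: [:: 3; 3; 3]; [:: 4; 5]]%N.

Lemma hb_resolution : has_minimal_resolution J b34.
Proof.
pose g : 'cV[R]_(rk b34 0) := G^T.
pose d k : 'M[R]_(rk b34 k.+1, rk b34 k) :=
  match k return 'M[R]_(rk b34 k.+1, rk b34 k) with
  | 0 => \matrix_(i < 2, j < 3) (if val i == 0%N then s 0 j else t 0 j)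
  | _ => 0
  end.
have rk0 k : rk b34 k.+2 = 0%N by rewrite /rk nth_default.
have hs' : homog_row (4 - 3) s by [].
have ht' : homog_row (5 - 3) t by [].
have noI k (i : 'I_(rk b34 k.+2)) : False by case: i => j; rewrite rk0.
have dE (u : 'rV[R]_2) : u *m (d 0%N : 'M_(2, 3)) = u 0 0 *: s + u 0 1 *: t.
  apply/rowP => j; rewrite !mxE big_ord_recl big_ord1 !mxE /=.
  by congr (u 0 _ * s 0 j + u 0 _ * t 0 j); apply/val_inj.
have gE (u : 'rV[R]_3) : (u *m (g : 'cV_3)) 0 0 = dot u G.
  by rewrite mxE; apply: eq_bigr => i _; rewrite mxE.
exists g, d; split; last first.
  split=> [i|[|k] i j]; last by rewrite mxE mcoeff0.
    by rewrite mxE; apply: homog_coef0 (G3 _).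
  by rewrite mxE; case: ifP => _; [exact: homog_coef0 (hs _)|exact: homog_coef0 (ht _)].
split.
- move=> i j; rewrite ord1 /= subn0 mxE.
  by elim/ord3P: i.
- move=> [|k] i j; last by case: (noI k i).
  rewrite mxE; case: i => [[|[|//]] il] /=; move: j; apply: ord3P => /=.
  - exact (hs' i0).
  - exact (hs' i1).
  - exact (hs' i2).
  - exact (ht' i0).
  - exact (ht' i1).
  - exact (ht' i2).
- move=> f; split=> [[c ->]|[u ->]]; last by exists u; rewrite gE.
  by exists c; rewrite gE.
- move=> u; split=> [ug|[w ->]].
    have /gen[a [b uE]] : dot u G = 0 by rewrite -gE ug mxE.
    exists (\row_(i < 2) if val i == 0%N then a else b).
    by rewrite (dE (\row_(i < 2) _)) uE !mxE.
  apply: mx11_eq0; rewrite gE dE dotDl !dotZl hb_syz1 hb_syz2; ring.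
- case=> [|k] u; last first.
    split=> [_|[w ->]]; last by rewrite mulmx0.
    by exists 0; rewrite mulmx0; apply/rowP => j; case: (noI k j).
  split=> [|[w ->]]; last by rewrite mulmx0 mul0mx.
  rewrite dE => /hb_indep[u0 u1]; exists 0; rewrite mulmx0.
  apply/rowP => j; rewrite mxE; case: j => [[|[|//]] jl].
    by rewrite -[RHS]u0; congr (u 0 _); apply/val_inj.
  by rewrite -[RHS]u1; congr (u 0 _); apply/val_inj.
Qed.

Lemma hb_codim_perfect : codim_le2 G -> codim J 2 /\ perfect J.
Proof.
move=> cod; have [f [reg f0 f1]] := hb_regular.
have Jf i : (i < 2)%N -> J (f i) by case: i => [|[|]].
split.
  split=> // P [primeP JP].
  by apply: (regular_seq_height primeP reg) => i /Jf; apply: JP.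
exists 2%N; first by split; [exists f | apply: regular_seq_length cod].
split; first by have [g [d [res _]]] := hb_resolution; exists b34, g, d.
move=> m [b [g [d [bm res]]]]; apply: leq_trans bm.
exact: (resolution_length_gt1 G3 indG res).
Qed.

End HilbertBurch.

Lemma hb_indeg (K : fieldType) (F : {mpoly K[3]}) :
  lin_indep (grad F) -> hilbert_burch (grad F) -> indeg_syz F 1.
Proof.
move=> ind [s [t [hs ht GE gen]]]; split.
  exists s; split=> //; first exact: (hb_neq0 ind GE).
  by apply/is_syzygyE; apply: (hb_syz1 GE).
move=> e s' [s'0 /is_syzygyE syz hs']; rewrite lt0n; apply/eqP => e0.
by case/eqP: s'0; apply: (const_syz ind) => // i; have := hs' i; rewrite e0.
Qed.

(** * Hilbert functions *)

Section Count.
Variable K : fieldType.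

Lemma rank_count (aT rT : vectType K) (f : aT -> rT) : linear f ->
  exists (Z : {vspace aT}) (W : {vspace rT}),
    [/\ forall v, v \in Z <-> f v = 0, forall w, w \in W <-> exists v, w = f v
      & (\dim Z + \dim W = dim aT)%N].
Proof.
move=> lf; pose g : {linear aT -> rT} :=
  HB.pack_for {linear aT -> rT} f (GRing.isLinear.Build K aT rT *:%R f lf).
exists (lker (linfun g)), (limg (linfun g)); split.
- by move=> v; rewrite memv_ker lfunE /=; split=> [/eqP|->].
- move=> w; split=> [/memv_imgP[v _ ->]|[v ->]].
    by exists v; rewrite lfunE.
  by apply/memv_imgP; exists v; rewrite ?memvf // lfunE.
- by rewrite -{1}[lker _]capfv limg_ker_dim dimvf.
Qed.

Lemma injective_count (aT rT : vectType K) (f : aT -> rT) (U : {vspace rT}) :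
  linear f -> (forall v, f v = 0 -> v = 0) -> (forall v, f v \in U) ->
  (dim aT <= \dim U)%N /\ (dim aT = \dim U <-> forall w, w \in U -> exists v, w = f v).
Proof.
move=> lf injf fU; have [Z [W [Zf Wf ZW]]] := rank_count lf.
have Z0 : (\dim Z = 0)%N.
  apply/eqP; rewrite dimv_eq0; apply/eqP/vspaceP => v; rewrite memv0.
  by apply/idP/eqP => [/Zf/injf|->]; rewrite ?mem0v.
have WU : (W <= U)%VS by apply/subvP => w /Wf[v ->].
rewrite Z0 add0n in ZW; rewrite -ZW; split; first exact: dimvS.
split=> [WUd w wU|h].
  by apply/Wf; suff /eqP -> : W == U by []; rewrite eqEdim WU WUd /=.
apply/eqP; rewrite eqn_leq !dimvS //.
by apply/subvP => w /h /Wf.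
Qed.

Lemma quotient_count (vT : vectType K) (W : {vspace vT}) h :
  (exists e : 'I_h -> vT,
     (forall c : 'I_h -> K, \sum_i c i *: e i \in W -> forall i, c i = 0) /\
     (forall v, exists c : 'I_h -> K, v - \sum_i c i *: e i \in W)) <->
  (h + \dim W = dim vT)%N.
Proof.
split=> [[e [ind gen]]|hW].
  pose X := [tuple e i | i < h].
  have XE (i : 'I_h) : X`_i = e i by rewrite (nth_map i) ?size_enum_ord // nth_ord_enum.
  have sumX (c : 'I_h -> K) : \sum_i c i *: X`_i = \sum_i c i *: e i.
    by apply: eq_bigr => i _; rewrite XE.
  have fX : free X.
    by apply/freeP => c; rewrite sumX => c0; apply: ind; rewrite c0 mem0v.
  have dX : \dim <<X>> = h by move/eqP: fX; rewrite size_tuple.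
  have XW : (<<X>> :&: W = 0)%VS.
    apply/eqP; rewrite -subv0; apply/subvP => v; rewrite memv_cap => /andP[vX vW].
    have vE := coord_span vX; rewrite sumX in vE.
    rewrite vE in vW; rewrite memv0 vE big1 // => i _.
    by rewrite (ind _ vW) scale0r.
  rewrite -{1}dX -(dimv_disjoint_sum XW) -dimvf.
  suff -> : (<<X>> + W)%VS = fullv by [].
  apply/vspaceP => v; rewrite memvf; have [c cW] := gen v.
  rewrite -(subrK (\sum_i c i *: e i) v) addrC; apply: memv_add => //.
  by apply: memv_suml => i _; rewrite memvZ // -XE memv_span // mem_nth // size_tuple.
have dC : \dim W^C = h by rewrite dimv_compl dimvf -hW addnK.
pose X : h.-tuple vT := tcast dC (vbasis W^C).
have XE : X = vbasis W^C :> seq vT by rewrite val_tcast.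
have bX : basis_of W^C X by rewrite XE vbasisP.
exists (fun i => X`_i); split=> [c cW|v].
  have c0 : \sum_i c i *: X`_i = 0.
    apply/eqP; rewrite -memv0 -(capv_compl W) memv_cap cW /=.
    by apply: memv_suml => i _; rewrite memvZ // (basis_mem bX) // mem_nth // size_tuple.
  by move/freeP: (basis_free bX); apply.
have : v \in (W + W^C)%VS by rewrite addv_complf memvf.
case/memv_addP => w wW [x xC ->]; exists (fun i => coord X i x).
by rewrite -(coord_basis bX xC) addrK.
Qed.

End Count.

Section HomogCount.
Variable K : fieldType.
Local Notation R := {mpoly K[3]}.
Local Notation V d := (dhomog 3 K d).

(** This binomial is convertible to the dimension of [dhomog 3 K d], on which the [dim _]
    conversions rely. *)
Definition hdim d := 'C(d + 2, d).

(** Doubled to avoid division, so that dimension counts become polynomial identities for [nia]. *)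
Lemma hdim2 d : (hdim d * 2 = (d + 2) * (d + 1))%N.
Proof.
rewrite /hdim -bin_sub ?leq_addr // addKn.
have := bin_ffact (d + 2) 2; rewrite (_ : 2`! = 2)%N // => ->.
by rewrite addn2 ffactSS ffactn1 addn1.
Qed.

Definition hm d (p : R) : V d := indhomog d p.

Lemma hmK d p : p \is d.-homog -> hm d p = p :> R.
Proof. by move=> hp; rewrite /hm /indhomog /insubd insubT. Qed.

Lemma V_homog d (p : V d) : (p : R) \is d.-homog.
Proof. by case: p. Qed.

Lemma V_eq0 d (p : V d) : (p : R) = 0 -> p = 0.
Proof. by move=> p0; apply/val_inj. Qed.

Lemma hilbert_funE (I : R -> Prop) d (W : {vspace V d}) h :
  (forall f : V d, f \in W <-> I f) ->
  hilbert_fun I d h <-> (h + \dim W = hdim d)%N.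
Proof.
move=> WI; rewrite -[hdim d]/(dim (V d)) -quotient_count.
have val_sum (c : 'I_h -> K) (e : 'I_h -> V d) :
    (\sum_i c i *: e i : V d) = \sum_i c i *: (e i : R) :> R.
  by rewrite [LHS]raddf_sum.
split=> [[e [ehom ind gen]]|[e [ind gen]]].
  exists (fun i => hm d (e i)); split=> [c /WI|v].
    rewrite val_sum; under eq_bigr do rewrite hmK //.
    exact: ind.
  have [c cI] := gen v (V_homog v); exists c; apply/WI.
  by rewrite [X in I X]raddfB /= val_sum; under eq_bigr do rewrite hmK //.
exists (fun i => e i : R); split=> [i|c|f hf].
- exact: V_homog.
- by rewrite -val_sum => /WI; apply: ind.
- have [c /WI cI] := gen (hm d f); exists c.
  by move: cI; rewrite raddfB /= val_sum hmK.
Qed.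

Section Ideal.
Variable G : 'rV[R]_3.
Hypotheses (G3 : homog_row 3 G) (indG : lin_indep G).
Local Notation J := (row_ideal G).

Definition toV3 d (v : 'rV[R]_3) : (V d * V d * V d)%type :=
  (hm d (v 0 i0), hm d (v 0 i1), hm d (v 0 i2)).

Definition ofV3 d (v : V d * V d * V d) : 'rV[R]_3 :=
  vec3 (v.1.1 : R) (v.1.2 : R) (v.2 : R).

Lemma ofV3_homog d (v : V d * V d * V d) : homog_row d (ofV3 v).
Proof. by apply: ord3P; rewrite mxE /=; apply: V_homog. Qed.

Lemma toV3K d v : homog_row d v -> ofV3 (toV3 d v) = v.
Proof. by move=> hv; apply: row3P; rewrite mxE /= hmK. Qed.

Lemma ofV3_linear d a (u v : V d * V d * V d) :
  ofV3 (a *: u + v) = a%:MP *: ofV3 u + ofV3 v.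
Proof. by apply: row3P; rewrite !mxE /= mul_mpolyC. Qed.

Lemma ofV3_inj d (v w : V d * V d * V d) : ofV3 v = ofV3 w -> v = w.
Proof.
case: v w => [[v0 v1] v2] [[w0 w1] w2] /rowP e.
have := e i0; have := e i1; have := e i2; rewrite !mxE /= => e2 e1 e0.
by congr (_, _, _); apply/val_inj.
Qed.

Lemma dot_homog d v : homog_row d v -> dot v G \is (d + 3).-homog.
Proof. by move=> hv; apply: rpred_sum => i _; apply: dhomogM. Qed.

Definition ev_dot d (v : V d * V d * V d) : V (d + 3) := hm (d + 3) (dot (ofV3 v) G).

Lemma ev_dotE d (v : V d * V d * V d) : ev_dot v = dot (ofV3 v) G :> R.
Proof. by apply: hmK; apply: dot_homog; apply: ofV3_homog. Qed.

Lemma ev_dot_linear d : linear (@ev_dot d).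
Proof.
move=> a u v; apply/val_inj.
by rewrite [LHS]ev_dotE ofV3_linear dotDl dotZl mul_mpolyC -(ev_dotE u) -(ev_dotE v).
Qed.

Lemma row_ideal_homog d f : J f -> f \is (d + 3).-homog ->
  exists2 v, homog_row d v & f = dot v G.
Proof.
case=> c cE hf; exists (\row_i pihomog mdeg d (c 0 i)).
  by move=> i; rewrite mxE; apply: pihomogP.
rewrite -(pihomog_dE hf) cE /dot raddf_sum; apply: eq_bigr => i _.
by rewrite /= (pihomog_homogM _ _ (G3 i)) leq_addl addnK mxE.
Qed.

Lemma row_ideal_space d : exists (Z : {vspace V d * V d * V d})
    (W : {vspace V (d + 3)}),
  [/\ forall v, v \in Z <-> dot (ofV3 v) G = 0,
      forall f : V (d + 3), f \in W <-> J f & (\dim Z + \dim W = 3 * hdim d)%N].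
Proof.
have [Z [W [Zf Wf ZW]]] := rank_count (@ev_dot_linear d); exists Z, W; split.
- move=> v; rewrite Zf -ev_dotE; split=> [->//|]; exact: V_eq0.
- move=> f; rewrite Wf; split=> [[v ->]|Jf].
    by exists (ofV3 v); rewrite ev_dotE.
  have [v hv fE] := row_ideal_homog Jf (V_homog f).
  by exists (toV3 d v); apply/val_inj; rewrite /= ev_dotE toV3K.
- rewrite ZW; transitivity (hdim d + hdim d + hdim d)%N => //; lia.
Qed.

Lemma hilbert_fun_low d h : (d < 3)%N -> hilbert_fun J d h <-> h = hdim d.
Proof.
move=> d3; rewrite (@hilbert_funE _ d 0%VS) => [|f]; first by rewrite dimv0 addn0.
rewrite memv0; split=> [/eqP->|Jf]; first exact: (row_ideal_is_ideal G).1.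
apply/eqP/V_eq0; rewrite -(pihomog_dE (V_homog f)).
exact: (row_ideal_low G3 d3 Jf).
Qed.

Lemma hilbert_fun_exists d : exists h, hilbert_fun J d h.
Proof.
have [d3|d3] := ltnP d 3; first by exists (hdim d); apply/hilbert_fun_low.
rewrite -(subnK d3); move: (d - 3)%N => {d3}d.
have [Z [W [_ WJ _]]] := row_ideal_space d.
exists (hdim (d + 3) - \dim W)%N; apply/(hilbert_funE _ WJ).
by rewrite subnK //; have := dimvS (subvf W); rewrite dimvf.
Qed.

(* [J] contains [G i0] times every form, so the Hilbert function is at most
   that of a cubic curve. *)
Lemma hilbert_fun_le d h : hilbert_fun J (d + 3) h -> (h <= 3 * (d + 3))%N.
Proof.
have [Z [W [_ WJ _]]] := row_ideal_space d.
rewrite (hilbert_funE _ WJ) => hE.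
pose f (p : V d) : V (d + 3) := hm (d + 3) ((p : R) * G 0 i0).
have fE p : f p = (p : R) * G 0 i0 :> R.
  by apply: hmK; apply: dhomogM => //; apply: V_homog.
have [|||le _] := @injective_count K _ _ f W.
- by move=> a u v; apply/val_inj; rewrite [LHS]fE mulrDl -scalerAl -(fE u) -(fE v).
- move=> p /(congr1 (fun q : V _ => q : R)); rewrite fE => /eqP.
  by rewrite mulf_eq0 (negbTE (indep_neq0 indG _)) orbF => /eqP; apply: V_eq0.
- by move=> p; apply/WJ; rewrite fE; apply: idealMl (row_ideal_is_ideal G) _ _ _;
    apply: row_ideal_gen.
have d2 := hdim2 d; have d32 := hdim2 (d + 3).
rewrite -[dim _]/(hdim d) in le.
move: (hdim d) (hdim (d + 3)) (\dim W) le hE d2 d32 => /= a b w; nia.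
Qed.

End Ideal.
End HomogCount.

Section PolyPos.
Import Order.TTheory Num.Theory.

(** The uniform bound [eps] carries the induction: multiplied by n it outgrows the constant
    coefficient. *)
Lemma poly_eventually_pos (q : {poly rat}) : 0 < lead_coef q ->
  exists N, exists2 eps, 0 < eps & forall n, (N <= n)%N -> eps <= q.[n%:R].
Proof.
elim/poly_ind: q => [|q c IH]; first by rewrite lead_coef0 ltxx.
have [->|q0] := eqVneq q 0.
  rewrite mul0r add0r lead_coefC => c0; exists 0%N; exists c => // n _.
  by rewrite hornerC.
have -> : lead_coef (q * 'X + c%:P) = lead_coef q.
  rewrite lead_coefDl ?lead_coefMX // size_polyC size_mulX //.
  by rewrite (leq_ltn_trans (leq_b1 _)) // ltnS size_poly_gt0.
case/IH => N [e e0 Ne]; pose B := Num.bound ((`|c| + e) / e).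
exists (maxn N B); exists e => // n; rewrite geq_max => /andP[Nn Bn].
rewrite hornerD hornerMX hornerC.
have nB : (`|c| + e) / e <= n%:R.
  apply: le_trans (ltW (archi_boundP _)) _; last by rewrite ler_nat.
  exact: divr_ge0 (addr_ge0 (normr_ge0 _) (ltW e0)) (ltW e0).
rewrite ler_pdivrMr // in nB.
have : e * n%:R <= q.[n%:R] * n%:R by rewrite ler_wpM2r ?Ne.
have := ler_norm (- c); rewrite normrN; lra.
Qed.

End PolyPos.

Section Multiplicity.
Import Order.TTheory Num.Theory.
Variable K : fieldType.
Local Notation R := {mpoly K[3]}.
Variable G : 'rV[R]_3.
Hypotheses (G3 : homog_row 3 G) (indG : lin_indep G).
Local Notation J := (row_ideal G).

(** A zero Hilbert polynomial would make the length at least 1 + 3 + 6 = 10, since [J] starts in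
    degree 3. A nonconstant one would have slope 7 or higher degree with positive leading
    coefficient, against the bound 3d of [hilbert_fun_le]. *)
Lemma degree7_hilbert : degree J 7 ->
  exists N, forall d, (N <= d)%N -> hilbert_fun J d 7.
Proof.
case=> h [p [N [hJ hp]]]; case: eqP => [p0|/eqP p0] e7.
  have hN d : (N <= d)%N -> h d = 0%N.
    by move=> Nd; apply/eqP; rewrite -(eqr_nat rat) (hp _ Nd) p0 horner0.
  have hd d : (d < 3)%N -> h d = hdim d.
    by move=> d3; apply/(hilbert_fun_low G3 _ d3).
  have N3 : (2 < N)%N.
    rewrite ltnNge; apply/negP => N2; have := hd 2%N isT.
    by rewrite (hN _ N2) /hdim.
  have : (7 = \sum_(d < N) h d)%N by apply/eqP; rewrite -(eqr_nat rat); apply/eqP.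
  by rewrite -(subnKC N3) big_split_ord /= !big_ord_recl big_ord0 /= !hd //.
exists N => d Nd; suff <- : h d = 7%N by [].
have lp0 : lead_coef p != 0 by rewrite lead_coef_eq0.
have fact0 k : 0 < k`!%:R :> rat by rewrite ltr0n fact_gt0.
have lpE : lead_coef p = 7%:R / ((size p).-1)`!%:R.
  by rewrite e7 mulfK // gt_eqF.
suff p1 : size p = 1%N.
  have [c _ pE] : exists2 c, c != 0 & p = c%:P by apply/size_poly1P; rewrite p1.
  apply/eqP; rewrite -(eqr_nat rat) (hp _ Nd) pE hornerC.
  by rewrite e7 pE lead_coefC size_polyC (_ : _.-1 = 0%N) ?mulr1 //; case: (c != 0).
have sp : (0 < size p)%N by rewrite size_poly_gt0.
apply/eqP; rewrite eqn_leq sp andbT leqNgt; apply/negP => p2.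
have [|N' [eps eps0 pos]] := @poly_eventually_pos (p - 3%:R *: 'X).
  have [p3|p3] := ltnP 2 (size p).
    rewrite lead_coefDl; first by rewrite lpE divr_gt0.
    by rewrite size_polyN size_scale ?size_polyX // pnatr_eq0.
  have sp2 : size p = 2%N by apply/eqP; rewrite eqn_leq p3 p2.
  have lp7 : p`_1 = 7%:R by rewrite -[7%:R]divr1 -[1%N]/(2.-1) -sp2 -lead_coefE lpE sp2.
  have c1 : (p - 3%:R *: 'X)`_1 = 4%:R by rewrite coefB coefZ coefX mulr1 lp7; ring.
  have s2 : size (p - 3%:R *: 'X) = 2%N.
    apply/eqP; rewrite eqn_leq; apply/andP; split.
      rewrite (leq_trans (size_polyD _ _)) // size_polyN geq_max sp2 /=.
      by rewrite size_scale ?size_polyX // pnatr_eq0.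
    by rewrite ltnNge; apply/negP => /leq_sizeP/(_ 1%N isT)/eqP; rewrite c1 pnatr_eq0.
  by rewrite lead_coefE s2 c1 ltr0n.
pose m := (maxn N N' + 3)%N.
have Nm : (N <= m)%N by rewrite /m (leq_trans (leq_maxl N N')) ?leq_addr.
have N'm : (N' <= m)%N by rewrite /m (leq_trans (leq_maxr N N')) ?leq_addr.
have := pos m N'm; rewrite hornerD hornerN hornerZ hornerX -(hp _ Nm) -natrM.
have := hilbert_fun_le G3 indG (hJ m); rewrite -/m -(ler_nat rat) => le.
by move=> h1; have := lt_le_trans eps0 h1; rewrite subr_gt0 ltNge le.
Qed.

End Multiplicity.

(** * Combinations of a linear and a quadratic syzygy *)

Section Combinations.
Variable K : fieldType.
Local Notation R := {mpoly K[3]}.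
Local Notation V d := (dhomog 3 K d).
Variable G : 'rV[R]_3.
Hypotheses (G3 : homog_row 3 G) (indG : lin_indep G).
Local Notation J := (row_ideal G).
Variables s t : 'rV[R]_3.
Hypotheses (hs : homog_row 1 s) (ht : homog_row 2 t) (GE : G = cross s t).

Let sG : dot s G = 0. Proof. exact: hb_syz1 GE. Qed.
Let tG : dot t G = 0. Proof. exact: hb_syz2 GE. Qed.

Definition comb e (x : V e.+1 * V e) : (V e.+2 * V e.+2 * V e.+2)%type :=
  toV3 e.+2 ((x.1 : R) *: s + (x.2 : R) *: t).

Lemma combK e (x : V e.+1 * V e) :
  ofV3 (comb x) = (x.1 : R) *: s + (x.2 : R) *: t.
Proof.
apply: toV3K => i; rewrite !mxE; apply: rpredD.
  by apply: dhomogM_eq (V_homog _) (hs i) _; rewrite addn1.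
by apply: dhomogM_eq (V_homog _) (ht i) _; rewrite addn2.
Qed.

Lemma comb_linear e : linear (@comb e).
Proof.
move=> a x y; apply: ofV3_inj; rewrite ofV3_linear [LHS]combK (combK x) (combK y) /=.
by apply/rowP => i; rewrite !mxE -!mul_mpolyC; ring.
Qed.

(** As [s] and [t] are independent, [comb] is injective, so equal dimensions mean that the
    combinations exhaust the syzygies of degree e + 2. *)
Lemma comb_count e (Z : {vspace V e.+2 * V e.+2 * V e.+2}) :
  (forall v, v \in Z <-> dot (ofV3 v) G = 0) ->
  (hdim e.+1 + hdim e)%N = \dim Z <->
  forall u, homog_row e.+2 u -> dot u G = 0 -> exists a b, u = a *: s + b *: t.
Proof.
move=> Zf; have [|||_ eqZ] := @injective_count K _ _ (@comb e) Z.
- exact: comb_linear.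
- move=> [a b] /(congr1 (@ofV3 K e.+2)); rewrite combK /=.
  have -> : ofV3 (0 : V e.+2 * V e.+2 * V e.+2) = 0.
    by apply: row3P; rewrite !mxE.
  by case/(hb_indep indG GE) => /V_eq0 -> /V_eq0 ->.
- move=> x; apply/Zf; rewrite combK dotDl !dotZl sG tG; ring.
rewrite -[(hdim e.+1 + hdim e)%N]/(dim (V e.+1 * V e)%type) eqZ; split.
  move=> h u hu uG; have [|x xE] := h (toV3 e.+2 u).
    by apply/Zf; rewrite toV3K.
  by exists (x.1 : R), (x.2 : R); rewrite -combK -xE toV3K.
move=> h w /Zf wG; have [a [b abE]] := h _ (ofV3_homog w) wG.
exists (hm e.+1 (pihomog mdeg e.+1 a), hm e (pihomog mdeg e b)).
apply: ofV3_inj; rewrite combK /= !hmK ?pihomogP //.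
apply/rowP => i; rewrite -(pihomog_dE (ofV3_homog w i)) abE !mxE raddfD /=.
rewrite (pihomog_homogM _ _ (hs i)) (pihomog_homogM _ _ (ht i)) /=.
by rewrite subn1 subn2.
Qed.

(** Syzygies of degree e + 2 concern forms of degree e + 5, and hdim (e + 5) - 3 hdim (e + 2) + hdim
    (e + 1) + hdim e = 7. *)
Lemma hilbert_comb e : hilbert_fun J (e + 5) 7 <->
  forall u, homog_row e.+2 u -> dot u G = 0 -> exists a b, u = a *: s + b *: t.
Proof.
have [Z [W [Zf Wf ZW]]] := row_ideal_space G3 e.+2.
rewrite -(comb_count Zf).
have -> : (e + 5 = e.+2 + 3)%N by rewrite addSnnS addSnnS.
rewrite (hilbert_funE _ Wf).
have := hdim2 e; have := hdim2 e.+1; have := hdim2 e.+2; have := hdim2 (e.+2 + 3).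
move: (hdim (e.+2 + 3)) (hdim e.+2) (hdim e.+1) (hdim e) (\dim Z) (\dim W) ZW.
move=> /= a b c d z w; split; nia.
Qed.

Lemma syz_pihomog d u : dot u G = 0 -> dot (\row_i pihomog mdeg d (u 0 i)) G = 0.
Proof.
move=> uG; have E := congr1 (pihomog mdeg (d + 3)) uG.
rewrite raddf0 /dot raddf_sum /= in E; rewrite -[RHS]E; apply: eq_bigr => i _.
by rewrite (pihomog_homogM _ _ (G3 i)) leq_addl addnK mxE.
Qed.

(* The combinations of [s] and [t] form a free module, so its elements are
   detected by their multiples by the variables. *)
Lemma comb_saturated u : (forall i, exists a b, ('X_i : R) *: u = a *: s + b *: t) ->
  exists a b, u = a *: s + b *: t.
Proof.
move=> h; have [a aE] := boolp.choice h; have [b abE] := boolp.choice aE.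
have ind i j : 'X_j * a i - 'X_i * a j = 0 /\ 'X_j * b i - 'X_i * b j = 0.
  apply: (hb_indep indG GE); rewrite !scalerBl addrACA -opprD -!scalerA.
  by rewrite -!scalerDr -(abE i) -(abE j) !scalerA mulrC subrr.
have [|k kE] := @par_X K (\row_i a i).
  by apply: row3P; rewrite !mxE /= ![a _ * _]mulrC; apply: (ind _ _).1.
have [|m mE] := @par_X K (\row_i b i).
  by apply: row3P; rewrite !mxE /= ![b _ * _]mulrC; apply: (ind _ _).2.
exists k, m; apply/rowP => j; apply: (mulfI (mpolyX_neq0 K i0)).
have := abE i0; move/rowP/(_ i0): kE; move/rowP/(_ i0): mE; rewrite !mxE => -> ->.
by move/rowP/(_ j); rewrite !mxE => ->; ring.
Qed.

(** Counting settles the large degrees, and [comb_saturated] descends from degree d + 1 to degree d;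
    [D] measures the distance to the range of the count. *)
Lemma hilbert_gen N : (forall d, (N <= d)%N -> hilbert_fun J d 7) ->
  forall u, dot u G = 0 -> exists a b, u = a *: s + b *: t.
Proof.
move=> hN.
have homog_case D d : (N + 2 <= D + d)%N -> forall u, homog_row d u ->
    dot u G = 0 -> exists a b, u = a *: s + b *: t.
  elim: D d => [|D IH] d Nd u hu uG.
    have d2 : (2 <= d)%N by apply: leq_trans Nd; rewrite leq_addl.
    have [e dE] : exists e, d = e.+2 by exists (d - 2)%N; lia.
    subst d; apply: (hilbert_comb e).1 hu uG; apply: hN; lia.
  apply: comb_saturated => i; apply: (IH d.+1); first by lia.
    by move=> j; rewrite mxE; apply: dhomogM_eq (homogX _ i) (hu j) _.
  by rewrite dotZl uG mulr0.
move=> u uG.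
have comp d : exists a b, \row_i pihomog mdeg d (u 0 i) = a *: s + b *: t.
  apply: (homog_case (N + 2)%N d); rewrite ?leq_addr //; last exact: syz_pihomog.
  by move=> i; rewrite mxE; apply: pihomogP.
have [a aE] := boolp.choice comp; have [b abE] := boolp.choice aE.
pose B := (\max_i msize (u 0%R i))%N.
exists (\sum_(d < B) a d), (\sum_(d < B) b d).
rewrite !scaler_suml -big_split /=; under eq_bigr do rewrite -abE.
apply/rowP => i; rewrite summxE; under eq_bigr do rewrite mxE.
by apply: pihomog_partitionE; apply: leq_bigmax.
Qed.

End Combinations.

Section DegreeSeven.
Variable K : fieldType.
Local Notation R := {mpoly K[3]}.
Variable G : 'rV[R]_3.
Hypotheses (G3 : homog_row 3 G) (indG : lin_indep G).
Local Notation J := (row_ideal G).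

Lemma hb_hilbert : hilbert_burch G -> forall d, (5 <= d)%N -> hilbert_fun J d 7.
Proof.
move=> [s [t [hs ht GE gen]]] d d5; rewrite -(subnK d5).
by apply/(hilbert_comb G3 indG hs ht GE) => u _; apply: gen.
Qed.

Lemma hb_degree7 : hilbert_burch G -> degree J 7.
Proof.
move=> hb; have [h hP] := boolp.choice (hilbert_fun_exists G3).
have unique d a b : hilbert_fun J d a -> hilbert_fun J d b -> a = b.
  have [d3|d3] := ltnP d 3.
    by rewrite !(hilbert_fun_low G3 _ d3) => -> ->.
  rewrite -(subnK d3); have [Z [W [_ Wf _]]] := row_ideal_space G3 (d - 3).
  by rewrite !(hilbert_funE _ Wf) => <- /addIn.
exists h, 7%:R%:P, 5%N; split=> // [d d5|].
  by rewrite hornerC (unique _ _ _ (hP d) (hb_hilbert hb d5)).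
by rewrite polyC_eq0 lead_coefC size_polyC /= mulr1.
Qed.

Lemma hilbert_nonzero d : hilbert_fun J d 7 -> exists2 f, f \is d.-homog & ~ J f.
Proof.
move=> [e [ehom ind _]]; exists (e ord0) => // Je.
have : J (\sum_i (i == ord0)%:R *: e i).
  rewrite (bigD1 ord0) //= scale1r big1 ?addr0 // => i /negbTE->.
  by rewrite scale0r.
by move/ind/(_ ord0)/eqP; rewrite eqxx oner_eq0.
Qed.

(** If [J] contained all forms of one degree, it would contain all forms of higher degrees, where
    the Hilbert function is 7. *)
Lemma hilbert_codim_le2 N : (forall d, (N <= d)%N -> hilbert_fun J d 7) -> codim_le2 G.
Proof.
move=> hN; apply: codim_le2_degree => // d.
have [f hf nf] := hilbert_nonzero (hN (N + d)%N (leq_addr _ _)).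
apply: boolp.contrapT => h; apply: nf.
have Jd g : g \is d.-homog -> J g.
  by move=> hg; apply: boolp.contrapT => ng; apply: h; exists g.
have idJ := row_ideal_is_ideal G.
have Jup k g : g \is (k + d).-homog -> J g.
  elim: k g => [|k IH] g hg; first exact: Jd.
  have [a aE] := const0_dotX (homog_coef0 hg).
  rewrite -(pihomog_dE hg) aE /dot raddf_sum; apply: (ideal_sum idJ) => i _ /=.
  rewrite mxE mulrC (pihomog_homogM _ _ (homogX K i)) /= subn1 /= mulrC.
  by apply: idealMl => //; apply: IH; apply: pihomogP.
exact: Jup hf.
Qed.

End DegreeSeven.

(** * Linear syzygies *)

Lemma codim1_complement (K : fieldType) (vT : vectType K) (S U : {vspace vT}) :
  (S <= U)%VS -> \dim U = (\dim S).+1 ->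
  exists w, [/\ w \in U, w \notin S
    & forall w', w' \in U -> exists c : K, w' - c *: w \in S].
Proof.
move=> SU dU.
have [w wU wS] : exists2 w, w \in U & w \notin S.
  apply: boolp.contrapT => h; suff /dimvS : (U <= S)%VS by rewrite dU ltnn.
  by apply/subvP => w wU; apply/negPn/negP => wS; apply: h; exists w.
exists w; split=> // w' w'U.
have /eqP UE : (<[w]> + S == U)%VS.
  rewrite eqEdim subv_add SU -memvE wU /= dU.
  rewrite dimv_disjoint_sum; last first.
    apply/eqP; rewrite -subv0; apply/subvP => x; rewrite memv_cap => /andP[/vlineP[k ->] kS].
    have [->|k0] := eqVneq k 0; first by rewrite scale0r mem0v.
    case/negP: wS; have := memvZ k^-1 kS.
    by rewrite scalerA mulVf // scale1r.
  rewrite dim_vline; case: eqP wS => [->|_ _]; first by rewrite mem0v.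
  by rewrite add1n.
move: w'U; rewrite -UE => /memv_addP[x /vlineP[c ->] [y yS ->]].
by exists c; rewrite addrC addKr.
Qed.

(** * Excluding ideals generated by a quadric and a cubic *)

Section LinearForms.
Variable K : fieldType.
Local Notation R := {mpoly K[3]}.

Lemma two_lin_dvd (l l' A w : R) : A != 0 -> prime_elt l -> ~ dvdr l l' ->
  dvdr A (l * w) -> dvdr A (l' * w) -> dvdr A w.
Proof.
move=> A0 [l0 _ pl] nl [a aE] [a' aE'].
have e : l' * a = l * a'.
  apply: (mulIf A0); rewrite -!mulrA -aE -aE'; ring.
have [|//|[b bE]] := pl l' a; first by exists a'; rewrite e mulrC.
by exists b; apply: (mulfI l0); rewrite aE bE; ring.
Qed.

Lemma homog_linZ (c d : K) (i j : 'I_3) :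
  (c *: 'X_i - d *: 'X_j : R) \is 1.-homog.
Proof. by rewrite rpredB // rpredZ // homogX. Qed.

(* The quotient of the ideal [(A : B)] by [(A)] cannot be one-dimensional in all
   large degrees: multiplication by linear forms from one degree to the next
   would have a kernel of dimension at least 2. *)
Lemma colon_not_onedim (A B : R) N : A != 0 ->
  ~ (forall e, (N <= e)%N -> exists w, [/\ w \is e.-homog, dvdr A (w * B), ~ dvdr A w
       & forall w', w' \is e.-homog -> dvdr A (w' * B) ->
           exists c : K, dvdr A (w' - c *: w)]).
Proof.
move=> A0 h; have [w [hw wB nw _]] := h N (leqnn _).
have [v [_ _ _ vP]] := h N.+1 (leqnSn _).
have /boolp.choice[c cP] : forall i : 'I_3, exists c : K, dvdr A ('X_i * w - c *: v).
  move=> i; apply: vP; first by apply: dhomogM_eq (homogX _ i) hw _; rewrite add1n.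
  by rewrite -mulrA; apply: dvdr_mull.
(* These linear forms kill [w] modulo [A]. Two non-proportional ones exist if some c_j is nonzero;
   otherwise the variables themselves kill [w]. Either way [A] divides [w]. *)
have lin i j : dvdr A ((c j *: 'X_i - c i *: 'X_j) * w).
  have -> : (c j *: 'X_i - c i *: 'X_j) * w =
      (c j)%:MP * ('X_i * w - c i *: v) - (c i)%:MP * ('X_j * w - c j *: v).
    by rewrite -!mul_mpolyC; ring.
  by apply: dvdrB; apply: dvdr_mull.
have two i j k : i != j -> i != k -> j != k -> c j != 0 -> False.
  move=> ij ik jk cj; apply: nw.
  have coef m l : (c j *: 'X_m - c m *: 'X_j : R)@_(U_(l))%MM =
      c j * (m == l)%:R - c m * (j == l)%:R.
    by rewrite mcoeffB !mcoeffZ !mcoeffX !eq_mnm1.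
  have nz m : m != j -> (c j *: 'X_m - c m *: 'X_j : R) != 0.
    move=> mj; apply/eqP => /(congr1 (mcoeff U_(m)%MM)); rewrite coef mcoeff0.
    by rewrite eqxx [j == m]eq_sym (negbTE mj) mulr1 mulr0 subr0 => /eqP; rewrite (negbTE cj).
  apply: (@two_lin_dvd (c j *: 'X_i - c i *: 'X_j) (c j *: 'X_k - c k *: 'X_j)) => //.
    by apply: prime_lin_form; [apply: nz | apply: homog_linZ].
  move=> /(lin_form_dvd (nz i ij) (homog_linZ _ _ _ _) (homog_linZ _ _ _ _))[m mE].
  have := congr1 (mcoeff U_(k)%MM) mE; rewrite mcoeffZ !coef eqxx.
  rewrite (negbTE ik) (negbTE jk) mulr1n !mulr0n !(mulr0, subr0) mulr1.
  by move/eqP; rewrite (negbTE cj).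
have [c1|c1] := eqVneq (c i1) 0; last exact: (@two i0 i1 i2).
have [c2|c2] := eqVneq (c i2) 0; last exact: (@two i0 i2 i1).
apply: nw; apply: (@two_lin_dvd 'X_i1 'X_i2) => //.
- exact: prime_mpolyX.
- exact: mpolyX_not_dvd.
- by have := cP i1; rewrite c1 scale0r subr0.
- by have := cP i2; rewrite c2 scale0r subr0.
Qed.

Local Notation V d := (dhomog 3 K d).

(** Modulo the Koszul multiples of (-B, A), the syzygies of (A, B) in a large degree have dimension
    7 - 6 = 1, where 6 = 2 * 3 is what the Koszul count alone would give. Hence (A : B)/(A) is
    one-dimensional in large degrees, which [colon_not_onedim] excludes. *)
Lemma two_generator_absurd (J : R -> Prop) (A B : R) N :
  A != 0 -> A \is 2.-homog -> B \is 3.-homog ->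
  (forall d, (N <= d)%N -> hilbert_fun J d 7) ->
  (forall e f, (N <= e)%N -> f \is (e + 3).-homog -> J f <-> exists p q,
     [/\ p \is e.+1.-homog, q \is e.-homog & f = p * A + q * B]) ->
  False.
Proof.
move=> A0 hA hB hN JP.
apply: (@colon_not_onedim A B N.+2 A0) => -[|[|a]] // Na.
have {}Na : (N <= a)%N by [].
pose th (x : V a.+3 * V a.+2) : V (a.+2 + 3) := hm (a.+2 + 3) ((x.1 : R) * A + (x.2 : R) * B).
have thE x : th x = (x.1 : R) * A + (x.2 : R) * B :> R.
  apply: hmK; apply: rpredD.
    by apply: dhomogM_eq (V_homog _) hA _; rewrite addn2 addn3.
  by apply: dhomogM_eq (V_homog _) hB _.
have [|Z [W [Zth Wth ZW]]] := @rank_count K _ _ th.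
  move=> k x y; apply/val_inj; rewrite [LHS]thE.
  transitivity (k *: (th x : R) + (th y : R)); last by [].
  rewrite (thE x) (thE y) /= -!mul_mpolyC; ring.
have WJ (f : V (a.+2 + 3)) : f \in W <-> J f.
  rewrite Wth (JP a.+2); [|lia|exact: V_homog]; split=> [[x ->]|[p [q [hp hq fE]]]].
    by exists (x.1 : R), (x.2 : R); split; [exact: V_homog|exact: V_homog|exact: thE].
  by exists (hm a.+3 p, hm a.+2 q); apply/val_inj; rewrite [RHS]thE /= !hmK.
have hW : (7 + \dim W = hdim (a.+2 + 3))%N by apply/(hilbert_funE _ WJ)/hN; lia.
pose th' (r : V a) : (V a.+3 * V a.+2)%type :=
  (hm a.+3 (- ((r : R) * B)), hm a.+2 ((r : R) * A)).
have th1 r : (th' r).1 = - ((r : R) * B) :> R.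
  by apply: hmK; rewrite rpredN; apply: dhomogM_eq (V_homog _) hB _; rewrite addn3.
have th2 r : (th' r).2 = (r : R) * A :> R.
  by apply: hmK; apply: dhomogM_eq (V_homog _) hA _; rewrite addn2.
have [|Z' [S [Z'th Sth ZS]]] := @rank_count K _ _ th'.
  move=> k x y; apply/eqP; rewrite xpair_eqE; apply/andP; split; apply/eqP/val_inj.
    transitivity (k *: ((th' x).1 : R) + ((th' y).1 : R)); last by [].
    rewrite [LHS](th1 (k *: x + y)) (th1 x) (th1 y) /= -!mul_mpolyC; ring.
  transitivity (k *: ((th' x).2 : R) + ((th' y).2 : R)); last by [].
  rewrite [LHS](th2 (k *: x + y)) (th2 x) (th2 y) /= -!mul_mpolyC; ring.
have Z'0 : (\dim Z' = 0)%N.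
  apply/eqP; rewrite dimv_eq0; apply/eqP/vspaceP => v; rewrite memv0.
  apply/idP/eqP => [/Z'th h|->]; last exact: mem0v.
  have := th2 v; rewrite h => /esym/eqP.
  by rewrite mulf_eq0 (negbTE A0) orbF => /eqP/V_eq0.
have SZ : (S <= Z)%VS.
  apply/subvP => x /Sth[r ->]; apply/Zth/V_eq0.
  by rewrite thE th1 th2; ring.
have dZ : \dim Z = (\dim S).+1.
  have := hdim2 a; have := hdim2 a.+2; have := hdim2 a.+3; have := hdim2 (a.+2 + 3).
  move: ZW; rewrite -[dim _]/(hdim a.+3 + hdim a.+2)%N.
  move: ZS; rewrite Z'0 -[dim _]/(hdim a) add0n.
  move: (hdim (a.+2 + 3)) (hdim a.+3) (hdim a.+2) (hdim a) (\dim Z) (\dim S) (\dim W) hW.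
  move=> /= a1 a2 a3 a4 z s0 w; nia.
have [[p w] [pwZ pwS pwP]] := codim1_complement SZ dZ.
have E (x : V a.+3 * V a.+2) : x \in Z <-> (x.1 : R) * A + (x.2 : R) * B = 0.
  by rewrite Zth -thE; split=> [->//|]; apply: V_eq0.
exists (w : R); split.
- exact: V_homog.
- exists (- (p : R)); move/E: pwZ => /= /eqP.
  by rewrite addrC addr_eq0 => /eqP ->; rewrite mulNr.
- move=> [r rE]; case/negP: pwS; apply/Sth.
  have hr : r \is (a).-homog.
    apply: (homog_dvd_quot A0 hA); rewrite -rE addn2; exact: V_homog.
  have rK : hm a r = r :> R by exact: hmK.
  exists (hm a r); congr (_, _); apply/val_inj; last by rewrite [RHS]th2 rK.
  rewrite [RHS]th1 rK; apply: (mulIf A0); move/E: pwZ => /= /eqP.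
  by rewrite addr_eq0 rE => /eqP ->; ring.
- move=> w' hw' [q qE].
  have hq : q \is (a.+3).-homog.
    apply: (homog_dvd_quot A0 hA); rewrite -qE.
    by apply: dhomogM_eq hw' hB _; rewrite addn2 addn3.
  have [|c cS] := pwP (hm a.+3 (- q), hm a.+2 w').
    by apply/E; rewrite /= !hmK ?rpredN // qE; ring.
  exists c; have [r rE] := (Sth _).1 cS; exists (r : R).
  by rewrite -th2 -rE -[in LHS](hmK hw').
Qed.

End LinearForms.

Section ConstantMatrices.
Variable K : fieldType.
Local Notation R := {mpoly K[3]}.

Definition cmx m n (M : 'M[K]_(m, n)) : 'M[R]_(m, n) := map_mx (@mpolyC 3 K) M.

Lemma cmxM m n p (M : 'M[K]_(m, n)) (N : 'M_(n, p)) : cmx (M *m N) = cmx M *m cmx N.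
Proof. exact: map_mxM. Qed.

Lemma cmx1 n : cmx (1%:M : 'M_n) = 1%:M.
Proof. exact: map_mx1. Qed.

Lemma cmxT m n (M : 'M[K]_(m, n)) : (cmx M)^T = cmx M^T.
Proof. by rewrite /cmx map_trmx. Qed.

Lemma det_cmx n (M : 'M[K]_n) : \det (cmx M) = (\det M)%:MP.
Proof. exact: det_map_mx. Qed.

Lemma homog_row_mulmx d (u : 'rV[R]_3) (M : 'M[K]_3) :
  homog_row d u -> homog_row d (u *m cmx M).
Proof.
move=> hu i; rewrite mxE; apply: rpred_sum => j _.
by rewrite mxE mulrC mul_mpolyC rpredZ.
Qed.

Lemma lin_indep_mulmx (G : 'rV[R]_3) (M : 'M[K]_3) : M \in unitmx ->
  lin_indep G -> lin_indep (G *m cmx M).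
Proof.
move=> uM ind c cG.
have Mc : M *m \col_i c i = 0.
  apply/colP => j; rewrite [RHS]mxE; move: j; apply: ind; rewrite -[RHS]cG.
  under [RHS]eq_bigr do rewrite mxE scaler_sumr.
  rewrite exchange_big; apply: eq_bigr => j _; rewrite mxE scaler_suml.
  by apply: eq_bigr => i _; rewrite !mxE [G _ _ * _]mulrC mul_mpolyC scalerA mulrC.
move=> i; have := mulKmx uM (\col_i c i); rewrite Mc mulmx0.
by move/colP/(_ i); rewrite !mxE.
Qed.

Lemma row_ideal_mulmx (G : 'rV[R]_3) (M : 'M[K]_3) : M \in unitmx ->
  row_ideal (G *m cmx M) = row_ideal G.
Proof.
move=> uM; apply: boolp.funext => p; apply: boolp.propext; split=> -[c ->].
  by exists (c *m (cmx M)^T); rewrite dot_mulmx.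
exists (c *m (cmx (invmx M))^T).
by rewrite dot_mulmx -mulmxA -trmx_mul -cmxM mulmxV // cmx1 trmx1 mulmx1.
Qed.

(** Undoes a constant change of basis in a factorization as a cross product; the inverse determinant
    comes from [cross_mulmx]. *)
Lemma cross_transport (G u v : 'rV[R]_3) (M : 'M[K]_3) : M \in unitmx ->
  G *m (cmx M)^T = cross u v ->
  G = cross (u *m cmx M) ((\det M)^-1%:MP *: (v *m cmx M)).
Proof.
move=> uM GM; have dM : \det M != 0 by rewrite -unitfE -unitmxE.
have MK : (cmx M)^T *m (cmx (invmx M))^T = 1%:M.
  by rewrite -trmx_mul -cmxM mulVmx // cmx1 trmx1.
rewrite -[LHS]mulmx1 -MK mulmxA GM crossZr.
rewrite -[X in _ = _ *: X]mulmx1 -MK [X in _ = _ *: X]mulmxA cross_mulmx det_cmx.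
by rewrite -scalemxAl scalerA -mpolyCM mulVf // mpolyC1 scale1r.
Qed.

Lemma hilbert_burch_mulmx (G : 'rV[R]_3) (M : 'M[K]_3) : M \in unitmx ->
  hilbert_burch (G *m (cmx M)^T) -> hilbert_burch G.
Proof.
move=> uM [s [t [hs ht GE gen]]].
have dM : \det M != 0 by rewrite -unitfE -unitmxE.
exists (s *m cmx M), ((\det M)^-1%:MP *: (t *m cmx M)); split.
- exact: homog_row_mulmx.
- by move=> i; rewrite mxE mul_mpolyC rpredZ //; apply: homog_row_mulmx.
- exact: cross_transport.
- move=> u uG; have [|a [b abE]] := gen (u *m cmx (invmx M)).
    by rewrite dot_mulmx trmxK -mulmxA -cmxM mulVmx // cmx1 mulmx1.
  exists a, (b * (\det M)%:MP).
  rewrite scalerA -mulrA -mpolyCM mulfV // mpolyC1 mulr1.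
  rewrite -[LHS]mulmx1 -cmx1 -(mulVmx uM) cmxM mulmxA abE.
  by rewrite mulmxDl -!scalemxAl.
Qed.

Definition lin_coefs (l : 'rV[R]_3) : 'M[K]_3 := \matrix_(i, j) (l 0 j)@_(U_(i))%MM.

Lemma lin_coefsE l : homog_row 1 l -> l = Xv K *m cmx (lin_coefs l).
Proof.
move=> hl; apply/rowP => j; rewrite mxE [LHS](lin_formP (hl j)).
by apply: eq_bigr => i _; rewrite !mxE mulrC mul_mpolyC.
Qed.

End ConstantMatrices.

Section PencilOfLines.
Variable K : fieldType.
Local Notation R := {mpoly K[3]}.
Variables (r1 r2 : 'rV[K]_3) (k : 'I_3).
Local Notation lin r := (dot (cmx r) (Xv K)).
Local Notation p := (cross r1 r2).
Hypothesis pk : p 0 k != 0.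
Local Notation p' := (fun i => p 0 i / p 0 k).

Lemma lin_linear a (u v : 'rV[K]_3) : lin (a *: u + v) = a *: lin u + lin v.
Proof. by rewrite !dotE !mxE mpolyCD mpolyCM -mul_mpolyC; ring. Qed.

(* [p] spans the common zeros of the two linear forms. *)
Lemma homog_mod_lines d (f : R) : f \is d.-homog -> exists c1 c2,
  f = c1 * lin r1 + c2 * lin r2 + f.@[p'] *: 'X_k ^+ d.
Proof.
move=> hf; pose I := fun q : R => exists c1 c2, q = c1 * lin r1 + c2 * lin r2.
have idI : is_ideal I by apply: gen2_is_ideal.
pose t' : 3.-tuple R := [tuple p' i *: 'X_k | i < 3].
have It : I (f - (f \mPo t')).
  rewrite -{1}(comp_mpoly_id f); apply: subst_congr => // i; rewrite !tnth_mktuple.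
  (* Expanding w x (r1 x r2) in two ways expresses p_k x_i - p_i x_k through the two linear
     forms. *)
  pose w : 'rV[K]_3 := cross (delta_mx 0 k) (delta_mx 0 i).
  have dotd j (u : 'rV[K]_3) : dot (delta_mx 0 j) u = u 0 j.
    rewrite /dot (bigD1 j) //= mxE !eqxx mul1r big1 ?addr0 // => m mj.
    by rewrite mxE (negbTE mj) andbF mul0r.
  have E1 : cross w p = p 0 k *: delta_mx 0 i - p 0 i *: delta_mx 0 k.
    by rewrite triple_cross !dotd.
  have E2 : cross w p = dot r2 w *: r1 - dot r1 w *: r2.
    by rewrite crossC triple_cross opprB.
  have linE j : lin (delta_mx 0 j) = 'X_j.
    rewrite /dot (bigD1 j) //= !mxE !eqxx mul1r big1 ?addr0 // => m mj.
    by rewrite !mxE (negbTE mj) andbF mpolyC0 mul0r.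
  have lin0 : lin 0 = 0 by rewrite dotE !mxE mpolyC0; ring.
  have linZ a u : lin (a *: u) = a *: lin u.
    by rewrite -[a *: u]addr0 lin_linear lin0 addr0.
  have linB a b u v : lin (a *: u - b *: v) = a *: lin u - b *: lin v.
    by rewrite -scaleNr lin_linear linZ scaleNr.
  exists ((p 0 k)^-1 * dot r2 w)%:MP, (- ((p 0 k)^-1 * dot r1 w)%:MP).
  have E : p 0 k *: 'X_i - p 0 i *: 'X_k = dot r2 w *: lin r1 - dot r1 w *: lin r2.
    have /(congr1 (fun u : 'rV[K]_3 => lin u)) := etrans (esym E1) E2.
    by rewrite (linB (p 0 k)) (linB (dot r2 w)) !linE.
  rewrite mulNr !mul_mpolyC -!scalerA -scalerBr -E scalerBr !scalerA mulVf //.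
  by rewrite scale1r mulrC.
have ft : f \mPo t' = f.@[p'] *: 'X_k ^+ d.
  rewrite comp_mpolyEX mevalE scaler_suml !big_seq; apply: eq_bigr => m mf.
  rewrite -scalerA; congr (_ *: _); rewrite comp_mpolyX.
  transitivity (\prod_i (p' i ^+ m i *: ('X_k : R) ^+ m i)).
    by apply: eq_bigr => i _; rewrite tnth_mktuple exprZn.
  rewrite scaler_prod; congr (_ *: _).
  rewrite prodrXr; congr (_ ^+ _).
  by rewrite -(dhomog_mf hf mf) /= mdegE.
by case: It => c1 [c2 fE]; exists c1, c2; rewrite -ft -fE subrK.
Qed.

End PencilOfLines.

Section LinearSyzygy.
Variable K : fieldType.
Local Notation R := {mpoly K[3]}.

Section RankTwo.
Variable G : 'rV[R]_3.
Hypotheses (G3 : homog_row 3 G) (indG : lin_indep G).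
Local Notation J := (row_ideal G).
Variable N : nat.
Hypothesis hN : forall d, (N <= d)%N -> hilbert_fun J d 7.
Variable l : 'rV[R]_3.
Hypotheses (hl : homog_row 1 l) (l0 : l != 0) (lG : dot l G = 0).
Hypothesis l00 : l 0 i0 = 0.
Local Notation l1 := (l 0 i1).
Local Notation l2 := (l 0 i2).

Let rel : l1 * G 0 i1 + l2 * G 0 i2 = 0.
Proof. by have := lG; rewrite dotE l00 mul0r add0r. Qed.

Let l1n0 : l1 != 0.
Proof.
apply: contraNneq l0 => e; have := rel; rewrite e mul0r add0r => /eqP.
rewrite mulf_eq0 (negbTE (indep_neq0 indG _)) orbF => /eqP e2.
by apply/eqP; apply: row3P; rewrite mxE.
Qed.

Let l1_l2 : ~ dvdr l1 l2.
Proof.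
move=> /(lin_form_dvd l1n0 (hl _) (hl _))[c cE].
have : l1 * (G 0 i1 + c *: G 0 i2) = 0.
  by rewrite -[RHS]rel cE -!mul_mpolyC; ring.
move/eqP; rewrite mulf_eq0 (negbTE l1n0) /= => /eqP e.
have := indG (c := fun i => if i == i1 then 1 else if i == i2 then c else 0).
by rewrite sum3 /= scale0r add0r scale1r e => /(_ erefl i1)/eqP; rewrite oner_eq0.
Qed.

(* If [G i0] is nonzero at the common zero of [l1] and [l2], then [J] agrees in
   large degrees with the ideal of two forms of degrees 2 and 3, whose Hilbert
   function is not eventually 7. *)
Lemma rank2_cross : exists C, G = cross l C.
Proof.
have [A AE] : dvdr l1 (G 0 i2).
  have [_ _ pl] := prime_lin_form l1n0 (hl i1).
  have : dvdr l1 (l2 * G 0 i2).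
    by exists (- G 0 i1); apply/eqP; rewrite -subr_eq0 -rel; apply/eqP; ring.
  by case/pl.
have G1E : G 0 i1 = - A * l2.
  apply: (mulfI l1n0); apply/eqP; rewrite -subr_eq0; apply/eqP.
  by rewrite -[RHS]rel AE; ring.
have A0 : A != 0 by apply: contraNneq (indep_neq0 indG i2) => e; rewrite AE e mul0r.
have hA : A \is 2.-homog by apply: (homog_dvd_quot l1n0 (hl i1)); rewrite -AE.
pose r1 : 'rV[K]_3 := \row_i l1@_(U_(i))%MM.
pose r2 : 'rV[K]_3 := \row_i l2@_(U_(i))%MM.
have lin1 : dot (cmx r1) (Xv K) = l1.
  by rewrite [RHS](lin_formP (hl i1)); apply: eq_bigr => i _; rewrite !mxE mul_mpolyC.
have lin2 : dot (cmx r2) (Xv K) = l2.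
  by rewrite [RHS](lin_formP (hl i2)); apply: eq_bigr => i _; rewrite !mxE mul_mpolyC.
pose p := cross r1 r2.
have [k pk] : exists k, p 0 k != 0.
  apply: boolp.contrapT => h; have p0 : cross r2 r1 = 0.
    rewrite crossC; apply/eqP; rewrite oppr_eq0; apply/eqP/rowP => k; rewrite [RHS]mxE.
    by apply/eqP/negPn/negP => pk; apply: h; exists k.
  have [j r1j] : exists j, r1 0 j != 0.
    apply: boolp.contrapT => hr; case/eqP: l1n0; rewrite -lin1 /dot big1 // => j _.
    rewrite mxE (_ : r1 0 j = 0) ?mpolyC0 ?mul0r //.
    by apply/eqP/negPn/negP => rj; apply: hr; exists j.
  apply: l1_l2; exists (r2 0 j / r1 0 j)%:MP; rewrite -lin1 -lin2.
  have E i : r2 0 i = r2 0 j / r1 0 j * r1 0 i.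
    by rewrite mulrAC (cross0_coord j i p0) mulfK.
  rewrite /dot mulr_sumr; apply: eq_bigr => i _.
  by rewrite [cmx r2 _ _]mxE [cmx r1 _ _]mxE (E i) mpolyCM mulrA.
pose p' i := p 0 i / p 0 k.
have modl d (f : R) : f \is d.-homog -> exists c1 c2,
    f = c1 * l1 + c2 * l2 + f.@[p'] *: 'X_k ^+ d.
  by move=> hf; have := homog_mod_lines pk hf; rewrite lin1 lin2.
have [b1 [b2 G0E]] := modl _ _ (G3 i0).
have [g0|g0] := eqVneq ((G 0 i0).@[p']) 0.
  exists (vec3 (- A) (- b2) b1); apply: row3P; rewrite !mxE /= ?l00.
  - by rewrite G0E g0 scale0r; ring.
  - by rewrite G1E; ring.
  - by rewrite AE; ring.
exfalso; have idJ := row_ideal_is_ideal G.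
have J1 : J (l1 * A) by rewrite mulrC -AE; apply: row_ideal_gen.
have J2 : J (l2 * A).
  have -> : l2 * A = -1 * G 0 i1 by rewrite G1E; ring.
  by apply: idealMl => //; apply: row_ideal_gen.
(* Modulo [l1] and [l2], whose products with [A] are in [J], the cubic [G 0 i0] is a nonzero
   multiple of x_k^3. Hence all multiples of [A] by forms of degree at least 3 are in [J], and [J]
   is (A, G_0) in large degrees. *)
have Jx : J ('X_k ^+ 3 * A).
  have -> : 'X_k ^+ 3 * A = ((G 0 i0).@[p'])^-1%:MP *
      (A * G 0 i0 + (- b1 * (l1 * A) + - b2 * (l2 * A))).
    have -> : A * G 0 i0 + (- b1 * (l1 * A) + - b2 * (l2 * A)) =
        (G 0 i0).@[p']%:MP * ('X_k ^+ 3 * A).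
      by rewrite {1}G0E -mul_mpolyC; ring.
    by rewrite [RHS]mulrA -mpolyCM mulVf // mpolyC1 mul1r.
  apply: (idealMl idJ); apply: (idealD idJ); first by apply: (idealMl idJ); apply: row_ideal_gen.
  by apply: (idealD idJ); apply: (idealMl idJ).
apply: (@two_generator_absurd K J A (G 0 i0) (N + 3)%N A0 hA (G3 i0)) => [d Nd|e f Ne hf].
  by apply: hN; apply: leq_trans Nd; rewrite leq_addr.
split=> [Jf|[p1 [q [hp hq ->]]]].
  have [v hv fE] := row_ideal_homog G3 Jf hf.
  exists (v 0 i2 * l1 - v 0 i1 * l2), (v 0 i0); split=> //.
    by apply: rpredB; apply: dhomogM_eq (hv _) (hl _) _; rewrite addn1.
  by rewrite fE dotE G1E AE; ring.
apply: (idealD idJ); last by apply: (idealMl idJ); apply: row_ideal_gen.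
have [c1 [c2 ->]] := modl _ _ hp; rewrite !mulrDl.
apply: (idealD idJ).
  by apply: (idealD idJ); rewrite -mulrA; apply: (idealMl idJ).
have xE : ('X_k : R) ^+ e.+1 = 'X_k ^+ (e - 2) * 'X_k ^+ 3.
  rewrite -exprD; congr (_ ^+ _).
  by rewrite addnS -addSn addn2 -[e in LHS](@subnK 2) ?addn2 // (leq_trans _ Ne) // addn3.
rewrite xE -scalerAl -mul_mpolyC -[_ * 'X_k ^+ 3 * A]mulrA.
by apply: (idealMl idJ); apply: (idealMl idJ).
Qed.

End RankTwo.

Variable G : 'rV[R]_3.
Hypotheses (G3 : homog_row 3 G) (indG : lin_indep G).
Local Notation J := (row_ideal G).
Variable N : nat.
Hypothesis hN : forall d, (N <= d)%N -> hilbert_fun J d 7.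
Variable l : 'rV[R]_3.
Hypotheses (hl : homog_row 1 l) (l0 : l != 0) (lG : dot l G = 0).

(** If the entries of [l] span all linear forms, a change of basis reduces to [koszul_X]. Otherwise
    a constant relation among them is moved to the first coordinate, which becomes 0 as
    [rank2_cross] requires. *)
Lemma lin_syz_cross : exists C, G = cross l C.
Proof.
pose A := lin_coefs l; have lE := lin_coefsE hl.
have [uA|] := boolP (A \in unitmx).
  have [|e eE] := @koszul_X K (G *m (cmx A)^T).
    by rewrite dot_mulmx trmxK -lE.
  exists ((\det A)^-1%:MP *: (e *m cmx A)).
  by rewrite {1}lE; apply: cross_transport.
rewrite unitmxE unitfE negbK -det_tr => /det0P[v v0 vA].
have Av : A *m v^T = 0 by rewrite -[A]trmxK -trmx_mul vA trmx0.
(* An invertible matrix whose first column spans the same line as [v^T]. *)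
pose P := col_ebase v^T; have uP : P \in unitmx by apply: col_ebase_unit.
have AP0 i : (A *m P) i i0 = 0.
  have rv : \rank v^T = 1%N.
    by apply/eqP; rewrite eqn_leq rank_leq_col lt0n mxrank_eq0 trmx_eq0.
  have e := mulmx_ebase v^T; rewrite rv in e.
  have APp : A *m P *m (pid_mx 1 : 'M_(3, 1)) = 0.
    have ue := row_ebase_unit v^T.
    by rewrite -[LHS](mulmxK ue) -(mulmxA A) -(mulmxA A) e Av mul0mx.
  move/colP/(_ i): APp; rewrite [RHS]mxE mxE (bigD1 i0) //= big1 => [|j /negbTE ji].
    by rewrite [pid_mx 1 _ _]mxE mulr1 addr0.
  by rewrite [pid_mx 1 _ _]mxE -val_eqE /= in ji *; case: eqP ji => //; rewrite mulr0.
pose Q := invmx P; have uQ : Q \in unitmx by rewrite unitmx_inv.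
pose l' := l *m cmx P; pose G' := G *m (cmx Q)^T.
have l'Q : l' *m cmx Q = l by rewrite -mulmxA -cmxM mulmxV // cmx1 mulmx1.
have uQT : Q^T \in unitmx by rewrite unitmx_tr.
have G'E : G' = G *m cmx Q^T by rewrite /G' cmxT.
have [|||||||C CE] := @rank2_cross G' _ _ N _ l'.
- by rewrite G'E; apply: homog_row_mulmx.
- by rewrite G'E; apply: lin_indep_mulmx.
- by rewrite G'E row_ideal_mulmx.
- exact: homog_row_mulmx.
- by apply: contraNneq l0 => e; rewrite -l'Q e mul0mx.
- by rewrite dot_mulmx trmxK l'Q.
- rewrite /l' lE -mulmxA -cmxM mxE big1 // => j _.
  by rewrite [cmx _ _ _]mxE AP0 mpolyC0 mulr0.
by exists ((\det Q)^-1%:MP *: (C *m cmx Q)); rewrite -{1}l'Q; apply: cross_transport.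
Qed.

Lemma lin_syz_hilbert_burch : hilbert_burch G.
Proof.
have [C CE] := lin_syz_cross.
pose C' : 'rV[R]_3 := \row_i pihomog mdeg 2 (C 0 i).
have hC' : homog_row 2 C' by move=> i; rewrite mxE; apply: pihomogP.
have GE : G = cross l C'.
  have comp i j : pihomog mdeg 3 (l 0 i * C 0 j) = l 0 i * C' 0 j.
    by rewrite mulrC (pihomog_homogM _ _ (hl i)) mxE mulrC.
  have G3E i : G 0 i = pihomog mdeg 3 (cross l C 0 i) by rewrite -CE pihomog_dE.
  by apply: row3P; rewrite G3E !mxE /= raddfB /= !comp !mxE.
exists l, C'; split=> //.
exact: (hilbert_gen G3 indG hl hC' GE hN).
Qed.

End LinearSyzygy.

(** * Linear substitutions and the normal form *)

Section Derivatives.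
Variables (K : fieldType) (n : nat).
Local Notation R := {mpoly K[n]}.

Lemma mpoly_ring_ind (P : R -> Prop) :
  (forall c, P c%:MP) -> (forall i, P 'X_i) ->
  (forall p q, P p -> P q -> P (p + q)) ->
  (forall p q, P p -> P q -> P (p * q)) -> forall p, P p.
Proof.
move=> PC PX PD PM p; rewrite [p]mpolyE.
elim/big_rec: _ => [|m q _ Pq]; first by rewrite -mpolyC0.
apply: (PD) => //; rewrite -mul_mpolyC; apply: (PM) => //; rewrite mpolyXE_id.
elim/big_rec: _ => [|i r _ Pr]; first by rewrite -mpolyC1.
apply: (PM) => //; elim: (m i) => [|k IH]; first by rewrite expr0 -mpolyC1.
by rewrite exprS; apply: (PM).
Qed.

Lemma mderiv_homog d (p : R) i : p \is d.+1.-homog -> p^`M(i) \is d.-homog.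
Proof.
move=> hp; apply/dhomogP => m; rewrite mcoeff_msupp mcoeff_deriv => pm.
have : (m + U_(i))%MM \in msupp p.
  by rewrite mcoeff_msupp; apply: contraNneq pm => ->; rewrite mul0rn.
by move/(dhomog_mf hp); rewrite /= mdegD mdeg1 addn1 => -[].
Qed.

Lemma euler d (p : R) : p \is d.-homog -> \sum_i 'X_i * p^`M(i) = d%:R *: p.
Proof.
move=> hp.
have dp i : p^`M(i) = \sum_(m <- msupp p) p@_m *: 'X_[m]^`M(i).
  by rewrite {1}[p]mpolyE raddf_sum /=; apply: eq_bigr => m _; rewrite mderivZ.
under eq_bigr do rewrite dp mulr_sumr.
rewrite exchange_big /= [in RHS](mpolyE p) scaler_sumr big_seq [RHS]big_seq.
apply: eq_bigr => m mp; transitivity (\sum_i (m i)%:R *: (p@_m *: 'X_[m] : R)).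
  apply: eq_bigr => i _; rewrite mderivX -!scalerAr scalerA mulrC -scalerA.
  case: (posnP (m i)) => [->|mi]; first by rewrite !scale0r.
  congr (_ *: (_ *: _)); rewrite -mpolyXD; congr 'X_[_].
  by rewrite addmC submK // lep1mP -lt0n.
rewrite -scaler_suml; congr (_ *: _).
by rewrite -natr_sum -mdegE (dhomog_mf hp mp).
Qed.

Lemma submm (m : 'X_{1..n}) : (m - m = 0)%MM.
Proof. by apply/mnmP => i; rewrite mnmBE mnm0E subnn. Qed.

Lemma chain_rule (t : n.-tuple R) (p : R) j :
  (p \mPo t)^`M(j) = \sum_i (p^`M(i) \mPo t) * (tnth t i)^`M(j).
Proof.
elim/mpoly_ring_ind: p => [c|i|p q IHp IHq|p q IHp IHq].
- rewrite comp_mpolyC mderivC big1 // => i _.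
  by rewrite mderivC comp_mpoly0 mul0r.
- rewrite comp_mpolyXU -tnth_nth (bigD1 i) //= big1 => [|k ki].
    by rewrite mderivX mnm1E eqxx scale1r submm mpolyX0 rmorph1 mul1r addr0.
  by rewrite mderivX mnm1E eq_sym (negbTE ki) scale0r comp_mpoly0 mul0r.
- rewrite rmorphD mderivD IHp IHq -big_split /=; apply: eq_bigr => i _.
  by rewrite mderivD rmorphD mulrDl.
- rewrite rmorphM /= mderivM IHp IHq mulr_suml mulr_sumr -big_split /=.
  by apply: eq_bigr => i _; rewrite mderivM rmorphD !rmorphM /=; ring.
Qed.

End Derivatives.

Section Gradients.
Variable K : fieldType.
Local Notation R := {mpoly K[3]}.

Lemma grad_homog d (F : R) : F \is d.+1.-homog -> homog_row d (grad F).
Proof. by move=> hF i; rewrite mxE; apply: mderiv_homog. Qed.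

Lemma grad_euler d (F : R) : F \is d.-homog -> dot (Xv K) (grad F) = d%:R *: F.
Proof. by move=> /euler <-; apply: eq_bigr => i _; rewrite !mxE. Qed.

Lemma gradM (p q : R) : grad (p * q) = q *: grad p + p *: grad q.
Proof. by apply/rowP => i; rewrite !mxE mderivM mulrC. Qed.

Lemma gradZ (c : K) (p : R) : grad (c *: p) = c%:MP *: grad p.
Proof. by apply/rowP => i; rewrite !mxE mderivZ mul_mpolyC. Qed.

Lemma alg_independent_lin_indep (F : R) :
  alg_independent [tuple F^`M(i) | i < 3] -> lin_indep (grad F).
Proof.
move=> ind c cF i.
have : \sum_j c j *: ('X_j : R) = 0.
  apply: ind; rewrite raddf_sum -[RHS]cF /=; apply: eq_bigr => j _.
  by rewrite comp_mpolyZ comp_mpolyXU -tnth_nth tnth_mktuple mxE.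
move/(congr1 (mcoeff U_(i)%MM)); rewrite mcoeff0 raddf_sum /= (bigD1 i) //=.
rewrite mcoeffZ mcoeffX eqxx mulr1 big1 ?addr0 // => j ji.
by rewrite mcoeffZ mcoeffX eq_mnm1 (negbTE ji) mulr0.
Qed.

End Gradients.

Section LinearSubstitution.
Variable K : fieldType.
Local Notation R := {mpoly K[3]}.

Implicit Types (M N : 'M[K]_3) (u v : 'rV[R]_3).

Definition subst_tuple (M : 'M[K]_3) : 3.-tuple R :=
  [tuple \sum_(j < 3) M i j *: 'X_j | i < 3].

Definition msubst (M : 'M[K]_3) (u : 'rV[R]_3) : 'rV[R]_3 := map_mx (lin_subst M) u.

Lemma lin_substE (M : 'M[K]_3) p : lin_subst M p = p \mPo subst_tuple M.
Proof. by []. Qed.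

Lemma lin_substX M i : lin_subst M 'X_i = \sum_j M i j *: 'X_j.
Proof. by rewrite /lin_subst comp_mpolyXU -tnth_nth tnth_mktuple. Qed.

Lemma lin_substM M (p q : R) : lin_subst M (p * q) = lin_subst M p * lin_subst M q.
Proof. exact: rmorphM. Qed.

Lemma lin_substD M (p q : R) : lin_subst M (p + q) = lin_subst M p + lin_subst M q.
Proof. exact: rmorphD. Qed.

Lemma lin_substB M (p q : R) : lin_subst M (p - q) = lin_subst M p - lin_subst M q.
Proof. exact: rmorphB. Qed.

Lemma lin_subst0 M : lin_subst M 0 = 0.
Proof. exact: rmorph0. Qed.

Lemma lin_subst_sum M (I : Type) (r : seq I) (P : pred I) (F : I -> R) :
  lin_subst M (\sum_(i <- r | P i) F i) = \sum_(i <- r | P i) lin_subst M (F i).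
Proof. exact: rmorph_sum. Qed.

Lemma lin_substZ M c (p : R) : lin_subst M (c *: p) = c *: lin_subst M p.
Proof. exact: comp_mpolyZ. Qed.

Lemma lin_subst_homog M d (p : R) : p \is d.-homog -> lin_subst M p \is d.-homog.
Proof.
move=> hp; rewrite lin_substE comp_mpolyEX big_seq; apply: rpred_sum => m mp.
apply: rpredZ; rewrite comp_mpolyX -(dhomog_mf hp mp) /= mdegE.
elim/big_rec2: _ => [|i k q _ hq]; first exact: dhomog1.
apply: dhomogM => //; rewrite -[X in X.-homog]mul1n; apply: dhomogMn.
by rewrite tnth_mktuple; apply: rpred_sum => j _; rewrite rpredZ ?homogX.
Qed.

Lemma lin_subst_comp M N (p : R) : lin_subst N (lin_subst M p) = lin_subst (M *m N) p.
Proof.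
apply: (@mpoly_rmorph_ext_comp 3 K _ _ (comp_mpoly (subst_tuple M))
  (comp_mpoly (subst_tuple N)) (comp_mpoly (subst_tuple (M *m N)))) => [c|i] /=.
  by rewrite !comp_mpolyC.
rewrite -!lin_substE !lin_substX lin_subst_sum.
under eq_bigr do rewrite lin_substZ lin_substX scaler_sumr.
rewrite exchange_big; apply: eq_bigr => k _; rewrite mxE scaler_suml.
by apply: eq_bigr => j _; rewrite scalerA.
Qed.

Lemma lin_subst1 (p : R) : lin_subst 1%:M p = p.
Proof.
rewrite -[RHS]comp_mpoly_id lin_substE; congr (_ \mPo _).
apply: eq_from_tnth => i; rewrite !tnth_mktuple (bigD1 i) //= mxE eqxx scale1r.
by rewrite big1 ?addr0 // => j ji; rewrite mxE eq_sym (negbTE ji) scale0r.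
Qed.

Lemma msubst_dot M u v : lin_subst M (dot u v) = dot (msubst M u) (msubst M v).
Proof.
rewrite /dot lin_subst_sum; apply: eq_bigr => i _.
by rewrite lin_substM !mxE.
Qed.

Lemma msubst_cross M u v : msubst M (cross u v) = cross (msubst M u) (msubst M v).
Proof. by apply: row3P; rewrite !mxE /= lin_substB !lin_substM. Qed.

Lemma msubst_comb M a b u v :
  msubst M (a *: u + b *: v) = lin_subst M a *: msubst M u + lin_subst M b *: msubst M v.
Proof. by apply/rowP => i; rewrite !mxE lin_substD !lin_substM. Qed.

Lemma grad_lin_subst M (F : R) : grad (lin_subst M F) = msubst M (grad F) *m cmx M.
Proof.
apply/rowP => j; rewrite mxE lin_substE chain_rule mxE; apply: eq_bigr => i _.
rewrite !mxE; congr (_ * _); rewrite tnth_mktuple raddf_sum (bigD1 j) //= big1 => [|k kj].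
  by rewrite mderivZ mderivX mnm1E eqxx scale1r submm mpolyX0 addr0 -mul_mpolyC mulr1.
by rewrite mderivZ mderivX mnm1E (negbTE kj) scale0r scaler0.
Qed.

Lemma hilbert_burch_msubst (G : 'rV[R]_3) M : M \in unitmx ->
  hilbert_burch (msubst M G) -> hilbert_burch G.
Proof.
move=> uM [s [t [hs ht GE gen]]]; pose N := invmx M.
have K1 p : lin_subst N (lin_subst M p) = p.
  by rewrite lin_subst_comp mulmxV // lin_subst1.
have mK u : msubst N (msubst M u) = u by apply/rowP => i; rewrite !mxE K1.
exists (msubst N s), (msubst N t); split.
- by move=> i; rewrite mxE; apply: lin_subst_homog.
- by move=> i; rewrite mxE; apply: lin_subst_homog.
- by rewrite -msubst_cross -GE mK.
- move=> u uG; have [|a [b abE]] := gen (msubst M u).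
    by rewrite -msubst_dot uG lin_subst0.
  by exists (lin_subst N a), (lin_subst N b); rewrite -msubst_comb -abE mK.
Qed.

Lemma hilbert_burch_scale (G : 'rV[R]_3) (c : K) : c != 0 ->
  hilbert_burch G -> hilbert_burch (c%:MP *: G).
Proof.
move=> c0 [s [t [hs ht -> gen]]].
have cc : c%:MP * c^-1%:MP = 1 :> R by rewrite -mpolyCM mulfV // mpolyC1.
exists s, (c%:MP *: t); split=> //.
- by move=> i; rewrite mxE mul_mpolyC rpredZ.
- by rewrite crossZr.
- move=> u; rewrite dotC dotZl => /eqP; rewrite mulf_eq0 mpolyC_eq0 (negbTE c0) /= => /eqP uG.
  have [|a [b ->]] := gen u; first by rewrite dotC.
  by exists a, (b * c^-1%:MP); rewrite scalerA -mulrA [_ * c%:MP]mulrC cc mulr1.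
Qed.

End LinearSubstitution.

(** * The gradient of the normal form *)

Section NormalForm.
Variable K : fieldType.
Local Notation R := {mpoly K[3]}.
Local Notation x := ('X_i0 : R).
Local Notation y := ('X_i1 : R).
Local Notation z := ('X_i2 : R).

(** Both [u] and [s] are orthogonal to [G], so u x s = k G = k (s x t); then u + k t is parallel to
    [s], hence a multiple of it. *)
Lemma par_gens (G s t : 'rV[R]_3) : par_prop G -> par_prop s -> G = cross s t ->
  forall u, dot u G = 0 -> exists a b, u = a *: s + b *: t.
Proof.
move=> pG ps GE u uG; have sG : dot s G = 0 by rewrite GE dot_crossl.
have [|k kE] := pG (cross u s).
  by rewrite crossC (orth_cross0 uG sG) oppr0.
have [|m mE] := ps (u + k *: t).
  by rewrite crossDl kE crossZl (crossC t) -GE scalerN subrr.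
by exists m, (- k); rewrite scaleNr -mE addrK.
Qed.

Lemma normal_formE v :
  normal_form v = (x ^+ 2 + y * z) * (x ^+ 2 + v%:MP * y ^+ 2 + y * z).
Proof.
rewrite /normal_form -mul_mpolyC.
have -> : (0 : 'I_3) = i0 by exact/val_inj.
have -> : (2%:R : 'I_3) = i2 by exact/val_inj.
by have -> : (1 : 'I_3) = i1 by exact/val_inj.
Qed.

Let a := x ^+ 2 + y * z.
(** The sum of the two conics [a] and a + v y^2; it is the coefficient of the gradient of [a] in
    that of their product. *)
Let D v := 2%:R%:MP * a + v%:MP * y ^+ 2.

Lemma grad_normal_form v : grad (normal_form v) =
  vec3 (2%:R%:MP * x * D v) (z * D v + 2%:R%:MP * v%:MP * y * a) (y * D v).
Proof.
have dX i j : ('X_j : R)^`M(i) = (i == j)%:R.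
  rewrite mderivX mnm1E eq_sym; case: eqP => [->|_]; last by rewrite scale0r.
  by rewrite scale1r submm mpolyX0.
rewrite normal_formE /D /a mpolyC_nat.
apply: row3P; rewrite !mxE /= !(mderivM, mderivD, mderivC, dX, expr2) /=; ring.
Qed.

(** The vector field (y, 0, -2x) annihilates y and x^2 + yz, hence both conics; the second factor
    solves for the gradient. *)
Lemma grad_normal_form_cross v : grad (normal_form v) =
  cross (vec3 y 0 (- (2%:R%:MP * x)))
    (vec3 (- (x * z)) (D v)
       (- (2%:R%:MP * z ^+ 2 + v%:MP * y * z + 2%:R%:MP * v%:MP * a))).
Proof.
rewrite grad_normal_form /D /a; apply: row3P; rewrite !mxE /=; ring.
Qed.

Hypothesis char0 : [pchar K] =i pred0.
Variable v : K.
Hypothesis v0 : v != 0.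

Let two0 : 2%:R != 0 :> K.
Proof. by move/pcharf0P: char0 => ->. Qed.

(** [x * Dv] and [f] form a regular sequence: [f] is nonzero at (0 : 1 : 0), where x vanishes, and
    modulo [Dv] it is -v^2 y^3, while the prime y does not divide [Dv]. *)
Lemma normal_form_par : par_prop (grad (normal_form v)).
Proof.
pose Dv := D v; pose f := z * Dv - v%:MP ^+ 2 * y ^+ 3.
have E0 : dot (vec3 (2%:R^-1%:MP) 0 0) (grad (normal_form v)) = x * Dv.
  rewrite grad_normal_form dotE !mxE /= !mul0r !addr0 !mulrA -mpolyCM mulVf //.
  by rewrite mpolyC1 mul1r.
have E1 : dot (vec3 0 1 (- v%:MP)) (grad (normal_form v)) = f.
  by rewrite grad_normal_form dotE !mxE /= /f /Dv /D; ring.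
have DE w : Dv.@[w] = 2%:R * (w i0 * w i0 + w i1 * w i2) + v * (w i1 * w i1).
  by rewrite /Dv /D /a !expr2 !(mevalD, mevalM, mevalC) !mevalXU.
have xp := prime_mpolyX K i0; have yp := prime_mpolyX K i1.
have x0 := mpolyX_neq0 K i0; have y0 := mpolyX_neq0 K i1.
have D0 : Dv != 0.
  apply/eqP => /(congr1 (meval (fun i => (i == i0)%:R))).
  by rewrite DE meval0 /= !(mulr1, mulr0, addr0) => /eqP; rewrite (negbTE two0).
have xf : ~ dvdr x f.
  case=> q /(congr1 (meval (fun i => (i == i1)%:R))).
  rewrite /f !exprS !expr0 !(mevalB, mevalM, mevalC, meval1) !mevalXU DE /=.
  by rewrite !(mulr1, mulr0, mul0r) sub0r => /eqP; rewrite oppr_eq0 mulf_eq0 orbb (negbTE v0).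
have yD : ~ dvdr y Dv.
  case=> q /(congr1 (meval (fun i => (i == i0)%:R))).
  by rewrite DE mevalM mevalXU /= !(mulr1, mulr0, addr0) => /eqP; rewrite (negbTE two0).
have Dy u : dvdr Dv (u * y) -> dvdr Dv u.
  case=> w wE; have [_ _ hy] := yp.
  have : dvdr y (w * Dv) by exists u; rewrite -wE.
  case/hy => // -[w' w'E]; exists w'; apply: (mulIf y0).
  by rewrite wE w'E; ring.
apply: (@par_regular _ _ (vec3 (2%:R^-1%:MP) 0 0) (vec3 0 1 (- v%:MP))); rewrite ?E0 ?E1.
  by rewrite mulf_neq0.
move=> u [w wE]; have [_ _ hx] := xp.
have [u' uE] : dvdr x u.
  have : dvdr x (u * f) by exists (w * Dv); rewrite wE; ring.
  by case/hx.
have [q qE] : dvdr Dv u'.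
  (* Modulo [Dv] the form [f] is a unit times y^3, and each power of y cancels. *)
  do 3!apply: (Dy).
  exists ((v%:MP ^+ 2)^-1 * (u' * z - w)).
  have vu : v%:MP ^+ 2 \is a @GRing.unit R.
    by rewrite unitrX //; apply: rmorph_unit; rewrite unitfE.
  apply: (mulrI vu); rewrite [RHS]mulrA (mulVKr vu); apply: (mulfI x0).
  have wE' : u' * x * f = w * (x * Dv) by rewrite -uE.
  apply/eqP; rewrite -subr_eq0; apply/eqP.
  have e : u' * x * f - w * (x * Dv) = 0 by rewrite wE' subrr.
  by rewrite -[RHS]oppr0 -e /f; ring.
by exists q; rewrite uE qE; ring.
Qed.

Lemma normal_form_hilbert_burch : hilbert_burch (grad (normal_form v)).
Proof.
have hX (i : 'I_3) : ('X_i : R) \is 1.-homog by apply: homogX.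
have hZ (c : K) d (p : R) : p \is d.-homog -> c%:MP * p \is d.-homog.
  by move=> hp; rewrite mul_mpolyC rpredZ.
have hXX (i j : 'I_3) : ('X_i * 'X_j : R) \is 2.-homog by apply: dhomogM_eq (hX i) (hX j) _.
have ha : a \is 2.-homog by rewrite /a expr2 rpredD.
have GE := grad_normal_form_cross v.
eexists _, _; split; [| |exact: GE|].
- by apply: ord3P; rewrite mxE /= ?rpredN ?rpred0 ?hZ.
- apply: ord3P; rewrite mxE /= ?rpredN ?hXX //.
    by rewrite /D rpredD // hZ // expr2.
  by rewrite -!mulrA !rpredD // !hZ // expr2.
- apply: par_gens normal_form_par _ GE.
  apply: (@par_prime _ _ i0 i2); rewrite !mxE /=; first exact: prime_mpolyX.
  case=> q /(congr1 (meval (fun i => (i == i0)%:R))).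
  rewrite !(mevalN, mevalM, mevalC) !mevalXU /= mulr0 mulr1 => /eqP.
  by rewrite oppr_eq0 (negbTE two0).
Qed.

End NormalForm.

(** * Pairs of conics *)

Section SymmetricMatrices.
Variable K : fieldType.
Hypothesis two0 : 2%:R != 0 :> K.
Implicit Types (A H N W : 'M[K]_3) (p : 'rV[K]_3).

(** After multiplication by the inverse of [H] the left side is a sum of two matrices with the trace
    of [A]. *)
Lemma sim_trace A H (c : K) : H \in unitmx ->
  A *m H + H *m A^T = c *: H -> \tr A *+ 2 = c * 3%:R.
Proof.
move=> uH /(congr1 (fun B => \tr (B *m invmx H))).
rewrite mulmxDl -scalemxAl mulmxK // mulmxV // mxtraceD mxtrace_mulC mulKmx //.
by rewrite mxtrace_tr mxtraceZ mxtrace1 mulr2n.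
Qed.

(** [A *m H] is skew of odd order, so its determinant is its own opposite. *)
Lemma skew_singular A H : H \in unitmx -> A *m H + H^T *m A^T = 0 ->
  exists2 p : 'rV_3, p != 0 & p *m A = 0.
Proof.
move=> uH skew; apply/det0P.
have : \det (A *m H) *+ 2 == 0.
  rewrite mulr2n -{2}det_tr trmx_mul; have -> : H^T *m A^T = - (A *m H).
    by apply/eqP; rewrite -addr_eq0 addrC skew.
  by rewrite -scaleN1r detZ -signr_odd /= expr1 mulN1r subrr.
rewrite -mulr_natr mulf_eq0 (negbTE two0) orbF det_mulmx mulf_eq0.
by move: uH; rewrite unitmxE unitfE => /negbTE ->; rewrite orbF.
Qed.

(** The Gram matrix of x^2 + yz. *)
Definition hyperbolic : 'M[K]_3 :=
  \matrix_(i, j) nth 0 (nth [::] [:: [:: 1; 0; 0]; [:: 0; 0; 2%:R^-1];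
                                     [:: 0; 2%:R^-1; 0]] i) j.

Lemma gram_entry (H : 'M[K]_3) (N : 'M[K]_3) i j :
  (N *m H *m N^T) i j = dot (row i N *m H) (row j N).
Proof. by rewrite -row_mul mxE; apply: eq_bigr => k _; rewrite !mxE. Qed.

(* The rows of [N] are [e, r, p], where [p, r] is a hyperbolic pair and [e] spans
   its orthogonal complement. *)
Lemma hyperbolic_basis H p : H \in unitmx -> H^T = H -> p != 0 ->
  dot (p *m H) p = 0 -> exists N h,
    [/\ N \in unitmx, h != 0, row i2 N = p & N *m H *m N^T = h *: hyperbolic].
Proof.
move=> uH sH p0 pp.
have [i pHi] : exists i, (p *m H) 0 i != 0.
  apply/rV0Pn; apply: contra_neq p0 => pH.
  by rewrite -(mulmxK uH p) pH mul0mx.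
have Hsym u v : dot (u *m H) v = dot (v *m H) u.
  by rewrite dotC dot_mulmx sH.
pose r0 := ((p *m H) 0 i)^-1 *: delta_mx 0 i : 'rV[K]_3.
have pr0 : dot (p *m H) r0 = 1.
  rewrite dotC dotZl /dot (bigD1 i) //= big1 => [|k ki].
    by rewrite [delta_mx _ _ _ _]mxE !eqxx mul1r addr0 mulVf.
  by rewrite [delta_mx _ _ _ _]mxE (negbTE ki) andbF mul0r.
(* [r0] pairs to 1 with the isotropic [p]; subtracting this multiple of [p] keeps the pairing and
   makes [r] isotropic. *)
pose a := dot (r0 *m H) r0 / 2%:R; pose r := r0 - a *: p.
have Dr w u v : dot w (u + v) = dot w u + dot w v by rewrite !(dotC w) dotDl.
have Nr w u : dot w (- u) = - dot w u by rewrite !(dotC w) dotNl.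
have Zr w b u : dot w (b *: u) = b * dot w u by rewrite !(dotC w) dotZl.
have pr : dot (p *m H) r = 1 by rewrite Dr Nr Zr pp pr0 mulr0 subr0.
have rr : dot (r *m H) r = 0.
  rewrite {2}/r Dr Nr Zr (Hsym r r0) (Hsym r p) pr mulr1 /r Dr Nr Zr.
  by rewrite (Hsym r0 p) pr0 /a; field.
pose e := cross (p *m H) (r *m H).
have ep : dot (p *m H) e = 0 by exact: dot_crossl.
have er : dot (r *m H) e = 0 by exact: dot_crossr.
pose h := dot (e *m H) e.
(* The cofactor identity turns [e *m H] into det H times p x r, and Lagrange's identity evaluates
   the pairing of p x r with [e] as -1. *)
have hE : h = - \det H.
  have -> : h = \det H * dot (cross p r) e.
    by rewrite /h (_ : e *m H = \det H *: cross p r) ?dotZl // -cross_mulmx sH.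
  have -> : dot (cross p r) e =
      dot (p *m H) p * dot (r *m H) r - dot (p *m H) r * dot (r *m H) p.
    rewrite /e; move: (p *m H) (r *m H) => u w.
    by rewrite !dotE !mxE /=; ring.
  by rewrite pp (Hsym r p) pr; ring.
have h0 : h != 0 by rewrite hE oppr_eq0 -unitfE -unitmxE.
(* The factor h / 2 on [r] adjusts its pairing with [p] to the norm [h] of [e]. *)
pose N : 'M[K]_3 := \matrix_k nth 0 [:: e; (h / 2%:R) *: r; p] k.
have N0 : row i0 N = e by rewrite rowK.
have N1 : row i1 N = (h / 2%:R) *: r by rewrite rowK.
have N2 : row i2 N = p by rewrite rowK.
have gram : N *m H *m N^T = h *: hyperbolic.
  apply/matrixP => k l; rewrite gram_entry [RHS]mxE [hyperbolic _ _]mxE.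
  elim/ord3P: k; elim/ord3P: l; rewrite ?N0 ?N1 ?N2 /= -?scalemxAl ?dotZl ?Zr.
  - by rewrite mulr1.
  - by rewrite Hsym er !mulr0.
  - by rewrite Hsym ep mulr0.
  - by rewrite er !mulr0.
  - by rewrite rr !mulr0.
  - by rewrite Hsym pr mulr1.
  - by rewrite ep mulr0.
  - by rewrite pr mulr1.
  - by rewrite pp mulr0.
exists N, h; split=> //.
have : \det (N *m H *m N^T) != 0.
  have q0 : 2%:R^-1 != 0 :> K by rewrite invr_eq0.
  have dW : \det hyperbolic = - (2%:R^-1 * 2%:R^-1).
    by rewrite det_mx33 !mxE /=; ring.
  by rewrite gram detZ dW mulf_neq0 ?expf_neq0 // oppr_eq0 mulf_neq0.
by rewrite !det_mulmx !mulf_eq0 !negb_or unitmxE unitfE => /andP[/andP[]].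
Qed.

(* [A] lies in the Lie algebra of the conic [x^2 + yz] and kills one of its
   points, hence is a multiple of a fixed nilpotent matrix. *)
Lemma common_skew_form A H : A != 0 -> row i2 A = 0 -> H^T = H -> H \in unitmx ->
  A *m hyperbolic + hyperbolic *m A^T = 0 -> A *m H + H *m A^T = 0 ->
  exists2 h, h != 0 & exists k, H = h *: hyperbolic + k *: delta_mx i1 i1.
Proof.
move=> A0 A2 sH uH skW skH.
have a2 j : A i2 j = 0 by move/rowP: A2 => /(_ j); rewrite !mxE.
have hs i j : H i j = H j i by rewrite -{1}sH mxE.
have W i j : (A *m hyperbolic) i j + (A *m hyperbolic) j i = 0.
  move/matrixP: skW => /(_ i j); rewrite mxE -[hyperbolic *m A^T]trmxK.
  rewrite trmx_mul trmxK (_ : hyperbolic^T = hyperbolic) ?mxE //.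
  by apply/matrixP; apply: ord3P; apply: ord3P; rewrite !mxE.
have S i j : (A *m H) i j + (A *m H) j i = 0.
  move/matrixP: skH => /(_ i j); rewrite mxE -[H *m A^T]trmxK.
  by rewrite trmx_mul trmxK sH !mxE.
have W00 := W i0 i0; have W01 := W i0 i1; have W02 := W i0 i2.
have W11 := W i1 i1; have W12 := W i1 i2.
have S00 := S i0 i0; have S01 := S i0 i1; have S02 := S i0 i2.
have S11 := S i1 i1; have S12 := S i1 i2.
move: W00 W01 W02 W11 W12 S00 S01 S02 S11 S12.
rewrite ![(A *m hyperbolic) _ _]mxE ![(A *m H) _ _]mxE !sum3 ![hyperbolic _ _]mxE /= !a2.
rewrite !(mul0r, mulr0, mulr1, addr0, add0r).
rewrite (hs i1 i0) (hs i2 i0) (hs i2 i1).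
have dbl (b : K) : b + b = 0 -> b = 0.
  by move/eqP; rewrite -mulr2n -mulr_natr mulf_eq0 (negbTE two0) orbF => /eqP.
have hlf (b : K) : b * 2%:R^-1 = 0 -> b = 0.
  by move/eqP; rewrite mulf_eq0 invr_eq0 (negbTE two0) orbF => /eqP.
move=> /dbl a00 W01 /hlf a01 /dbl/hlf a12 /hlf a11.
have a10 : A i1 i0 = - (A i0 i2 / 2%:R) by apply/eqP; rewrite -addr_eq0 addrC W01.
have c0 : A i0 i2 != 0.
  apply: contra_neq A0 => c0; apply/matrixP => i j; rewrite [RHS]mxE.
  elim/ord3P: i; elim/ord3P: j; rewrite ?a2 ?a00 ?a01 ?a10 ?a11 ?a12 ?c0 //.
  by rewrite mul0r oppr0.
rewrite a00 a01 a12 a11 a10 !mul0r !add0r !addr0.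
have cr (b : K) : A i0 i2 * b = 0 -> b = 0.
  by move/eqP; rewrite mulf_eq0 (negbTE c0) => /eqP.
have cn (b : K) : - (A i0 i2 / 2%:R) * b = 0 -> b = 0.
  move/eqP; rewrite mulf_eq0 oppr_eq0 mulf_eq0 invr_eq0 (negbTE two0) (negbTE c0).
  by move/eqP.
(* The equations for [hyperbolic] left only the parameter [A i0 i2]; those for [H] now leave only
   [H i0 i0] and [H i1 i1] free. *)
move=> /dbl/cr h02 S01 /cr h22 /dbl/cn h01 _.
have h12 : H i1 i2 = H i0 i0 / 2%:R.
  apply: (mulfI c0); apply/eqP; rewrite -subr_eq0 -[X in _ == X]S01; apply/eqP; ring.
have HE : H = H i0 i0 *: hyperbolic + H i1 i1 *: delta_mx i1 i1.
  apply/matrixP => i j; rewrite [RHS]mxE [X in X + _]mxE [X in _ + X]mxE.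
  rewrite [delta_mx _ _ _ _]mxE [hyperbolic _ _]mxE.
  elim/ord3P: i; elim/ord3P: j; rewrite /= ?(mulr0, mulr1, addr0, add0r) //.
  - by rewrite hs.
  - by rewrite hs.
  - by rewrite hs.
exists (H i0 i0); last by exists (H i1 i1).
apply: contraTneq uH => h00; rewrite unitmxE unitfE negbK det_mx33.
by rewrite h00 h01 h02 !mul0r subr0 addr0.
Qed.

End SymmetricMatrices.

Section Quadrics.
Variable K : fieldType.
Local Notation R := {mpoly K[3]}.
Local Notation X := (Xv K).
Implicit Types (A B H M N : 'M[K]_3) (p : 'rV[K]_3).

Definition eval_row p (u : 'rV[R]_3) : 'rV[K]_3 := map_mx (meval (p 0)) u.

Lemma eval_row_lin p B : eval_row p (X *m cmx B) = p *m B.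
Proof.
rewrite /eval_row map_mxM; congr (_ *m _); last first.
  by apply/matrixP => i j; rewrite !mxE /= mevalC.
by apply/rowP => i; rewrite !mxE /= mevalXU.
Qed.

Lemma eval_dot p u v : (dot u v).@[p 0] = dot (eval_row p u) (eval_row p v).
Proof. by rewrite /dot raddf_sum; apply: eq_bigr => i _; rewrite /= mevalM !mxE. Qed.

Lemma lin_row_inj B B' : X *m cmx B = X *m cmx B' -> B = B'.
Proof.
move=> E; apply/row_matrixP => i; rewrite !rowE -!eval_row_lin; congr (eval_row _ _).
exact: E.
Qed.

Definition qform B : R := dot X (X *m cmx B).

Lemma qformZ c B : qform (c *: B) = c *: qform B.
Proof.
by rewrite /qform /cmx map_mxZ -scalemxAr dotC dotZl dotC mul_mpolyC.
Qed.

Lemma qformD (B B' : 'M[K]_3) : qform (B + B') = qform B + qform B'.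
Proof.
by rewrite /qform /cmx map_mxD mulmxDr dotC dotDl !(dotC _ X).
Qed.

Lemma grad_qform B : grad (qform B) = X *m cmx (B + B^T).
Proof.
have dX i j : ('X_j : R)^`M(i) = (i == j)%:R.
  rewrite mderivX mnm1E eq_sym; case: eqP => [->|_]; last by rewrite scale0r.
  by rewrite scale1r submm mpolyX0.
apply/rowP => j; rewrite !mxE /qform /dot raddf_sum /=.
have dE i : ('X_i * (X *m cmx B) 0 i : R)^`M(j) =
    (j == i)%:R * (X *m cmx B) 0 i + 'X_i * (B j i)%:MP.
  rewrite mderivM dX; congr (_ + _ * _); rewrite mxE raddf_sum /= (bigD1 j) //=.
  rewrite big1 => [|k kj]; rewrite !mxE mderivM mderivC dX mulr0 addr0.
    by rewrite eqxx mul1r addr0.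
  by rewrite eq_sym (negbTE kj) mul0r.
transitivity (\sum_i ((j == i)%:R * (X *m cmx B) 0 i + 'X_i * (B j i)%:MP)).
  by apply: eq_bigr => i _; rewrite [X 0 i]mxE dE.
rewrite big_split /= (bigD1 j) //= eqxx mul1r big1 ?addr0 => [|k kj]; last first.
  by rewrite eq_sym (negbTE kj) mul0r.
by rewrite mxE -big_split; apply: eq_bigr => i _; rewrite !mxE mpolyCD mulrDr.
Qed.

Lemma qform_inj B B' : qform B = qform B' -> B + B^T = B' + B'^T.
Proof. by move=> E; apply: lin_row_inj; rewrite -!grad_qform E. Qed.

(** Twice the Gram matrix of a quadric [q], read off from its gradient. *)
Definition hessian (q : R) : 'M[K]_3 := lin_coefs (grad q).

Lemma hessian_sym q : (hessian q)^T = hessian q.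
Proof.
apply/matrixP => i j; rewrite !mxE !mcoeff_deriv addmC !mnm1E.
by rewrite eq_sym.
Qed.

Lemma grad_quadric q : q \is 2.-homog -> grad q = X *m cmx (hessian q).
Proof. by move=> hq; apply: lin_coefsE; apply: grad_homog. Qed.

Lemma qform_hessian q : q \is 2.-homog -> qform (hessian q) = 2%:R *: q.
Proof. by move=> hq; rewrite /qform -grad_quadric // (grad_euler hq). Qed.

Lemma lin_subst_qform M B : lin_subst M (qform B) = qform (M^T *m B *m M).
Proof.
have XM : msubst M X = X *m cmx M^T.
  apply/rowP => i; rewrite !mxE lin_substX; apply: eq_bigr => j _.
  by rewrite !mxE mulrC mul_mpolyC.
have lB : msubst M (X *m cmx B) = X *m cmx (M^T *m B).
  rewrite cmxM mulmxA -XM; apply/rowP => i; rewrite !mxE lin_subst_sum.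
  apply: eq_bigr => j _; rewrite lin_substM !mxE; congr (_ * _).
  by rewrite lin_substE comp_mpolyC.
by rewrite msubst_dot XM lB dotC dot_mulmx cmxT trmxK -(mulmxA X) -cmxM dotC.
Qed.

Section Nondegenerate.
Hypothesis two0 : 2%:R != 0 :> K.
Variable q : R.
Hypothesis hq : nondegenerate_quadric q.

Lemma nondegenerate_grad p : p != 0 -> q.@[p 0] = 0 -> eval_row p (grad q) != 0.
Proof.
move=> /rV0Pn[i pi] qp; case: hq => _ /(_ K idfun (p 0)) nd.
have idq : map_mpoly (idfun : {rmorphism K -> K}) q = q.
  by apply/mpolyP => m; rewrite mcoeff_map_mpoly.
have [||j] := nd; rewrite ?idq //; first by exists i.
by apply: contra_neq => /rowP/(_ j); rewrite !mxE.
Qed.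

(** A kernel vector is a zero of the gradient, and by Euler's identity of [q]: a singular point
    already over K. *)
Lemma hessian_unit : hessian q \in unitmx.
Proof.
have [q2 _] := hq.
rewrite unitmxE unitfE; apply/det0P => -[p p0 pH].
have : eval_row p (grad q) != 0.
  apply: nondegenerate_grad => //; apply: (mulfI two0).
  rewrite mulr0 -mevalZ -qform_hessian // /qform eval_dot eval_row_lin pH dotC.
  exact: dot0l.
by rewrite grad_quadric // eval_row_lin pH eqxx.
Qed.

Lemma nondegenerate_neq0 : q != 0.
Proof.
apply: contraTneq hessian_unit => q0; rewrite unitmxE unitfE negbK.
apply/det0P; exists (delta_mx 0 i0).
  by apply/rV0Pn; exists i0; rewrite mxE !eqxx oner_neq0.
by apply/rowP => j; rewrite -rowE !mxE q0 mderiv0 mcoeff0.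
Qed.

(** A proper factorization is into two linear forms, and their common zero, a kernel vector of the
    matrix [N] with zero last column, is a singular point. *)
Lemma nondegenerate_prime : prime_elt q.
Proof.
have [q2 _] := hq; have q0 := nondegenerate_neq0; have sq := msize_dhomog q0 q2.
apply: irreducible_prime; rewrite ?mpoly_unit_msize ?sq // => a b qE.
have [a0 b0] : a != 0 /\ b != 0 by move: q0; rewrite qE mulf_eq0 negb_or => /andP.
rewrite !mpoly_unit_msize; have := msizeM a0 b0; rewrite -qE sq.
move: a0 b0; rewrite -!msize_poly_eq0 => a0 b0 sab.
have [sa|sa] := eqVneq (msize a) 1%N; [by left|right].
have [//|sb] := eqVneq (msize b) 1%N; exfalso.
have [{}sa {}sb] : (msize a <= 2)%N /\ (msize b <= 2)%N.

  move: sab a0 b0 sa sb; case: (msize a) => [|[|[|m]]] //;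
  by case: (msize b) => [|[|[|k]]] //=; rewrite ?addSn ?addnS.
pose pa d := pihomog mdeg d a; pose pb d := pihomog mdeg d b.
have ha d : pa d \is d.-homog by apply: pihomogP.
have hb d : pb d \is d.-homog by apply: pihomogP.
have {}qE : q = pa 1%N * pb 1%N.
  have aE : a = pa 0%N + pa 1%N.
    by rewrite [LHS](pihomog_partitionE sa) !big_ord_recl big_ord0 addr0.
  have bE : b = pb 0%N + pb 1%N.
    by rewrite [LHS](pihomog_partitionE sb) !big_ord_recl big_ord0 addr0.
  have ab d e : pihomog mdeg 2 (pa d * pb e) = if (d + e == 2)%N then pa d * pb e else 0.
    case: eqP => [de|/eqP de]; first by rewrite pihomog_dE ?(dhomogM_eq (ha d) (hb e) de).
    by rewrite (pihomog_ne0 de) // dhomogM.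
  by rewrite -[LHS](pihomog_dE q2) qE aE bE !(mulrDl, mulrDr, raddfD) /= !ab /= !add0r.
pose N : 'M[K]_3 :=
  \matrix_(i, j) nth 0 [:: (pa 1%N)@_U_(i)%MM; (pb 1%N)@_U_(i)%MM; 0] j.
have /det0P[p p0 pN] : \det N == 0.
  by rewrite det_mx33 !mxE /=; apply/eqP; ring.
have ev f j : f \is 1.-homog -> (forall i, N i j = f@_U_(i)%MM) -> f.@[p 0] = 0.
  move=> /lin_formP fE Nj; rewrite fE raddf_sum /=; move/rowP: pN => /(_ j).
  rewrite !mxE => pN; rewrite -[RHS]pN; apply: eq_bigr => i _.
  by rewrite mevalZ mevalXU Nj mulrC.
have ea : (pa 1%N).@[p 0] = 0 by apply: (ev _ i0) => // i; rewrite mxE.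
have eb : (pb 1%N).@[p 0] = 0 by apply: (ev _ i1) => // i; rewrite mxE.
have := nondegenerate_grad p0; rewrite qE mevalM ea mul0r => /(_ erefl)/eqP; apply.
apply/rowP => i; rewrite gradM !mxE mevalD !mevalM ea eb; ring.
Qed.

End Nondegenerate.

End Quadrics.

(** * Simultaneous reduction of the two conics *)

Section QuadricPairs.
Variable K : fieldType.
Local Notation R := {mpoly K[3]}.
Local Notation Xs := (Xv K).

Hypothesis char0 : [pchar K] =i pred0.

Let two0 : 2%:R != 0 :> K.
Proof. by move/pcharf0P: char0 => ->. Qed.

Let three0 : 3%:R != 0 :> K.
Proof. by move/pcharf0P: char0 => ->. Qed.

Lemma qform_hyperbolic : qform (hyperbolic K) = 'X_i0 ^+ 2 + 'X_i1 * 'X_i2.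
Proof.
rewrite /qform dotE !mxE !sum3 !mxE /= mpolyC0 mpolyC1.
have half : 2%:R^-1%:MP + 2%:R^-1%:MP = 1 :> R.
  by rewrite -mpolyCD -mpolyC1; congr _%:MP; field.
rewrite -[in RHS](mul1r ('X_i1 * 'X_i2)) -[in RHS]half; ring.
Qed.

Lemma qform_delta : qform (delta_mx i1 i1 : 'M[K]_3) = 'X_i1 ^+ 2.
Proof. by rewrite /qform dotE !mxE !sum3 !mxE /= mulr0n mulr1n mpolyC0 mpolyC1; ring. Qed.

Lemma qform_normal_form (h1 h k : K) : h != 0 ->
  qform (h1 *: hyperbolic K) * qform (h *: hyperbolic K + k *: delta_mx i1 i1) =
  (h1 * h) *: normal_form (k / h).
Proof.
move=> h0; rewrite qformD !qformZ qform_hyperbolic qform_delta normal_formE.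
rewrite -!mul_mpolyC; have -> : k = h * (k / h) by field.
rewrite [h * (k / h) / h](_ : _ = k / h); last by field.
by rewrite !mpolyCM; ring.
Qed.

Lemma hilbert_burch_of_normal_form (M : 'M[K]_3) (c v : K) (F : R) :
  M \in unitmx -> c != 0 -> v != 0 -> lin_subst M F = c *: normal_form v ->
  hilbert_burch (grad F).
Proof.
move=> uM c0 v0 FE; apply: (hilbert_burch_msubst uM).
apply: (@hilbert_burch_mulmx _ _ M^T); first by rewrite unitmx_tr.
rewrite cmxT trmxK -grad_lin_subst FE gradZ.
exact/hilbert_burch_scale/normal_form_hilbert_burch.
Qed.

Variables q1 q2 : R.
Hypotheses (nd1 : nondegenerate_quadric q1) (nd2 : nondegenerate_quadric q2).
Hypothesis dist : distinct_quadrics q1 q2.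
Local Notation H1 := (hessian q1).
Local Notation H2 := (hessian q2).

(* A linear vector field [s] annihilating [q1 * q2] is tangent to each conic. *)
Lemma syzygy_eigen (s : 'rV[R]_3) : homog_row 1 s -> dot s (grad (q1 * q2)) = 0 ->
  exists c : K, dot s (grad q1) = c *: q1 /\ dot s (grad q2) = - c *: q2.
Proof.
move=> hs; rewrite gradM dotC dotDl !dotZl !(dotC _ s) => sF.
have [hq1 _] := nd1; have [hq2 _] := nd2.
have n1 := nondegenerate_neq0 two0 nd1; have n2 := nondegenerate_neq0 two0 nd2.
have [_ _ p1] := nondegenerate_prime two0 nd1.
have hc e (w p q : R) : q \is 2.-homog -> q != 0 -> (e + 2)%N = 2%N ->
    p \is 2.-homog -> p = w * q -> exists c : K, w = c%:MP.
  move=> hq q0 e0 hp pE; exists w@_0%MM; apply: homog0_const.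
  by apply: (homog_dvd_quot q0 hq); rewrite -pE.
have hd : dot s (grad q1) \is 2.-homog.
  apply: rpred_sum => i _; apply: (dhomogM_eq (hs i) (grad_homog hq1 i)).
  by [].
have : dvdr q1 (q2 * dot s (grad q1)).
  by exists (- dot s (grad q2)); rewrite mulNr [_ * q1]mulrC; apply/eqP; rewrite -addr_eq0 sF.
case/p1 => -[w wE].
  have [c cE] := hc 0%N w q2 q1 hq1 n1 erefl hq2 wE.
  have q2E : q2 = c *: q1 by rewrite wE cE mul_mpolyC.
  by case: (dist (c := c)) => //; apply: contraNneq n2 => c0; rewrite q2E c0 scale0r.
have [c cE] := hc 0%N w _ q1 hq1 n1 erefl hd wE.
have d1 : dot s (grad q1) = c *: q1 by rewrite wE cE mul_mpolyC.
exists c; split=> //; apply: (mulfI n1); apply/eqP; rewrite -subr_eq0 -[X in _ == X]sF d1.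
apply/eqP; rewrite -!mul_mpolyC mpolyCN; ring.
Qed.

Lemma lie_derivative (q : R) (A : 'M[K]_3) (c : K) : q \is 2.-homog ->
  dot (Xs *m cmx A) (grad q) = c *: q ->
  A *m hessian q + hessian q *m A^T = c *: hessian q.
Proof.
move=> hq; rewrite grad_quadric // dot_mulmx cmxT hessian_sym -mulmxA -cmxM dotC.
rewrite -/(qform _) => E; have /qform_inj : qform (2%:R *: (A *m hessian q)) = qform (c *: hessian q).
  by rewrite !qformZ E qform_hessian // !scalerA mulrC.
rewrite ![(_ *: _)^T]linearZ /= trmx_mul hessian_sym -scalerDr => E2.
by apply: (scalerI two0); rewrite E2 scaler_nat mulr2n.
Qed.

Lemma hilbert_burch_normal_form :
  lin_indep (grad (q1 * q2)) -> hilbert_burch (grad (q1 * q2)) ->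
  exists (M : 'M[K]_3) (c v : K),
    [/\ M \in unitmx, c != 0, v != 0 & lin_subst M (q1 * q2) = c *: normal_form v].
Proof.
move=> ind [s [t [hs ht GE _]]].
have [hq1 _] := nd1; have [hq2 _] := nd2.
have u1 := hessian_unit two0 nd1; have u2 := hessian_unit two0 nd2.
have [|c [c1 c2]] := syzygy_eigen hs; first by rewrite GE dot_crossl.
have sE := lin_coefsE hs; pose A := lin_coefs s; rewrite -/A in sE.
rewrite sE in c1 c2.
have A1 := lie_derivative hq1 c1; have A2 := lie_derivative hq2 c2.
(* Twice the trace of [A] is both 3c and -3c, so 6c = 0. *)
have c0 : c = 0.
  have := sim_trace u1 A1; rewrite (sim_trace u2 A2) mulNr => /eqP.
  rewrite eq_sym -addr_eq0 -mulr2n -[_ *+ 2]mulr_natr !mulf_eq0 (negbTE two0) (negbTE three0).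
  by rewrite !orbF => /eqP.
rewrite c0 oppr0 !scale0r in A1 A2.
have An0 : A != 0.
  apply/eqP => A0; have s0 : s = 0 by rewrite sE A0 /cmx map_mx0 mulmx0.
  have S : \sum_i (1 : K) *: (grad (q1 * q2)) 0 i = 0.
    rewrite GE s0 big1 // => i _.
    by rewrite -(scale0r 0) crossZl scale0r mxE scaler0.
  by have /eqP := ind (fun _ => 1) S i0; rewrite oner_eq0.
have [p p0 pA] : exists2 p : 'rV_3, p != 0 & p *m A = 0.
  by apply: (skew_singular two0 u1); rewrite hessian_sym.
(* The vector field vanishes at [p], hence so does the gradient, its cross product with [t]. *)
have gp : eval_row p (grad (q1 * q2)) = 0.
  have : eval_row p s = 0 by rewrite sE eval_row_lin.
  rewrite GE => /rowP sp; apply/rowP => j; rewrite [RHS]mxE mxE.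
  have s0 i : (s 0 i).@[p 0] = 0 by have := sp i; rewrite !mxE.
  by elim/ord3P: j; rewrite mxE /= mevalB !mevalM !s0 !mul0r subrr.
(* Euler's identity in degree 4 makes [q1 * q2] vanish at [p]. If the vanishing factor is [q2], the
   gradient at [p] is q1(p) times that of [q2], which is nonzero by smoothness. *)
have q1p : q1.@[p 0] = 0.
  have four0 : 4%:R != 0 :> K by move/pcharf0P: char0 => ->.
  have hF : q1 * q2 \is 4.-homog by apply: (dhomogM_eq hq1 hq2).
  have : (q1 * q2).@[p 0] = 0.
    apply: (mulfI four0); rewrite mulr0 -mevalZ -(grad_euler hF) eval_dot gp dotC.
    exact: dot0l.
  rewrite mevalM => /eqP; rewrite mulf_eq0 => /orP[/eqP // | /eqP q2p].
  have := nondegenerate_grad nd2 p0 q2p; case/rV0Pn => i; rewrite !mxE => gi.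
  move/rowP: gp => /(_ i); rewrite gradM !mxE mevalD !mevalM q2p mul0r add0r => /eqP.
  by rewrite mulf_eq0 (negbTE gi) orbF => /eqP.
have pHp : dot (p *m H1) p = 0.
  have : (qform H1).@[p 0] = 0 by rewrite (qform_hessian hq1) mevalZ q1p mulr0.
  rewrite /qform eval_dot eval_row_lin dotC => E; rewrite -[RHS]E; congr dot.
  by apply/rowP => i; rewrite !mxE mevalXU.
have [N [h [uN h0 N2 gram]]] := hyperbolic_basis two0 u1 (hessian_sym q1) p0 pHp.
pose A' := N *m A *m invmx N.
have conj H : H^T = H -> A *m H + H *m A^T = 0 ->
    A' *m (N *m H *m N^T) + (N *m H *m N^T) *m A'^T = 0.
  move=> sH skew; have -> : A' *m (N *m H *m N^T) = N *m (A *m H) *m N^T.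
    by rewrite /A' !mulmxA mulmxKV.
  have -> : N *m H *m N^T *m A'^T = N *m (H *m A^T) *m N^T.
    by rewrite /A' !trmx_mul !mulmxA trmx_inv mulmxK // unitmx_tr.
  by rewrite -mulmxDl -mulmxDr skew mulmx0 mul0mx.
have A'0 : A' != 0.
  apply: contra_neq An0 => A'0; have NA : N *m A = A' *m N by rewrite /A' mulmxKV.
  by rewrite -[A](mulKmx uN) NA A'0 mul0mx mulmx0.
have A'2 : row i2 A' = 0 by rewrite /A' !row_mul N2 pA mul0mx.
have skW : A' *m hyperbolic K + hyperbolic K *m A'^T = 0.
  have := conj _ (hessian_sym q1) A1; rewrite gram -scalemxAr -scalemxAl -scalerDr.
  by move/eqP; rewrite scaler_eq0 (negbTE h0) => /eqP.
have sH2 : (N *m H2 *m N^T)^T = N *m H2 *m N^T.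
  by rewrite !trmx_mul trmxK hessian_sym mulmxA.
have uH2 : N *m H2 *m N^T \in unitmx by rewrite !unitmx_mul uN u2 unitmx_tr.
have [h' h'0 [k H2E]] := common_skew_form two0 A'0 A'2 sH2 uH2 skW
  (conj _ (hessian_sym q2) A2).
have l1 : 2%:R *: lin_subst N^T q1 = qform (h *: hyperbolic K).
  by rewrite -lin_substZ -(qform_hessian hq1) lin_subst_qform trmxK gram.
have l2 : 2%:R *: lin_subst N^T q2 = qform (h' *: hyperbolic K + k *: delta_mx i1 i1).
  by rewrite -lin_substZ -(qform_hessian hq2) lin_subst_qform trmxK H2E.
(* The factor 1/4 appears because each Hessian represents twice its conic. *)
exists N^T, (4%:R^-1 * (h * h')), (k / h').
have four0 : 4%:R != 0 :> K by move/pcharf0P: char0 => ->.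
split; rewrite ?unitmx_tr ?mulf_neq0 ?invr_eq0 //.
  (* If [k] were 0, both conics would be multiples of the same form, hence proportional. *)
  apply/eqP => k0; case: (dist (c := h' / h)); first by rewrite mulf_neq0 ?invr_eq0.
  have K1 q : lin_subst (invmx N^T) (lin_subst N^T q) = q.
    by rewrite lin_subst_comp mulmxV ?lin_subst1 // unitmx_tr.
  rewrite -[LHS]K1 -[q1]K1 -lin_substZ; congr lin_subst; apply: (scalerI two0).
  rewrite l2 k0 scale0r addr0 scalerA mulrC -scalerA l1 !qformZ scalerA.
  by congr (_ *: _); field.
rewrite -scalerA -qform_normal_form // -l1 -l2 lin_substM.
rewrite -scalerAl -scalerAr !scalerA -[LHS]scale1r; congr (_ *: _); field.
by [].
Qed.

End QuadricPairs.

Theorem proposition4p11 (K : fieldType) (q1 q2 F : {mpoly K[3]})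
    (hq1 : nondegenerate_quadric q1) (hq2 : nondegenerate_quadric q2)
    (hq : distinct_quadrics q1 q2) (hF : F = q1 * q2)
    (hind : alg_independent [tuple F^`M(i) | i < 3]) :
  let J := jacobian_ideal F in
  let cond_i := [/\ codim J 2, perfect J &
    has_minimal_resolution J [:: [:: 3; 3; 3]; [:: 4; 5]]%N] in
  let cond_ii := indeg_syz F 1 /\ degree J 7 in
  let cond_iii := free_divisor F in
  let cond_iv := exists (M : 'M[K]_3) (c v : K),
    [/\ M \in unitmx, c != 0, v != 0 & lin_subst M F = c *: normal_form v] in
  [/\ cond_i <-> cond_ii,
      cond_ii <-> cond_iii
    & [pchar K] =i pred0 -> (cond_iii <-> cond_iv)].
Proof.
move=> J cond_i cond_ii cond_iii cond_iv.
have hF4 : F \is 4.-homog by rewrite hF; apply: dhomogM (proj1 hq1) (proj1 hq2).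
have G3 := grad_homog hF4; have indG := alg_independent_lin_indep hind.
have JE : J = row_ideal (grad F) by exact: jacobian_idealE.
have hb_iii : hilbert_burch (grad F) -> cond_iii.
  move=> hb; have cod := hilbert_codim_le2 G3 (hb_hilbert G3 indG hb).
  have [s [t [hs ht GE gen]]] := hb.
  by rewrite /cond_iii /free_divisor -/J JE; apply: (hb_codim_perfect G3 indG hs ht GE gen cod).
have iii_hb : cond_iii -> hilbert_burch (grad F).
  by rewrite /cond_iii /free_divisor -/J JE => -[]; apply: free_hilbert_burch.
have hb_i : hilbert_burch (grad F) -> cond_i.
  move=> hb; have [cod perf] := hb_iii hb; split=> //.
  have [s [t [hs ht GE gen]]] := hb.
  by rewrite JE; apply: (hb_resolution G3 indG hs ht GE gen).
have hb_ii : hilbert_burch (grad F) -> cond_ii.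
  by move=> hb; split; [apply: hb_indeg | rewrite JE; apply: hb_degree7].
have ii_hb : cond_ii -> hilbert_burch (grad F).
  case=> -[[l [l0 /is_syzygyE lG hl]] _]; rewrite JE => deg.
  have [N hN] := degree7_hilbert G3 indG deg.
  exact: (lin_syz_hilbert_burch G3 indG hN hl l0 lG).
have i_hb : cond_i -> hilbert_burch (grad F) by case=> cod perf _; apply: iii_hb.
split.
- by split=> [/i_hb | /ii_hb].
- by split=> [/ii_hb | /iii_hb].
move=> char0; split=> [/iii_hb hb | [M [c [v [uM c0 v0 FE]]]]].
  by rewrite /cond_iv hF; apply: hilbert_burch_normal_form; rewrite -?hF.
exact/hb_iii/(hilbert_burch_of_normal_form char0 uM c0 v0 FE).
Qed.
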